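(* Let $X$ be a topological space, let $\mathbb O(X)$ be its set of open subsets, and let $Y:=2^{\mathbb O(X)}$ be the power set of $\mathbb O(X)$, equipped with the topology that has as a basis the sets $Y_{\supseteq F}:=\{y\in Y\mid y\supseteq F\}$ for finite subsets $F\subseteq\mathbb O(X)$. Then the category of $C^*$-algebras $A$ equipped with an arbitrary map $f\colon\mathbb O(X)\to\mathbb I(A)$ is isomorphic to the category of $C^*$-algebras over $Y$.
   Context: $\mathbb I(A)$ denotes the set of closed two-sided ($*$-)ideals of a $C^*$-algebra $A$, identified with the set of open subsets of the primitive ideal space $\mathrm{Prim}(A)$ (hull-kernel topology) via $U\mapsto\bigcap_{\mathfrak p\in\mathrm{Prim}(A)\setminus U}\mathfrak p$. Category of $C^*$-algebras with a map $\mathbb O(X)\to\mathbb I(A)$: objects are pairs $(A,f_A)$ with $A$ a $C^*$-algebra and $f_A\colon\mathbb O(X)\to\mathbb I(A)$ any map of sets; morphisms $(A,f_A)\to(B,f_B)$ are $*$-homomorphisms $h\colon A\to B$ with $h(f_A(U))\subseteq f_B(U)$ for all $U\in\mathbb O(X)$. Category of $C^*$-algebras over a topological space $Y$: objects are pairs $(A,\psi)$ with $A$ a $C^*$-algebra and $\psi\colon\mathrm{Prim}(A)\to Y$ continuous; for open $V\subseteq Y$ let $A(V)\in\mathbb I(A)$ be the ideal corresponding to $\psi^{-1}(V)$; morphisms are $*$-homomorphisms $h\colon A\to B$ with $h(A(V))\subseteq B(V)$ for all open $V\subseteq Y$. *)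

(* Defs.v *)
From HB Require Import structures.
From mathcomp Require Import all_boot all_order all_algebra.
From mathcomp Require Import sesquilinear.
From mathcomp Require Export complex.
From mathcomp Require Import all_classical all_reals.
From mathcomp Require Import topology normedtype.

Set Implicit Arguments.
Unset Strict Implicit.
Unset Printing Implicit Defensive.

Import Order.TTheory GRing.Theory Num.Theory.
Import numFieldNormedType.Exports.

Local Open Scope classical_set_scope.
Local Open Scope ring_scope.

(* The complex numbers are R[i] with R : realType.  Norms of complex normed
   modules take their values in (the nonnegative reals of) R[i]. *)

(* C*-algebras are not assumed unital, so the product is not a MathComp ring
   multiplication. *)
HB.mixin Record isCStarAlgebra (R : realType) A
    of CompleteNormedModule R[i] A := {
  cmul : A -> A -> A ;
  star : A -> A ;
  cmulA : associative cmul ;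
  cmulDl : left_distributive cmul +%R ;
  cmulDr : right_distributive cmul +%R ;
  cmulZl : forall (c : R[i]) (a b : A), cmul (c *: a) b = c *: cmul a b ;
  cmulZr : forall (c : R[i]) (a b : A), cmul a (c *: b) = c *: cmul a b ;
  starK : involutive star ;
  starD : {morph star : a b / a + b} ;
  starZ : forall (c : R[i]) (a : A), star (c *: a) = Num.conj c *: star a ;
  starM : forall a b : A, star (cmul a b) = cmul (star b) (star a) ;
  norm_cmul : forall a b : A, `|cmul a b| <= `|a| * `|b| ;
  norm_cstar : forall a : A, `|cmul (star a) a| = `|a| ^+ 2
}.

#[short(type="cstarAlgType")]
HB.structure Definition CStarAlgebra (R : realType) :=
  {A of isCStarAlgebra R A & CompleteNormedModule R[i] A}.

(* The inner product is linear in its first argument and conjugate-linear in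
   its second one. *)
HB.mixin Record isHilbert (R : realType) H of CompleteNormedModule R[i] H := {
  hdot : {dot H for Num.conj} ;
  hdot_norm : forall x : H, hdot x x = `|x| ^+ 2
}.

#[short(type="hilbertType")]
HB.structure Definition Hilbert (R : realType) :=
  {H of isHilbert R H & CompleteNormedModule R[i] H}.

Definition closed_subspace (K : numFieldType) (V : normedModType K)
    (S : set V) : Prop :=
  [/\ closed S, S 0 & forall (c : K) (x y : V), S x -> S y -> S (c *: x + y)].

Section Ideals.
Context {R : realType}.
Implicit Type A : cstarAlgType R.

Record closed_ideal A := ClosedIdeal {
  ideal_set :> set A ;
  ideal_closed_subspace : closed_subspace ideal_set ;
  ideal_mull : forall a b, ideal_set b -> ideal_set (cmul a b) ;
  ideal_mulr : forall a b, ideal_set a -> ideal_set (cmul a b) ;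
  ideal_star : forall a, ideal_set a -> ideal_set (star a)
}.

Record is_representation A (H : hilbertType R) (pi : A -> {linear H -> H}) :
    Prop := IsRepresentation {
  repr_continuous : forall a, continuous (pi a) ;
  repr_linear : forall (c : R[i]) a b x,
    pi (c *: a + b) x = c *: pi a x + pi b x ;
  repr_mul : forall a b x, pi (cmul a b) x = pi a (pi b x) ;
  repr_star : forall a x y, hdot (pi (star a) x) y = hdot x (pi a y)
}.

Definition nonzero_irreducible A (H : hilbertType R)
    (pi : A -> {linear H -> H}) : Prop :=
  [/\ is_representation pi,
      exists a x, pi a x <> 0
    & forall S : set H, closed_subspace S ->
        (forall a x, S x -> S (pi a x)) -> S = [set 0] \/ S = setT].

Definition primitive A (p : closed_ideal A) : Prop :=
  exists (H : hilbertType R) (pi : A -> {linear H -> H}),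
    nonzero_irreducible pi /\
    (p : set A) = [set a | forall x, pi a x = 0].

Record Prim A := MkPrim {
  prim_ideal :> closed_ideal A ;
  prim_primitive : primitive prim_ideal
}.

Section Kernel.
Variable A : cstarAlgType R.
Implicit Type T : set (Prim A).

Let kernel_set T : set A := \bigcap_(p in T) (p : set A).

Let kernel_closed_subspace T : closed_subspace (kernel_set T).
Proof.
split; first by apply: closed_bigI => p _; case: (ideal_closed_subspace p).
- by move=> p _; case: (ideal_closed_subspace p).
- move=> c x y Sx Sy p Tp; case: (ideal_closed_subspace p) => _ _; apply.
  + exact: Sx.
  + exact: Sy.
Qed.

Let kernel_mull T a b : kernel_set T b -> kernel_set T (cmul a b).
Proof. by move=> Tb p Tp; apply/ideal_mull/Tb. Qed.

Let kernel_mulr T a b : kernel_set T a -> kernel_set T (cmul a b).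
Proof. by move=> Ta p Tp; apply/ideal_mulr/Ta. Qed.

Let kernel_star T a : kernel_set T a -> kernel_set T (star a).
Proof. by move=> Ta p Tp; apply/ideal_star/Ta. Qed.

(* The intersection of the primitive ideals in T (all of A if T is empty). *)
Definition kernel T : closed_ideal A :=
  @ClosedIdeal A (kernel_set T) (kernel_closed_subspace T)
    (@kernel_mull T) (@kernel_mulr T) (@kernel_star T).

Definition ideal_of_open (U : set (Prim A)) : closed_ideal A := kernel (~` U).

Definition hull_kernel_closure T : set (Prim A) :=
  [set p : Prim A | kernel T `<=` p].

Lemma prim_proper (p : Prim A) : ~ ([set: A] `<=` p).
Proof.
case: p => p [H [pi [[_ [a [x piax0]] _] pE]]] /= /(_ a I).
by rewrite pE => /(_ x).
Qed.

Lemma prim_prime (p : Prim A) (I J : closed_ideal A) :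
  I `&` J `<=` p -> I `<=` p \/ J `<=` p.
Proof.
case: p => p [H [pi [[[pic pil pim pis] _ irr] pE]]] /= IJp.
rewrite pE in IJp *.
have [Jp|] := pselect (J `<=` [set a | forall x, pi a x = 0]); first by right.
move=> /existsNP[j] /not_implyP[Jj] /= /existsNP[x jx0]; left => i Ii /= y.
pose K : set H := [set z | forall k, (I : set A) k -> pi k z = 0].
have Ksub : closed_subspace K.
  split.
  - have -> : K = \bigcap_(i in (I : set A)) (pi i @^-1` [set 0]).
      by apply/seteqP; split.
    apply: closed_bigI => k _; apply: closed_comp.
      by move=> z _; exact: pic.
    exact: (accessible_closed_set1 (hausdorff_accessible (@norm_hausdorff _ H))).
  - by move=> k _; rewrite linear0.
  - by move=> c u v Ku Kv k Ik; rewrite linearP Ku// Kv// scaler0 addr0.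
have [|K0|KT] := irr K Ksub.
- by move=> a z Kz k Ik; rewrite -pim; apply/Kz/ideal_mulr.
- have : K (pi j x).
    move=> k Ik; rewrite -pim; apply: IJp; split.
      exact: ideal_mulr.
    exact: ideal_mull.
  by rewrite K0 => /jx0.
- have : K y by rewrite KT.
  exact.
Qed.

Let hk_open (W : set (Prim A)) := hull_kernel_closure (~` W) `<=` ~` W.

Let hk_openT : hk_open setT.
Proof. by move=> p /= pT _; apply: (@prim_proper p) => a _; apply: pT => q []. Qed.

Let hk_openI : setI_closed hk_open.
Proof.
move=> V W oV oW p /= VWp [Vp Wp].
have [|Vsub|Wsub] := @prim_prime p (kernel (~` V)) (kernel (~` W)).
- move=> a [aV aW]; apply: VWp => q; rewrite setCI => -[Vq|Wq].
    exact: aV.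
  exact: aW.
- exact: (oV p Vsub).
- exact: (oW p Wsub).
Qed.

Let hk_open_bigU (I : Type) (f : I -> set (Prim A)) :
  (forall i, hk_open (f i)) -> hk_open (\bigcup_i f i).
Proof.
move=> of_ p /= fp [i _ fip]; apply: (of_ i p) => //= a ai; apply: fp => q fq.
by apply: ai => fiq; apply: fq; exists i.
Qed.

HB.instance Definition _ := gen_eqMixin (Prim A).
HB.instance Definition _ := gen_choiceMixin (Prim A).
HB.instance Definition _ :=
  isOpenTopological.Build (Prim A) hk_openT hk_openI hk_open_bigU.

Lemma closed_hull_kernel T : closed T <-> hull_kernel_closure T `<=` T.
Proof. by rewrite -openC -{2 3}(setCK T). Qed.

Lemma closure_hull_kernel T : closure T = hull_kernel_closure T.
Proof.
have TT : T `<=` hull_kernel_closure T by move=> p Tp a; exact.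
apply/seteqP; split.
- have /closure_id -> : closed (hull_kernel_closure T).
    apply/closed_hull_kernel => p Kp a Ta.
    by apply: Kp => q; exact.
  exact: closure_subset.
- move=> p Tp; have /closed_hull_kernel := @closed_closure _ T; apply.
  by move=> a cTa; apply: Tp => q Tq; apply/cTa/subset_closure.
Qed.

End Kernel.
End Ideals.

Definition opens (X : topologicalType) := {U : set X | open U}.

Definition power_opens (X : topologicalType) := set (opens X).

Section PowerOpens.
Variable X : topologicalType.

Definition Ysup (F : set (opens X)) : set (power_opens X) :=
  [set y : power_opens X | F `<=` y].

Let Ysup_cover : \bigcup_(F in [set F | finite_set F]) Ysup F = setT.
Proof.
apply/seteqP; split=> // y _; exists set0; [exact: finite_set0|by move=> U].
Qed.

Let Ysup_join (F G : set (opens X)) (y : power_opens X) :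
  finite_set F -> finite_set G -> Ysup F y -> Ysup G y ->
  exists E, [/\ finite_set E, Ysup E y & Ysup E `<=` Ysup F `&` Ysup G].
Proof.
move=> fF fG Fy Gy; exists (F `|` G); split.
- by rewrite finite_setU.
- by move=> U [/Fy|/Gy].
- by move=> z FGz; split=> U ?; apply: FGz; [left|right].
Qed.

HB.instance Definition _ := gen_eqMixin (power_opens X).
HB.instance Definition _ := gen_choiceMixin (power_opens X).
HB.instance Definition _ :=
  isBaseTopological.Build (power_opens X) Ysup_cover Ysup_join.

Lemma open_power_opens (V : set (power_opens X)) :
  open V <-> exists2 D : set (set (opens X)),
    D `<=` [set F | finite_set F] & \bigcup_(F in D) Ysup F = V.
Proof. by []. Qed.

End PowerOpens.

Record category := Category {
  Ob : Type ;
  Hom : Ob -> Ob -> Type ;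
  idm : forall x, Hom x x ;
  compm : forall x y z, Hom y z -> Hom x y -> Hom x z ;
  comp1m : forall x y (f : Hom x y), compm (idm y) f = f ;
  compm1 : forall x y (f : Hom x y), compm f (idm x) = f ;
  compmA : forall x y z t (h : Hom z t) (g : Hom y z) (f : Hom x y),
    compm h (compm g f) = compm (compm h g) f
}.
Arguments Hom {c}.
Arguments idm {c}.
Arguments compm {c x y z}.

Record functor (C D : category) := Functor {
  fob : Ob C -> Ob D ;
  fmap : forall x y, Hom x y -> Hom (fob x) (fob y) ;
  fmap_id : forall x, fmap (idm x) = idm (fob x) ;
  fmap_comp : forall x y z (g : Hom y z) (f : Hom x y),
    fmap (compm g f) = compm (fmap g) (fmap f)
}.
Arguments fmap {C D} _ {x y}.

Definition functor_id (C : category) : functor C C :=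
  @Functor C C id (fun _ _ => id) (fun=> erefl) (fun _ _ _ _ _ => erefl).

Section FunctorComp.
Variables (C D E : category) (G : functor D E) (F : functor C D).

Let GF_map x y (f : Hom x y) : Hom (fob G (fob F x)) (fob G (fob F y)) :=
  fmap G (fmap F f).

Let GF_id x : GF_map (idm x) = idm (fob G (fob F x)).
Proof. by rewrite /GF_map !fmap_id. Qed.

Let GF_comp x y z (g : Hom y z) (f : Hom x y) :
  GF_map (compm g f) = compm (GF_map g) (GF_map f).
Proof. by rewrite /GF_map !fmap_comp. Qed.

Definition functor_comp : functor C E := Functor GF_id GF_comp.

End FunctorComp.

Definition isomorphic_categories (C D : category) : Prop :=
  exists (F : functor C D) (G : functor D C),
    functor_comp G F = functor_id C /\ functor_comp F G = functor_id D.

Section StarHom.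
Context {R : realType}.
Implicit Type A B C : cstarAlgType R.

Record star_hom A B := StarHom {
  star_hom_fun :> A -> B ;
  star_hom_linear : forall (c : R[i]) (a b : A),
    star_hom_fun (c *: a + b) = c *: star_hom_fun a + star_hom_fun b ;
  star_hom_mul : {morph star_hom_fun : a b / cmul a b} ;
  star_hom_star : {morph star_hom_fun : a / star a}
}.

Lemma star_hom_eq A B (f g : star_hom A B) :
  (f : A -> B) = g -> f = g.
Proof.
case: f g => f f1 f2 f3 [g g1 g2 g3] /= fg; case: g / fg g1 g2 g3 => *.
by congr StarHom; exact: Prop_irrelevance.
Qed.

Definition star_hom_id A : star_hom A A :=
  @StarHom A A id (fun _ _ _ => erefl) (fun _ _ => erefl) (fun=> erefl).

Definition star_hom_comp A B C (g : star_hom B C) (f : star_hom A B) :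
  star_hom A C.
Proof.
refine (@StarHom A C (g \o f) _ _ _) => /=.
- by move=> c a b; rewrite /= !star_hom_linear.
- by move=> a b; rewrite /= !star_hom_mul.
- by move=> a; rewrite /= !star_hom_star.
Defined.

End StarHom.

(* Both categories below are instances of the following construction: objects
   of type O have an underlying C*-algebra and a family of ideals indexed by S,
   and morphisms are the *-homomorphisms that preserve this family. *)
Section IdealFamilyCategory.
Context {R : realType} (O S : Type) (alg : O -> cstarAlgType R)
  (ideal : forall x : O, S -> closed_ideal (alg x)).

Record ideal_hom (x y : O) := IdealHom {
  ideal_hom_fun :> star_hom (alg x) (alg y) ;
  ideal_hom_sub : forall s : S, ideal_hom_fun @` ideal x s `<=` ideal y s
}.

Lemma ideal_hom_eq x y (f g : ideal_hom x y) :
  (f : alg x -> alg y) = g -> f = g.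
Proof.
case: f g => f f1 [g g1] /= /star_hom_eq fg; case: g / fg g1 => *.
by congr IdealHom; exact: Prop_irrelevance.
Qed.

Definition ideal_hom_id x : ideal_hom x x.
Proof. by exists (star_hom_id (alg x)) => s _ [a ? <-]. Defined.

Definition ideal_hom_comp x y z (g : ideal_hom y z) (f : ideal_hom x y) :
  ideal_hom x z.
Proof.
exists (star_hom_comp g f) => s _ [a xa <-] /=.
by apply: (ideal_hom_sub (s := s)); exists (f a) => //;
  apply: (ideal_hom_sub (s := s)); exists a.
Defined.

Definition ideal_family_category : category.
Proof.
refine (@Category O ideal_hom ideal_hom_id ideal_hom_comp _ _ _).
all: by move=> *; exact: ideal_hom_eq.
Defined.

End IdealFamilyCategory.

Section Categories.
Variable R : realType.

Record ideal_map_algebra (X : topologicalType) := IdealMapAlgebra {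
  ima_alg : cstarAlgType R ;
  ima_map : opens X -> closed_ideal ima_alg
}.

Definition ideal_map_category (X : topologicalType) : category :=
  ideal_family_category (@ima_map X).

Record algebra_over (Y : topologicalType) := AlgebraOver {
  over_alg : cstarAlgType R ;
  over_map : Prim over_alg -> Y ;
  over_continuous : continuous over_map
}.

Definition over_ideal (Y : topologicalType) (A : algebra_over Y)
    (V : opens Y) : closed_ideal (over_alg A) :=
  ideal_of_open (@over_map Y A @^-1` (sval V)).

Definition algebra_over_category (Y : topologicalType) : category :=
  ideal_family_category (@over_ideal Y).

End Categories.

(* Main.v *)
Require Import Defs.
From HB Require Import structures.
From mathcomp Require Import all_boot all_order all_algebra.
From mathcomp Require Import sesquilinear.
From mathcomp Require Import complex.
From mathcomp Require Import all_classical all_reals topology normedtype sequences.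
From mathcomp Require Import ring lra.

(* Maps Prim(A) -> 2^O(X) are families of subsets of Prim(A) indexed by O(X), and
   such a map is continuous iff all these subsets are open, so everything rests
   on the correspondence between open subsets of Prim(A) and closed ideals.  It
   amounts to: if [a] is not in the closed ideal [I], then some irreducible
   representation vanishes on [I] but not at [a].

   In the multiplier algebra [M], call an element positive when it is so modulo
   [I].  By Kaplansky's argument every [y^*y] is positive, and an approximate
   unit of [I] shows that [a^*a] has positive upper bounds modulo [I] bounded
   away from 0.  A Zorn argument on sublinear functionals, which is
   Hahn-Banach and Krein-Milman in one, then gives a pure state of [M] vanishing
   on [I] and positive at [a^*a]; its GNS representation is irreducible. *)

(** No spectrum or functional calculus enters. The basic tool is a square root of [1 - h] for
    selfadjoint [h] of norm less than 1; positivity is a norm inequality, and bounds are certified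
    by writing elements as sums of squares. Since the root is constructed only for norm strictly
    below 1, many arguments carry an extra [e > 0] that is removed at the end.

    [A] need not have a unit, hence the multiplier algebra. The quotient by [I] is never formed: an
    inequality modulo [I] is one in the multiplier algebra up to adding a selfadjoint element of
    [I].

    The separation statement is used twice: to recover an ideal from its open set, and for
    morphisms, where compatibility with the sets indexed by [O(X)] has to imply compatibility with
    every open set of [2^O(X)]. Isomorphism of categories means equality of functors, not natural
    isomorphism; it holds because both functors leave the underlying algebras and homomorphisms
    untouched. *)

Set Implicit Arguments.
Unset Strict Implicit.
Unset Printing Implicit Defensive.

Import Order.TTheory GRing.Theory Num.Theory.
Import numFieldNormedType.Exports.

Local Open Scope classical_set_scope.
Local Open Scope complex_scope.
Local Open Scope ring_scope.

(** * Linear identities *)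

(* The square-zero extension of a commutative ring by a module: it embeds the
   module in a commutative ring, where the [ring] tactic decides linear
   identities. *)
Section SquareZeroExtension.
Variables (K : comNzRingType) (V : lmodType K).

Definition sqz : Type := (K * V)%type.
HB.instance Definition _ := GRing.Zmodule.on sqz.

Definition sqz_one : sqz := (1, 0).
Definition sqz_mul (x y : sqz) : sqz := (x.1 * y.1, x.1 *: y.2 + y.1 *: x.2).

Let sqz_mulA : associative sqz_mul.
Proof.
move=> [a u] [b v] [c w]; congr (_, _); first exact: mulrA.
by rewrite /= !scalerDr !scalerA addrA (mulrC c a) (mulrC c b).
Qed.

Let sqz_mulC : commutative sqz_mul.
Proof. by move=> [a u] [b v]; congr (_, _); [exact: mulrC|rewrite /= addrC]. Qed.

Let sqz_mul1 : left_id sqz_one sqz_mul.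
Proof.
by move=> [b v]; congr (_, _); rewrite /= ?mul1r// scale1r scaler0 addr0.
Qed.

Let sqz_mulDl : left_distributive sqz_mul +%R.
Proof.
move=> [a u] [b v] [c w]; congr (_, _); first exact: mulrDl.
by rewrite /= scalerDl scalerDr addrACA.
Qed.

Let sqz1_neq0 : sqz_one != 0.
Proof. by apply/eqP => -[/eqP]; rewrite oner_eq0. Qed.

HB.instance Definition _ := GRing.Zmodule_isComNzRing.Build sqz
  sqz_mulA sqz_mulC sqz_mul1 sqz_mulDl sqz1_neq0.

Definition sqz_in (v : V) : sqz := (0, v).
Definition sqz_cst (c : K) : sqz := (c, 0).

Lemma sqz_in_inj : injective sqz_in. Proof. by move=> u v []. Qed.
Lemma sqz_inD u v : sqz_in (u + v) = sqz_in u + sqz_in v.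
Proof. by congr (_, _); rewrite /= addr0. Qed.
Lemma sqz_inN u : sqz_in (- u) = - sqz_in u.
Proof. by congr (_, _); rewrite /= oppr0. Qed.
Lemma sqz_in0 : sqz_in 0 = 0. Proof. by []. Qed.
Lemma sqz_inZ c u : sqz_in (c *: u) = sqz_cst c * sqz_in u.
Proof. by congr (_, _); rewrite /= ?mulr0// scale0r addr0. Qed.
Lemma sqz_cstD a b : sqz_cst (a + b) = sqz_cst a + sqz_cst b.
Proof. by congr (_, _); rewrite /= addr0. Qed.
Lemma sqz_cstN a : sqz_cst (- a) = - sqz_cst a.
Proof. by congr (_, _); rewrite /= oppr0. Qed.
Lemma sqz_cstM a b : sqz_cst (a * b) = sqz_cst a * sqz_cst b.
Proof. by congr (_, _); rewrite /= !scaler0 addr0. Qed.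
Lemma sqz_cst1 : sqz_cst 1 = 1. Proof. by []. Qed.
Lemma sqz_cst0 : sqz_cst 0 = 0. Proof. by []. Qed.

End SquareZeroExtension.

Ltac linear_identity :=
  apply: sqz_in_inj;
  rewrite ?(sqz_inD, sqz_inN, sqz_in0, sqz_inZ, sqz_cstD, sqz_cstN, sqz_cstM,
    sqz_cst1, sqz_cst0);
  ring.

(** * Real-valued norms *)

Section RealNorm.
Context {R : realType}.
Implicit Type V : normedModType R[i].

(** Norms take values in [R[i]], whose order is only partial; over [R] the tactics [lra] and [nra]
    apply. *)
Definition nr V (x : V) : R := complex.Re `|x|.

Lemma nrE V (x : V) : `|x| = (nr x)%:C.
Proof. by rewrite /nr RRe_real// ger0_real. Qed.

Lemma nr_ge0 V (x : V) : 0 <= nr x.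
Proof. by rewrite -ler0c -nrE. Qed.

Lemma nr0 V : nr (0 : V) = 0.
Proof. by apply: complexI; rewrite -nrE normr0. Qed.

Lemma nr0_eq0 V (x : V) : nr x = 0 -> x = 0.
Proof. by move=> x0; apply/normr0_eq0; rewrite nrE x0. Qed.

Lemma nrD V (x y : V) : nr (x + y) <= nr x + nr y.
Proof. by rewrite -lecR rmorphD/= -!nrE ler_normD. Qed.

Lemma nrZ V (c : R[i]) (x : V) : nr (c *: x) = complex.Re `|c| * nr x.
Proof.
by apply: complexI; rewrite -nrE normrZ nrE rmorphM/= RRe_real// ger0_real.
Qed.

Lemma nrZr V (r : R) (x : V) : nr (r%:C *: x) = `|r| * nr x.
Proof. by rewrite nrZ normc_def/= expr0n/= addr0 sqrtr_sqr. Qed.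

Lemma nrN V (x : V) : nr (- x) = nr x.
Proof. by rewrite /nr normrN. Qed.

Lemma nrB V (x y : V) : nr (x - y) <= nr x + nr y.
Proof. by rewrite -(nrN y); exact: nrD. Qed.

Lemma nr_distC V (x y : V) : nr (x - y) = nr (y - x).
Proof. by rewrite -nrN opprB. Qed.

Lemma nr_dist_le V (x y : V) : nr x - nr y <= nr (x - y).
Proof. by rewrite lerBlDr -{1}(subrK y x) nrD. Qed.

Lemma nr_le_eq0 V (x : V) : (forall e, 0 < e -> nr x <= e) -> x = 0.
Proof.
move=> h; apply: nr0_eq0; apply/eqP; rewrite eq_le nr_ge0 andbT.
by apply/ler_addgt0Pl => e e0; rewrite addr0; exact: h.
Qed.

Lemma nr_lt V (x : V) (e : R) : (`|x| < e%:C) = (nr x < e).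
Proof. by rewrite nrE ltcR. Qed.

Lemma gt0_real_complex (c : R[i]) : 0 < c -> exists2 e : R, 0 < e & c = e%:C.
Proof.
by case: c => a b; rewrite ltcE/= => /andP[/eqP -> a0]; exists a.
Qed.

Lemma nr_ball V (x y : V) (e : R) : ball x e%:C y <-> nr (x - y) < e.
Proof. by rewrite -ball_normE/= nr_lt. Qed.

Definition cauchy_nr V (u : nat -> V) :=
  forall e : R, 0 < e -> exists N : nat,
    forall m n, (N <= m)%N -> (N <= n)%N -> nr (u m - u n) <= e.

Definition cvg_nr V (u : nat -> V) (l : V) :=
  forall e : R, 0 < e -> exists N : nat, forall n, (N <= n)%N -> nr (u n - l) <= e.

Lemma cauchy_cvg_nr (V : completeNormedModType R[i]) (u : nat -> V) :
  cauchy_nr u -> exists l, cvg_nr u l.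
Proof.
move=> cu.
have : cvg (u @ \oo).
  apply/cauchy_cvgP/cauchy_ballP => c c0.
  have [e e0 ->] := gt0_real_complex c0.
  have [N uN] := cu (e / 2) (divr_gt0 e0 (ltr0Sn _ 1)).
  exists ([set u n | n in [set n | (N <= n)%N]],
          [set u n | n in [set n | (N <= n)%N]]).
    by split; exists N => // n /= Nn; exists n.
  move=> [a b] /= [[m Nm <-] [n Nn <-]].
  by apply/nr_ball/(le_lt_trans (uN _ _ Nm Nn)); lra.
move=> /cvg_ex[l ul]; exists l => e e0.
have /cvgrPdist_le/(_ e%:C) := ul; rewrite ltcR => /(_ e0)[N _ uN].
by exists N => n /uN /=; rewrite nrE lecR nr_distC.
Qed.

(** The structures ask for completeness by filters. A Cauchy filter contains a ball of radius
    [1/(n+1)] for each [n]; the centres form a Cauchy sequence with the same limit. *)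
Lemma complete_nr V :
  (forall u : nat -> V, cauchy_nr u -> exists l, cvg_nr u l) ->
  forall F : set_system V, ProperFilter F -> cauchy F -> cvg F.
Proof.
move=> cV F FF /cauchyP Fc.
have [d [d0 small d_le]] : exists d : nat -> R, [/\ forall n, 0 < d n,
    forall e, 0 < e -> exists N, d N < e
    & forall m n, (n <= m)%N -> d m <= d n].
  exists (fun n => n.+1%:R^-1); split=> [n|e|m n nm]; first by rewrite invr_gt0.
  2: by rewrite lef_pV2 ?posrE// ler_nat.
  move=> e0; exists (Num.truncn e^-1).
  rewrite invf_plt ?posrE//.
  by have /Num.Theory.truncn_itv/andP[] : 0 <= e^-1 by rewrite invr_ge0 ltW.
have /choice[u uP] n : exists x, F (ball x (d n)%:C).
  by apply: Fc; rewrite ltcR.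
have [e e0|l ul] := cV u.
  have [N Ne] := small (e / 2) (divr_gt0 e0 (ltr0Sn _ 1)); exists N => m n Nm Nn.
  have [x [/nr_ball xm /nr_ball xn]] := filter_ex (filterI (uP m) (uP n)).
  rewrite -(subrK x (u m)) -addrA; apply: (le_trans (nrD _ _)).
  rewrite (nr_distC x).
  by have := d_le _ _ Nm; have := d_le _ _ Nn; lra.
apply/cvg_ex; exists l; apply/cvg_ballP => c c0.
have [e e0 ->] := gt0_real_complex c0.
have [N Ne] := small (e / 2) (divr_gt0 e0 (ltr0Sn _ 1)).
have e40 : 0 < e / 4 by apply: divr_gt0.
have [M uM] := ul (e / 4) e40.
have [//|N' N'e] := small (e / 4).
pose k := maxn M N'.
apply: filterS (uP k) => x /nr_ball xk; apply/nr_ball.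
rewrite -(subrK (u k) l) -addrA; apply: (le_lt_trans (nrD _ _)).
have := uM k (leq_maxl _ _); rewrite nr_distC.
by have := d_le _ _ (leq_maxr M N'); rewrite -/k; lra.
Qed.

Lemma closed_nr V (S : set V) : closed S <->
  (forall x, (forall e : R, 0 < e -> exists2 s, S s & nr (x - s) <= e) -> S x).
Proof.
split=> [cS x xS|h].
  apply: cS => B /nbhs_ballP[c /= c0 xB].
  have [e e0 ce] := gt0_real_complex c0.
  have [s Ss xs] := xS (e / 2) (divr_gt0 e0 (ltr0Sn _ 1)).
  exists s; split=> //; apply: xB; rewrite ce; apply/nr_ball.
  by apply: (le_lt_trans xs); lra.
move=> x clx; apply: h => e e0.
have [|s [Ss /nr_ball xs]] := clx (ball x e%:C).
  by apply: nbhsx_ballx; rewrite ltcR.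
by exists s => //; exact: ltW.
Qed.

Lemma continuous_nr V (W : normedModType R[i]) (f : V -> W) (c : R) :
  0 <= c -> (forall x y, nr (f x - f y) <= c * nr (x - y)) -> continuous f.
Proof.
move=> c0 fc x; apply/cvgrPdist_le => d d0.
have [e e0 ->] := gt0_real_complex d0.
have ec : 0 < e / (c + 1) by rewrite divr_gt0// ltr_wpDl.
apply/nbhs_ballP; exists (e / (c + 1))%:C => /=; first by rewrite ltcR.
move=> y /nr_ball/=; rewrite nrE lecR ltr_pdivlMr ?ltr_wpDl// => xy.
by apply: (le_trans (fc _ _)); have := nr_ge0 (x - y); lra.
Qed.

End RealNorm.

(** * Square roots in C*-algebras *)

Section CStarFacts.
Context {R : realType} {A : cstarAlgType R}.
Implicit Types (a b x y : A) (r : R).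

Lemma cmul0l a : cmul 0 a = 0.
Proof. by apply: (addrI (cmul 0 a)); rewrite -cmulDl !addr0. Qed.

Lemma cmul0r a : cmul a 0 = 0.
Proof. by apply: (addrI (cmul a 0)); rewrite -cmulDr !addr0. Qed.

Lemma cmulNl a b : cmul (- a) b = - cmul a b.
Proof. by apply: (addrI (cmul a b)); rewrite -cmulDl !subrr cmul0l. Qed.

Lemma cmulNr a b : cmul a (- b) = - cmul a b.
Proof. by apply: (addrI (cmul a b)); rewrite -cmulDr !subrr cmul0r. Qed.

Lemma cmulBl a b c : cmul (a - b) c = cmul a c - cmul b c.
Proof. by rewrite cmulDl cmulNl. Qed.

Lemma cmulBr a b c : cmul a (b - c) = cmul a b - cmul a c.
Proof. by rewrite cmulDr cmulNr. Qed.

Lemma conjr r : Num.conj (r%:C : R[i]) = r%:C.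
Proof. exact: conjc_real. Qed.

Lemma star0 : star (0 : A) = 0.
Proof. by apply: (addrI (star 0)); rewrite -starD !addr0. Qed.

Lemma starN a : star (- a) = - star a.
Proof. by apply: (addrI (star a)); rewrite -starD !subrr star0. Qed.

Lemma starB a b : star (a - b) = star a - star b.
Proof. by rewrite starD starN. Qed.

Lemma starZr r a : star (r%:C *: a) = r%:C *: star a.
Proof. by rewrite starZ conjr. Qed.

Lemma nr_cmul a b : nr (cmul a b) <= nr a * nr b.
Proof. by rewrite -lecR rmorphM/= -!nrE norm_cmul. Qed.

Lemma nr_cstar a : nr (cmul (star a) a) = nr a ^+ 2.
Proof. by apply: complexI; rewrite rmorphXn/= -!nrE norm_cstar. Qed.

Lemma nr_star a : nr (star a) = nr a.
Proof.
suff le b : nr b <= nr (star b).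
  by apply/eqP; rewrite eq_le le andbT -{2}(starK a) le.
have [->|b0] := eqVneq b 0; first by rewrite star0.
have b_gt0 : 0 < nr b.
  by rewrite lt_neqAle nr_ge0 andbT eq_sym; apply: contra b0 => /eqP/nr0_eq0 ->.
rewrite -(ler_pM2r b_gt0) -expr2 -nr_cstar; exact: nr_cmul.
Qed.

Lemma nr_cmul_sa a : star a = a -> nr (cmul a a) = nr a ^+ 2.
Proof. by move=> sa; rewrite -nr_cstar sa. Qed.

Lemma half_double (V : lmodType R[i]) (x : V) : (2^-1 : R)%:C *: (x + x) = x.
Proof.
by rewrite -mulr2n -(scaler_nat 2 x) scalerA -(rmorph_nat (real_complex R))
  -rmorphM/= mulVf ?pnatr_eq0// rmorph1 scale1r.
Qed.

Lemma expr_small (c e : R) : 0 <= c < 1 -> 0 < e ->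
  exists N : nat, forall n, (N <= n)%N -> c ^+ n <= e.
Proof.
move=> /andP[c0 c1] e0.
have cvg0 : (fun n => c ^+ n) @ \oo --> (0 : R).
  by apply: cvg_expr; rewrite ger0_norm.
have /cvgrPdist_le/(_ _ e0)[N _ cN] := cvg0.
exists N => n Nn.
by have := cN n Nn; rewrite /= sub0r normrN ger0_norm ?exprn_ge0.
Qed.

Lemma half_expr_small (e : R) : 0 < e ->
  exists N : nat, forall n, (N <= n)%N -> (2^-1 : R) ^+ n <= e.
Proof. by apply: expr_small; rewrite invr_ge0 ler0n invf_lt1// ltr1n. Qed.

Lemma cauchy_geometric (V : normedModType R[i]) (u : nat -> V) (c : R) :
  0 <= c < 1 -> (forall n, nr (u n.+1 - u n) <= c ^+ n) -> cauchy_nr u.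
Proof.
move=> c01 uc; have /andP[c0 c1] := c01.
(* The geometric sum, multiplied by [1 - c] to avoid division. *)
have dist n k : nr (u (n + k)%N - u n) * (1 - c) <= c ^+ n * (1 - c ^+ k).
  elim: k => [|k IH]; first by rewrite addn0 subrr nr0 mul0r expr0 subrr mulr0.
  rewrite addnS -(subrK (u (n + k)%N) (u (n + k).+1)) -addrA.
  apply: (@le_trans _ _ (c ^+ (n + k) * (1 - c) + c ^+ n * (1 - c ^+ k))).
    apply: le_trans (lerD (ler_wpM2r _ (uc (n + k)%N)) IH); last by lra.
    by rewrite -mulrDl ler_wpM2r ?nrD//; lra.
  by rewrite exprD exprS; lra.
move=> e e0.
have e10 : 0 < e * (1 - c) / 2 by rewrite divr_gt0// mulr_gt0// subr_gt0.
have [N cN] := expr_small c01 e10.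
have uN n : (N <= n)%N -> nr (u n - u N) <= e / 2.
  move=> Nn; rewrite -(subnKC Nn).
  have c1' : 0 < 1 - c by rewrite subr_gt0.
  rewrite -(ler_pM2r c1') (le_trans (dist _ _))//.
  have cNe := cN N (leqnn N).
  apply: (@le_trans _ _ (c ^+ N)); last by lra.
  have := exprn_ge0 (n - N) c0; have := exprn_ge0 N c0; nra.
exists N => m n Nm Nn; rewrite -(subrK (u N) (u m)) -addrA.
apply: (le_trans (nrD _ _)); rewrite (nr_distC (u N)).
by have := uN _ Nm; have := uN _ Nn; lra.
Qed.

(* The solution [x] is [1 - sqrt (1 - h)], the fixed point of
   [x |-> (h + x^2) / 2] on the ball of radius [nr h]. *)
Lemma csqrt1B (h : A) : star h = h -> nr h < 1 ->
  exists x, [/\ star x = x, x + x - cmul x x = h, nr x <= nr h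
    & forall d, cmul d h = cmul h d -> cmul d x = cmul x d].
Proof.
move=> sh h1; set c := nr h in h1 *; have c0 : 0 <= c := nr_ge0 h.
pose f x := (2^-1 : R)%:C *: (h + cmul x x).
have fball x : nr x <= c -> nr (f x) <= c.
  move=> xc; rewrite nrZr ger0_norm ?invr_ge0//.
  have := nr_cmul x x; have := nrD h (cmul x x); rewrite -/c.
  have := ler_pM (nr_ge0 x) (nr_ge0 x) xc (le_trans xc (ltW h1)).
  by rewrite mulr1; lra.
have flip x y : nr x <= c -> nr y <= c -> nr (f x - f y) <= c * nr (x - y).
  move=> xc yc; rewrite /f -scalerBr opprD addrACA subrr add0r.
  have -> : cmul x x - cmul y y = cmul x (x - y) + cmul (x - y) y.
    by rewrite cmulBr cmulBl addrA subrK.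
  rewrite nrZr ger0_norm ?invr_ge0//.
  have := nrD (cmul x (x - y)) (cmul (x - y) y).
  have := nr_cmul x (x - y); have := nr_cmul (x - y) y.
  have := ler_wpM2r (nr_ge0 (x - y)) xc; have := ler_wpM2l (nr_ge0 (x - y)) yc.
  by lra.
pose u n := iter n f 0.
have uc n : nr (u n) <= c.
  by elim: n => [|n IH]; [rewrite nr0|exact: fball].
have u_dist n : nr (u n.+1 - u n) <= c ^+ n.
  elim: n => [|n IH].
    by rewrite expr0 subr0 (le_trans (uc 1%N))// ltW.
  rewrite exprS.
  exact: (le_trans (flip (u n.+1) (u n) (uc _) (uc _)) (ler_wpM2l c0 IH)).
have c01 : 0 <= c < 1 by rewrite c0 h1.
have [x ux] := cauchy_cvg_nr (cauchy_geometric c01 u_dist).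
have {}ux e : 0 < e -> exists2 n, nr (u n - x) <= e & nr (u n.+1 - x) <= e.
  by move=> /ux[N uN]; exists N; apply: uN => //; exact: leqW.
have xc : nr x <= c.
  apply/ler_addgt0Pl => e /ux[n un _].
  rewrite -(subrK (u n) x) (le_trans (nrD _ _))// nr_distC.
  by have := uc n; lra.
have fx : f x = x.
  apply/eqP; rewrite -subr_eq0; apply/eqP/nr_le_eq0 => e e0.
  have [n un un1] := ux (e / 2) (divr_gt0 e0 (ltr0Sn _ 1)).
  rewrite -(subrK (f (u n)) (f x)) -addrA (le_trans (nrD _ _))//.
  have := flip _ _ xc (uc n); rewrite (nr_distC x).
  have := nr_ge0 (u n - x).
  have : c * nr (u n - x) <= 1 * nr (u n - x).
    by apply: ler_wpM2r; [exact: nr_ge0|exact: ltW].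
  by move: un1; rewrite /u iterS -/(u n) mul1r; lra.
exists x; split => //.
- apply/eqP; rewrite -subr_eq0; apply/eqP/nr_le_eq0 => e e0.
  have [n un _] := ux (e / 2) (divr_gt0 e0 (ltr0Sn _ 1)).
  have su : star (u n) = u n.
    by elim: (n) => [|m IH]; rewrite ?star0//= starZr starD starM sh IH.
  rewrite -(subrK (u n) (star x)) -addrA -{1}su -starB (le_trans (nrD _ _))//.
  by rewrite nr_star nr_distC; lra.
- have -> : x + x = h + cmul x x.
    by rewrite -{1 2}fx -scalerDr half_double.
  by rewrite addrK.
(* The iterates are polynomials in [h], so [d] commutes with them and, by continuity, with their
   limit. *)
- move=> d dh; apply/eqP; rewrite -subr_eq0; apply/eqP/nr_le_eq0 => e e0.
  have d1 : 0 < nr d + 1 by rewrite ltr_wpDl// nr_ge0.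
  have [|n un _] := ux (e / 2 / (nr d + 1)).
    by rewrite divr_gt0// divr_gt0.
  have du : cmul d (u n) = cmul (u n) d.
    elim: (n) => [|m IH]; first by rewrite cmul0l cmul0r.
    rewrite /u/= -/(u m) /f cmulZl cmulZr cmulDl cmulDr dh.
    by rewrite cmulA IH -cmulA IH cmulA.
  have -> : cmul d x - cmul x d = cmul (u n - x) d - cmul d (u n - x).
    by rewrite cmulBl cmulBr du opprB [RHS]addrC addrA subrK.
  rewrite (le_trans (nrB _ _))//.
  have := nr_cmul (u n - x) d; have := nr_cmul d (u n - x).
  move: un; rewrite ler_pdivlMr//.
  by have := nr_ge0 (u n - x); lra.
Qed.

End CStarFacts.

(** * The multiplier algebra *)

(* The multiplier algebra of [A], as adjointable maps of the Hilbert module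
   [A]: a unital C*-algebra containing [A] as an ideal. *)
Record multiplier (R : realType) (A : cstarAlgType R) := Multiplier {
  mfun :> A -> A ;
  madj : A -> A ;
  madjP : forall a b, cmul (star (mfun a)) b = cmul (star a) (madj b) ;
  mbounded : exists2 c : R, 0 <= c & forall a, nr (mfun a) <= c * nr a
}.

Section MultiplierAlgebra.
Context {R : realType} {A : cstarAlgType R}.
Implicit Types (a b x y : A) (T S : multiplier A) (r : R).

Lemma cmul_starI x y :
  (forall w, cmul (star w) x = cmul (star w) y) -> x = y.
Proof.
move=> xy; apply/eqP; rewrite -subr_eq0; apply/eqP/nr0_eq0/eqP.
by rewrite -sqrf_eq0 -nr_cstar cmulBr xy subrr nr0.
Qed.

(** The adjoint is determined by the map, because the [A]-valued pairing is nondegenerate; so only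
    the maps need comparing. *)
Lemma mult_eq T S : (forall a, T a = S a) -> T = S.
Proof.
case: T S => [f f' fP fb] [g g' gP gb] /= /funext fg.
case: _ / fg gP gb => gP gb.
have fg' : f' = g' by apply/funext => b; apply: cmul_starI => w; rewrite -fP gP.
by case: _ / fg' gP => gP; congr Multiplier; exact: Prop_irrelevance.
Qed.

Lemma madjP' T a b : cmul (star (madj T a)) b = cmul (star a) (T b).
Proof. by apply: (inv_inj starK); rewrite !starM !starK madjP. Qed.

(** Linearity is not a field of [multiplier]: it follows from the existence of an adjoint, by moving
    [T] across the pairing. *)
Lemma mfunP T (c : R[i]) a b : T (c *: a + b) = c *: T a + T b.
Proof.
by apply: cmul_starI => w; rewrite cmulDr cmulZr -!madjP' cmulDr cmulZr.
Qed.

Lemma madj_bounded T (c : R) : 0 <= c -> (forall a, nr (T a) <= c * nr a) ->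
  forall a, nr (madj T a) <= c * nr a.
Proof.
move=> c0 Tc a; have [->|a0] := eqVneq (nr (madj T a)) 0.
  by rewrite mulr_ge0// nr_ge0.
have a_gt0 : 0 < nr (madj T a) by rewrite lt_neqAle eq_sym a0 nr_ge0.
rewrite -(ler_pM2r a_gt0) -expr2 -nr_cstar madjP' (le_trans (nr_cmul _ _))//.
by rewrite nr_star mulrAC (mulrC _ (nr a)) ler_wpM2l ?nr_ge0// Tc.
Qed.

Program Definition mzero := @Multiplier R A (fun=> 0) (fun=> 0) _ _.
Next Obligation. by move=> a b; rewrite star0 cmul0l cmul0r. Qed.
Next Obligation. by exists 0 => // a; rewrite nr0 mul0r. Qed.

Program Definition mopp T :=
  @Multiplier R A (fun a => - T a) (fun a => - madj T a) _ _.
Next Obligation. by move=> T a b; rewrite starN cmulNl cmulNr madjP. Qed.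
Next Obligation.
by move=> T; case: (mbounded T) => c c0 Tc; exists c => // a; rewrite nrN.
Qed.

Program Definition madd T S :=
  @Multiplier R A (fun a => T a + S a) (fun a => madj T a + madj S a) _ _.
Next Obligation. by move=> T S a b; rewrite starD cmulDl cmulDr !madjP. Qed.
Next Obligation.
move=> T S; have [[c c0 Tc] [d d0 Sd]] := (mbounded T, mbounded S).
exists (c + d) => [|a]; first exact: addr_ge0.
by rewrite (le_trans (nrD _ _))// mulrDl lerD.
Qed.

Program Definition mscale (k : R[i]) T :=
  @Multiplier R A (fun a => k *: T a) (fun a => Num.conj k *: madj T a) _ _.
Next Obligation. by move=> k T a b; rewrite starZ cmulZl cmulZr madjP. Qed.
Next Obligation.
move=> k T; have [c c0 Tc] := mbounded T.
exists (complex.Re `|k| * c) => [|a].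
  by rewrite mulr_ge0// -ler0c RRe_real// ger0_real.
by rewrite nrZ -mulrA ler_wpM2l// -ler0c RRe_real// ger0_real.
Qed.

Program Definition mone := @Multiplier R A id id _ _.
Next Obligation. by []. Qed.
Next Obligation. by exists 1 => // a; rewrite mul1r. Qed.

Program Definition mmul T S :=
  @Multiplier R A (T \o S) (madj S \o madj T) _ _.
Next Obligation. by move=> T S a b; rewrite /= !madjP. Qed.
Next Obligation.
move=> T S; have [[c c0 Tc] [d d0 Sd]] := (mbounded T, mbounded S).
exists (c * d) => [|a]; first exact: mulr_ge0.
by rewrite (le_trans (Tc _))// -mulrA ler_wpM2l.
Qed.

Program Definition mstar T := @Multiplier R A (madj T) T _ _.
Next Obligation. by move=> T a b; exact: madjP'. Qed.
Next Obligation.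
by move=> T; have [c c0 Tc] := mbounded T; exists c => // a; exact: madj_bounded.
Qed.

Lemma mfunD T a b : T (a + b) = T a + T b.
Proof. by have := mfunP T 1 a b; rewrite !scale1r. Qed.

Lemma mfun0 T : T 0 = 0.
Proof. by apply: (addrI (T 0)); rewrite -mfunD !addr0. Qed.

Lemma mfunZ T (c : R[i]) a : T (c *: a) = c *: T a.
Proof. by have := mfunP T c a 0; rewrite mfun0 !addr0. Qed.

HB.instance Definition _ := gen_eqMixin (multiplier A).
HB.instance Definition _ := gen_choiceMixin (multiplier A).

Let maddA : associative madd.
Proof. by move=> T S U; apply: mult_eq => a /=; rewrite addrA. Qed.
Let maddC : commutative madd.
Proof. by move=> T S; apply: mult_eq => a /=; rewrite addrC. Qed.
Let madd0 : left_id mzero madd.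
Proof. by move=> T; apply: mult_eq => a /=; rewrite add0r. Qed.
Let maddN : left_inverse mzero mopp madd.
Proof. by move=> T; apply: mult_eq => a /=; rewrite addNr. Qed.
HB.instance Definition _ :=
  GRing.isZmodule.Build (multiplier A) maddA maddC madd0 maddN.

Let mmulA : associative mmul.
Proof. by move=> T S U; apply: mult_eq. Qed.
Let mmul1l : left_id mone mmul.
Proof. by move=> T; apply: mult_eq. Qed.
Let mmul1r : right_id mone mmul.
Proof. by move=> T; apply: mult_eq. Qed.
Let mmulDl : left_distributive mmul +%R.
Proof. by move=> T S U; apply: mult_eq. Qed.
Let mmulDr : right_distributive mmul +%R.
Proof. by move=> T S U; apply: mult_eq => a /=; rewrite mfunD. Qed.
HB.instance Definition _ := GRing.Zmodule_isPzRing.Build (multiplier A)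
  mmulA mmul1l mmul1r mmulDl mmulDr.

Let mscaleA k l T : mscale k (mscale l T) = mscale (k * l) T.
Proof. by apply: mult_eq => a /=; rewrite scalerA. Qed.
Let mscale1 : left_id 1 mscale.
Proof. by move=> T; apply: mult_eq => a /=; rewrite scale1r. Qed.
Let mscaleDr : right_distributive mscale +%R.
Proof. by move=> k T S; apply: mult_eq => a /=; rewrite scalerDr. Qed.
Let mscaleDl T : {morph mscale^~ T : k l / k + l}.
Proof. by move=> k l; apply: mult_eq => a /=; rewrite scalerDl. Qed.
HB.instance Definition _ := GRing.Zmodule_isLmodule.Build R[i] (multiplier A)
  mscaleA mscale1 mscaleDr mscaleDl.

Definition opnorm T : R := inf [set c | 0 <= c /\ forall a, nr (T a) <= c * nr a].

Lemma opnorm_le T c : 0 <= c -> (forall a, nr (T a) <= c * nr a) -> opnorm T <= c.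
Proof. by move=> c0 Tc; apply: ge_inf => //; exists 0 => d []. Qed.

Let opnorm_has_inf T :
  [set c | 0 <= c /\ forall a, nr (T a) <= c * nr a] !=set0.
Proof. by have [c c0 Tc] := mbounded T; exists c; split. Qed.

Lemma opnorm_ge0 T : 0 <= opnorm T.
Proof. by apply: (lb_le_inf (opnorm_has_inf T)) => c []. Qed.

Lemma opnormP T a : nr (T a) <= opnorm T * nr a.
Proof.
have [a0|a0] := eqVneq (nr a) 0.
  by rewrite (nr0_eq0 a0) mfun0 nr0 mulr0.
have a_gt0 : 0 < nr a by rewrite lt_neqAle eq_sym a0 nr_ge0.
rewrite -ler_pdivrMr//; apply: (lb_le_inf (opnorm_has_inf T)) => c [c0 Tc].
by rewrite ler_pdivrMr.
Qed.

Let mnorm T : R[i] := (opnorm T)%:C.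

Let mnormD T S : mnorm (T + S) <= mnorm T + mnorm S.
Proof.
rewrite -rmorphD lecR; apply: opnorm_le => [|a].
  by rewrite addr_ge0// opnorm_ge0.
by rewrite mulrDl (le_trans (nrD _ _))// lerD// opnormP.
Qed.

Let mnormZ k T : mnorm (k *: T) = `|k| * mnorm T.
Proof.
have le l S : opnorm (l *: S) <= complex.Re `|l| * opnorm S.
  have l0 : 0 <= complex.Re `|l| by rewrite -ler0c RRe_real// ger0_real.
  apply: opnorm_le => [|a]; first by rewrite mulr_ge0// opnorm_ge0.
  by rewrite nrZ -mulrA ler_wpM2l// opnormP.
have -> : `|k| = (complex.Re `|k|)%:C by rewrite RRe_real// ger0_real.
rewrite -rmorphM; congr (_ %:C); apply/eqP; rewrite eq_le le andTb.
have [->|k0] := eqVneq k 0; first by rewrite normr0 mul0r opnorm_ge0.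
have := le k^-1 (k *: T); rewrite scalerA mulVf// scale1r => leT.
have kk : complex.Re `|k| * complex.Re `|k^-1| = 1.
  have E (l : R[i]) : (complex.Re `|l|)%:C = `|l| by rewrite RRe_real// ger0_real.
  apply: complexI; apply: etrans (rmorphM _ _ _) _.
  by apply: etrans (congr2 *%R (E k) (E k^-1)) _; rewrite -normrM mulfV// normr1.
have k_ge0 : 0 <= complex.Re `|k| by rewrite -ler0c RRe_real// ger0_real.
by apply: (le_trans (ler_wpM2l k_ge0 leT)); rewrite mulrA kk mul1r.
Qed.

Let mnorm0 T : mnorm T = 0 -> T = 0.
Proof.
move=> /complexI T0; apply: mult_eq => a; apply: nr0_eq0; apply/eqP.
by rewrite eq_le nr_ge0 andbT (le_trans (opnormP _ _))// T0 mul0r.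
Qed.

HB.instance Definition _ :=
  Lmodule_isNormed.Build R[i] (multiplier A) mnormD mnormZ mnorm0.

Lemma nr_multP T a : nr (T a) <= nr T * nr a. Proof. exact: opnormP. Qed.

Lemma nr_madjP T a : nr (madj T a) <= nr T * nr a.
Proof. exact: (madj_bounded (opnorm_ge0 T) (opnormP T)). Qed.

Lemma mult_complete (F : set_system (multiplier A)) :
  ProperFilter F -> cauchy F -> cvg F.
Proof.
apply: complete_nr => u cu.
have cf a : exists l, cvg_nr (fun n => u n a) l.
  apply: cauchy_cvg_nr => e e0.
  have a1 : 0 < nr a + 1 by rewrite ltr_wpDl// nr_ge0.
  have [N uN] := cu (e / (nr a + 1)) (divr_gt0 e0 a1).
  exists N => m n Nm Nn; apply: (le_trans (nr_multP (u m - u n) a)).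
  have := uN _ _ Nm Nn; rewrite ler_pdivlMr//.
  by have := nr_ge0 (u m - u n); lra.
have cg a : exists l, cvg_nr (fun n => madj (u n) a) l.
  apply: cauchy_cvg_nr => e e0.
  have a1 : 0 < nr a + 1 by rewrite ltr_wpDl// nr_ge0.
  have [N uN] := cu (e / (nr a + 1)) (divr_gt0 e0 a1).
  exists N => m n Nm Nn; apply: (le_trans (nr_madjP (u m - u n) a)).
  have := uN _ _ Nm Nn; rewrite ler_pdivlMr//.
  by have := nr_ge0 (u m - u n); lra.
have [f fP] := choice cf; have [g gP] := choice cg.
have fgP a b : cmul (star (f a)) b = cmul (star a) (g b).
  apply/eqP; rewrite -subr_eq0; apply/eqP/nr_le_eq0 => e e0.
  have d0 : 0 < e / 2 / (nr a + nr b + 1).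
    by rewrite divr_gt0 ?divr_gt0// ltr_wpDl// addr_ge0 ?nr_ge0.
  have [N1 uN1] := fP a _ d0; have [N2 uN2] := gP b _ d0.
  pose n := maxn N1 N2.
  have := uN1 n (leq_maxl _ _); have := uN2 n (leq_maxr _ _).
  rewrite !ler_pdivlMr ?ltr_wpDl ?addr_ge0 ?nr_ge0// => ub ua.
  have -> : cmul (star (f a)) b - cmul (star a) (g b) =
     cmul (star a) (madj (u n) b - g b) - cmul (star (u n a - f a)) b.
    by rewrite cmulBr starB cmulBl madjP opprB [RHS]addrC addrA subrK.
  rewrite (le_trans (nrB _ _))//.
  have := nr_cmul (star a) (madj (u n) b - g b).
  have := nr_cmul (star (u n a - f a)) b; rewrite !nr_star.
  have := nr_ge0 a; have := nr_ge0 b.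
  have := nr_ge0 (u n a - f a); have := nr_ge0 (madj (u n) b - g b); nra.
(* Pointwise convergence becomes uniform: the Cauchy bound does not depend on [a], and the second
   index goes to infinity for each [a] separately. *)
have uf e : 0 < e -> exists N, forall n, (N <= n)%N ->
    forall a, nr (u n a - f a) <= e * nr a.
  move=> e0; have [N uN] := cu e e0; exists N => n Nn a.
  apply/ler_addgt0Pl => d d0; have [M uM] := fP a d d0.
  pose m := maxn M N.
  rewrite -(subrK (u m a) (u n a)) -addrA (le_trans (nrD _ _))//.
  have := uM m (leq_maxl _ _); have := nr_multP (u n - u m) a.
  have := ler_wpM2r (nr_ge0 a) (uN n m Nn (leq_maxr _ _)).
  by rewrite /=; lra.
have fb : exists2 c, 0 <= c & forall a, nr (f a) <= c * nr a.
  have [N uN] := uf 1 ltr01; exists (nr (u N) + 1) => [|a].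
    by rewrite addr_ge0// nr_ge0.
  rewrite -(subrK (u N a) (f a)) (le_trans (nrD _ _))// nr_distC.
  by have := uN N (leqnn N) a; have := nr_multP (u N) a; lra.
exists (Multiplier fgP fb) => e e0; have [N uN] := uf e e0; exists N => n Nn.
by apply: opnorm_le => [|a]; [exact: ltW|exact: uN].
Qed.

HB.instance Definition _ :=
  Uniform_isComplete.Build (multiplier A) mult_complete.

Let mulZl (c : R[i]) T S : (c *: T) * S = c *: (T * S).
Proof. exact: mult_eq. Qed.
Let mulZr (c : R[i]) T S : T * (c *: S) = c *: (T * S).
Proof. by apply: mult_eq => a /=; rewrite mfunZ. Qed.
Let mstarK : involutive mstar.
Proof. by move=> T; exact: mult_eq. Qed.
Let mstarD : {morph mstar : T S / T + S}.
Proof. by move=> T S; exact: mult_eq. Qed.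
Let mstarZ (c : R[i]) T : mstar (c *: T) = Num.conj c *: mstar T.
Proof. exact: mult_eq. Qed.
Let mstarM T S : mstar (T * S) = mstar S * mstar T.
Proof. exact: mult_eq. Qed.
Let mnormM T S : `|T * S| <= `|T| * `|S|.
Proof.
rewrite !nrE -rmorphM lecR; apply: opnorm_le => [|a].
  by rewrite mulr_ge0// nr_ge0.
apply: (le_trans (nr_multP T (S a))).
by rewrite -mulrA ler_wpM2l ?nr_ge0// nr_multP.
Qed.
Let mnorm_star T : `|mstar T * T| = `|T| ^+ 2.
Proof.
rewrite !nrE -rmorphXn/=; congr (_ %:C); apply/eqP; rewrite eq_le; apply/andP; split.
  apply: opnorm_le => [|a]; first by rewrite exprn_ge0// nr_ge0.
  apply: (le_trans (nr_madjP T (T a))).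
  by rewrite expr2 -mulrA ler_wpM2l ?nr_ge0// nr_multP.
(* Since [|T a|^2 = |a^* (T^* T a)| <= |T^* T| |a|^2], the square root of [|T^* T|] is a bound for
   [T]. *)
rewrite -[leRHS]sqr_sqrtr ?nr_ge0// ler_pXn2r ?nnegrE ?nr_ge0 ?sqrtr_ge0//.
apply: opnorm_le => [|a]; first exact: sqrtr_ge0.
rewrite -(@ler_pXn2r _ 2)// ?nnegrE ?mulr_ge0 ?nr_ge0 ?sqrtr_ge0//.
rewrite exprMn sqr_sqrtr ?nr_ge0// -nr_cstar madjP (le_trans (nr_cmul _ _))//.
by rewrite nr_star mulrC expr2 mulrA ler_wpM2r ?nr_ge0// (nr_multP (mstar T * T)).
Qed.

HB.instance Definition _ := isCStarAlgebra.Build R (multiplier A)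
  (@mulrA (multiplier A)) (@mulrDl (multiplier A)) (@mulrDr (multiplier A))
  mulZl mulZr mstarK mstarD mstarZ mstarM mnormM mnorm_star.

Program Definition lmult a := @Multiplier R A (cmul a) (cmul (star a)) _ _.
Next Obligation. by move=> a b c; rewrite starM cmulA. Qed.
Next Obligation.
by move=> a; exists (nr a) => [|b]; [exact: nr_ge0|exact: nr_cmul].
Qed.

Lemma lmultP (c : R[i]) a b : lmult (c *: a + b) = c *: lmult a + lmult b.
Proof. by apply: mult_eq => x /=; rewrite cmulDl cmulZl. Qed.

Lemma lmultM a b : lmult (cmul a b) = lmult a * lmult b.
Proof. by apply: mult_eq => x /=; rewrite cmulA. Qed.

Lemma lmult_star a : lmult (star a) = star (lmult a).
Proof. exact: mult_eq. Qed.

Lemma nr_lmult a : nr (lmult a) = nr a.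
Proof.
apply/eqP; rewrite eq_le; apply/andP; split.
  by apply: opnorm_le => [|b]; [exact: nr_ge0|exact: nr_cmul].
have [->|a0] := eqVneq (nr a) 0; first exact: nr_ge0.
have a_gt0 : 0 < nr a by rewrite lt_neqAle eq_sym a0 nr_ge0.
have aa : nr (cmul a (star a)) = nr a ^+ 2.
  by rewrite -{1}(starK a) nr_cstar nr_star.
rewrite -(ler_pM2r a_gt0) -expr2 -aa -[nr a in leRHS](nr_star a).
exact: (nr_multP (lmult a) (star a)).
Qed.

(** [A] is a left ideal of its multiplier algebra, and a two-sided one by taking stars. *)
Lemma lmult_mul T a : T * lmult a = lmult (T a).
Proof.
apply: mult_eq => x /=; apply: cmul_starI => w.
by rewrite cmulA -!madjP' cmulA.
Qed.

End MultiplierAlgebra.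

(** * Order in the multiplier algebra *)

Section MultiplierOrder.
Context {R : realType} {A : cstarAlgType R}.
Local Notation U := (multiplier A).
Implicit Types (x y z g h k l m q v : U) (r s t e : R).

Lemma mstarM x y : star (x * y) = star y * star x :> U. Proof. exact: starM. Qed.

Lemma mstar1 : star (1 : U) = 1. Proof. exact: mult_eq. Qed.

Lemma mscaleAl (c : R[i]) x y : (c *: x) * y = c *: (x * y) :> U.
Proof. exact: cmulZl. Qed.

Lemma mscaleAr (c : R[i]) x y : x * (c *: y) = c *: (x * y) :> U.
Proof. exact: cmulZr. Qed.

Lemma nr_mul x y : nr (x * y : U) <= nr x * nr y. Proof. exact: nr_cmul. Qed.

Lemma nr_starM x : nr (star x * x : U) = nr x ^+ 2. Proof. exact: nr_cstar. Qed.

(** An inequality only: the unit has norm 0 when [A] is zero. *)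
Lemma nr_le1 : nr (1 : U) <= 1.
Proof. by apply: opnorm_le => // a; rewrite mul1r. Qed.

Definition cst r : U := r%:C *: (1 : U).

Lemma cstD r s : cst (r + s) = cst r + cst s.
Proof. by rewrite /cst rmorphD scalerDl. Qed.
Lemma cstN r : cst (- r) = - cst r. Proof. by rewrite /cst rmorphN scaleNr. Qed.
Lemma cstB r s : cst (r - s) = cst r - cst s. Proof. by rewrite cstD cstN. Qed.
Lemma cst0 : cst 0 = 0. Proof. by rewrite /cst scale0r. Qed.
Lemma cst1 : cst 1 = 1. Proof. by rewrite /cst scale1r. Qed.
Lemma cstZ r s : r%:C *: cst s = cst (r * s).
Proof. by rewrite /cst scalerA -rmorphM. Qed.
Lemma cstMl r x : cst r * x = r%:C *: x. Proof. by rewrite mscaleAl mul1r. Qed.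
Lemma cstMr r x : x * cst r = r%:C *: x. Proof. by rewrite mscaleAr mulr1. Qed.
Lemma star_cst r : star (cst r) = cst r. Proof. by rewrite starZr mstar1. Qed.

Lemma nr_cst r : 0 <= r -> nr (cst r) <= r.
Proof.
by move=> r0; rewrite nrZr ger0_norm// ler_piMr// nr_le1.
Qed.

(* For selfadjoint [q] this says that the spectrum of [q] is nonnegative; in this
   form sums of positive elements are positive by the triangle inequality. *)
Definition pos q := star q = q /\ exists2 t, 0 <= t & nr (cst t - q) <= t.

Lemma pos_cst r : 0 <= r -> pos (cst r).
Proof.
by move=> r0; split; [exact: star_cst|exists r; rewrite ?subrr ?nr0].
Qed.

Lemma posD x y : pos x -> pos y -> pos (x + y).
Proof.
move=> [sx [t t0 xt]] [sy [s s0 ys]]; split; first by rewrite starD sx sy.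
exists (t + s); first exact: addr_ge0.
by rewrite cstD opprD addrACA (le_trans (nrD _ _))// lerD.
Qed.

Lemma posZ r x : 0 <= r -> pos x -> pos (r%:C *: x).
Proof.
move=> r0 [sx [t t0 xt]]; split; first by rewrite starZr sx.
exists (r * t); first exact: mulr_ge0.
by rewrite -cstZ -scalerBr nrZr ger0_norm// ler_wpM2l.
Qed.

Lemma posZ_inv r x : 0 < r -> pos (r%:C *: x) -> pos x.
Proof.
move=> r0 /(posZ (_ : 0 <= r^-1)); rewrite scalerA -rmorphM mulVf ?gt_eqF//.
by rewrite scale1r; apply; rewrite invr_ge0 ltW.
Qed.

Lemma pos0 : pos 0. Proof. by rewrite -cst0; exact: pos_cst. Qed.

Lemma pos_nr x t : star x = x -> nr x <= t -> pos (cst t - x).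
Proof.
move=> sx xt; split; first by rewrite starB star_cst sx.
by exists t; [exact: le_trans (nr_ge0 x) xt|rewrite subKr].
Qed.

Lemma nr_double x : nr (x + x) = 2 * nr x.
Proof.
by rewrite -mulr2n -scaler_nat -(rmorph_nat (real_complex R)) nrZr ger0_norm.
Qed.

Lemma mulii : 'i%C * 'i%C = -1 :> R[i].
Proof. by rewrite -expr2 sqr_i. Qed.

(* [l + i m] has norm [sqrt r], since it times its adjoint is [r]. *)
Lemma nr_circle l m r : star l = l -> star m = m -> l * m = m * l -> 0 <= r ->
  m * m + l * l = cst r -> nr (l * l) <= r.
Proof.
move=> sl sm lm r0 mlr; pose u := m + 'i%C *: l.
have su : star u = m - 'i%C *: l.
  rewrite starD starZ sl sm -scaleNr; congr (_ + _ *: _).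
  by apply/eqP; rewrite eq_complex/= oppr0 !eqxx.
have uu : star u * u = cst r.
  rewrite su mulrDl !mulrDr !mulNr !mscaleAl !mscaleAr lm scalerA.
  by rewrite mulii -mlr; linear_identity.
have nu : nr u ^+ 2 <= r by rewrite -nr_starM uu nr_cst.
have ul : u - star u = 'i%C *: l + 'i%C *: l.
  by rewrite su opprB addrC addrA subrK.
have : nr (u - star u) <= nr u + nr u.
  by rewrite (le_trans (nrB _ _))// nr_star.
rewrite ul nr_double nrZ.
have -> : complex.Re `|'i%C : R[i]| = 1.
  by rewrite normc_def/= expr0n expr1n add0r sqrtr1.
rewrite mul1r => lu; have {}lu : nr l <= nr u by lra.
rewrite (nr_cmul_sa sl); apply: le_trans nu.
by rewrite ler_pXn2r ?nnegrE ?nr_ge0.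
Qed.

Lemma sqrt1B g : star g = g -> nr g < 1 ->
  exists l, [/\ star l = l, l * l = 1 - g
    & forall d, d * g = g * d -> d * l = l * d].
Proof.
move=> sg g1; have [x [sx xg _ xC]] := csqrt1B sg g1.
exists (1 - x); split.
- by rewrite starB mstar1 sx.
- rewrite mulrBl mul1r mulrBr mulr1 -xg -[cmul x x]/(x * x).
  by linear_identity.
- by move=> d /xC dx; rewrite mulrBl mulrBr mulr1 mul1r -[x * d]dx.
Qed.

(** After scaling to [t = 1], [1 - n^2] has a square root [l] commuting with [n]; as
    [l^2 + n^2 = 1], [nr_circle] bounds [l^2]. *)
Lemma nr_subsq m t : star m = m -> nr (m * m) < t -> nr (cst t - m * m) <= t.
Proof.
move=> sm mt; have t0 : 0 < t := le_lt_trans (nr_ge0 _) mt.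
pose k := (t^-1)%:C *: (m * m).
have sk : star k = k by rewrite starZr mstarM sm.
have tk : t%:C *: k = m * m.
  by rewrite scalerA -rmorphM mulfV ?gt_eqF// scale1r.
have k1 : nr k < 1.
  by rewrite nrZr ger0_norm ?invr_ge0 1?ltW// mulrC ltr_pdivrMr// mul1r.
have [l [sl lk lC]] := sqrt1B sk k1.
pose n := (Num.sqrt t^-1)%:C *: m.
have nn : n * n = k.
  rewrite mscaleAl mscaleAr scalerA -rmorphM -expr2 sqr_sqrtr// invr_ge0.
  exact: ltW.
have sn : star n = n by rewrite starZr sm.
have nl : n * l = l * n by apply: lC; rewrite -nn mulrA.
have -> : cst t - m * m = t%:C *: (l * l).
  by rewrite lk scalerBr tk.
rewrite nrZr ger0_norm ?(ltW t0)// ler_piMr ?(ltW t0)//.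
by apply: (nr_circle sl sn) => //; rewrite nn lk cst1 addrC subrK.
Qed.

Lemma pos_sq m : star m = m -> pos (m * m).
Proof.
move=> sm; split; first by rewrite mstarM sm.
exists (nr (m * m) + 1); first by rewrite addr_ge0// nr_ge0.
by apply: nr_subsq => //; rewrite ltrDl.
Qed.

(** The summand [e] makes room for [sqrt1B]: [q + e = (t + e) (1 - g)] where [g] has norm at most
    [t / (t + e) < 1]. *)
Lemma pos_sqrt q e : pos q -> 0 < e ->
  exists l, [/\ star l = l, l * l = q + cst e
    & forall d, d * q = q * d -> d * l = l * d].
Proof.
move=> [sq [t t0 qt]] e0.
have te0 : 0 < t + e by rewrite ltr_wpDl.
pose g := ((t + e)^-1)%:C *: (cst t - q).
have teg : (t + e)%:C *: g = cst t - q.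
  by rewrite scalerA -rmorphM mulfV ?gt_eqF// scale1r.
have [|//|l [sl lg lC]] := @sqrt1B g.
- by rewrite starZr starB star_cst sq.
- rewrite nrZr ger0_norm ?invr_ge0 1?ltW// mulrC ltr_pdivrMr// mul1r.
  by apply: le_lt_trans qt _; rewrite ltrDl.
exists ((Num.sqrt (t + e))%:C *: l); split.
- by rewrite starZr sl.
- rewrite mscaleAl mscaleAr scalerA -rmorphM -expr2 sqr_sqrtr ?(ltW te0)// lg.
  by rewrite scalerBr teg -/(cst _) cstD addrC opprB addrA subrK.
- move=> d dq; rewrite mscaleAl mscaleAr lC// mscaleAl mscaleAr.
  by rewrite mulrBl mulrBr dq cstMl cstMr.
Qed.

(** Commuting roots of [h + e/3] and [r - h + e/3] have squares adding up to [r + 2e/3], so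
    [nr_circle] applies; the last third of [e] pays for going back from [h + e/3] to [h]. *)
Lemma nr_pos_le h r : 0 <= r -> star h = h -> pos h -> pos (cst r - h) -> nr h <= r.
Proof.
move=> r0 sh ph prh; apply/ler_addgt0Pr => e e0.
have e30 : 0 < e / 3 by exact: divr_gt0.
have [l [sl ll lC]] := pos_sqrt ph e30.
have [m [sm mm mC]] := pos_sqrt prh e30.
have mh : m * h = h * m.
  by apply/esym/mC; rewrite mulrBl mulrBr cstMl cstMr.
have : nr (l * l) <= r + 2 * (e / 3).
  apply: (nr_circle sl sm) => //; first by rewrite lC.
    by rewrite addr_ge0// mulr_ge0// ltW.
  have -> : r + 2 * (e / 3) = r + e / 3 + e / 3 by lra.
  by rewrite mm ll !cstD; linear_identity.
have -> : h = l * l - cst (e / 3) by rewrite ll addrK.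
by have := nrB (l * l) (cst (e / 3)); have := nr_cst (ltW e30); lra.
Qed.

(** The radius in [pos] is existential; this shows that every radius beyond the norm works. *)
Lemma pos_sharp v t : pos v -> nr v < t -> nr (cst t - v) <= t.
Proof.
move=> pv vt; apply/ler_addgt0Pr => e e0.
have [l [sl ll _]] := pos_sqrt pv e0.
have -> : cst t - v = cst (t + e) - l * l.
  by rewrite ll cstD; linear_identity.
apply: nr_subsq => //; rewrite ll (le_lt_trans (nrD _ _))//.
by rewrite ltr_leD// nr_cst// ltW.
Qed.

(** The radius witnessing [pos (v + cst e)] might depend on [e]; [pos_sharp] replaces it by
    [nr v + 1 + e], and then [e] tends to 0. *)
Lemma pos_closed v : star v = v -> (forall e, 0 < e -> pos (v + cst e)) -> pos v.
Proof.
move=> sv vp; split=> //; exists (nr v + 1); first by rewrite addr_ge0// nr_ge0.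
apply/ler_addgt0Pr => e e0.
have -> : cst (nr v + 1) - v = cst (nr v + 1 + e) - (v + cst e).
  by rewrite !cstD; linear_identity.
apply: pos_sharp; first exact: vp.
by rewrite (le_lt_trans (nrD _ _))//; have := nr_cst (ltW e0); lra.
Qed.

Lemma star_exp k n : star k = k -> star (k ^+ n) = k ^+ n.
Proof.
move=> sk; elim: n => [|n IH]; first by rewrite expr0 mstar1.
by rewrite {1}exprS mstarM IH sk -exprSr.
Qed.

Lemma nr_exp2 k p : star k = k -> nr (k ^+ (2 ^ p)) = nr k ^+ (2 ^ p).
Proof.
move=> sk; elim: p => [|p IH]; first by rewrite expn0 !expr1.
rewrite expnS mulnC !exprM expr2 (nr_cmul_sa (star_exp _ sk)) IH.
by rewrite -!exprM.
Qed.

Lemma bernoulli (d : R) n : 0 <= d -> 1 + n%:R * d <= (1 + d) ^+ n.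
Proof.
move=> d0; elim: n => [|n IH]; first by rewrite mul0r addr0 expr0.
rewrite exprS; apply: (@le_trans _ _ ((1 + d) * (1 + n%:R * d))).
  by rewrite -natr1; have := ler0n R n; nra.
by rewrite ler_wpM2l//; lra.
Qed.

(** A substitute for the spectral radius formula: at exponents [2^p] the norm of the power is the
    power of the norm, so a norm above [r] would force exponential growth relative to [r ^+ n]. *)
Lemma nr_le_growth k r c : star k = k -> 0 < r -> 0 <= c ->
  (forall n, nr (k ^+ n) <= (1 + c * n%:R) * r ^+ n) -> nr k <= r.
Proof.
move=> sk r0 c0 kr; rewrite leNgt; apply/negP => rk.
pose d := nr k / r - 1; have d0 : 0 < d by rewrite subr_gt0 ltr_pdivlMr// mul1r.
(* With [n = 2^M] the exponent used is [2n]. Bernoulli gives [(1 + d)^(2n) >= (1 + n d)^2], which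
   exceeds [1 + 2 n c] as soon as [2 c < n d^2]. *)
have [M Mc] : exists M, 2 * c / d ^+ 2 < M%:R.
  exists (Num.bound (2 * c / d ^+ 2)); apply: archi_boundP.
  by rewrite divr_ge0 ?mulr_ge0 ?exprn_ge0 ?(ltW d0).
pose n := (2 ^ M)%N.
have {}Mc : 2 * c < n%:R * d ^+ 2.
  rewrite -ltr_pdivrMr ?exprn_gt0// (lt_le_trans Mc)// ler_nat.
  exact/ltnW/ltn_expl.
have := kr (2 ^ M.+1)%N; rewrite nr_exp2// expnS -/n -ler_pdivrMr ?exprn_gt0//.
rewrite -expr_div_n mulnC exprM.
have -> : nr k / r = 1 + d by rewrite /d addrC subrK.
have b := bernoulli n (ltW d0).
have n0 : 0 <= n%:R :> R := ler0n _ _.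
have : (1 + n%:R * d) ^+ 2 <= ((1 + d) ^+ n) ^+ 2.
  have d1 : 0 <= 1 + d by lra.
  have nd : 0 <= 1 + n%:R * d by apply: addr_ge0 => //; apply: mulr_ge0; lra.
  by apply: lerXn2r; rewrite ?nnegrE ?exprn_ge0.
have : 0 < n%:R :> R by rewrite ltr0n expn_gt0.
by rewrite natrM !expr2 in Mc *; nra.
Qed.

(* [z^*z] and [zz^*] have the same nonzero spectrum; here this is seen on the
   powers of [t - z^*z]. *)
Lemma pos_swap z : pos (1 + z * star z) -> pos (1 + star z * z).
Proof.
set g := z * star z; set h := star z * z.
move=> [_ [t t0 gt]].
have sh : star h = h by rewrite mstarM starK.
have {}gt : nr (cst t - g) <= t + 1.
  have -> : cst t - g = cst t - (1 + g) + 1.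
    by linear_identity.
  by rewrite (le_trans (nrD _ _))// lerD// nr_le1.
split; first by rewrite starD mstar1 sh.
exists (t + 1); first exact: addr_ge0.
have -> : cst (t + 1) - (1 + h) = cst t - h.
  by rewrite cstD cst1; linear_identity.
have t10 : 0 < t + 1 by rewrite ltr_wpDl.
have zpow n : z * (cst t - h) ^+ n = (cst t - g) ^+ n * z.
  elim: n => [|n IH]; first by rewrite !expr0 mulr1 mul1r.
  rewrite exprSr mulrA IH exprSr -!mulrA; congr (_ * _).
  by rewrite mulrBl mulrBr cstMl cstMr /h /g mulrA.
have gpow n : nr ((cst t - g) ^+ n) <= (t + 1) ^+ n.
  elim: n => [|n IH]; first by rewrite !expr0 nr_le1.
  by rewrite !exprS (le_trans (nr_mul _ _))// ler_pM// nr_ge0.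
apply: (nr_le_growth (c := nr z ^+ 2)) => //.
- by rewrite starB star_cst sh.
- by rewrite exprn_ge0// nr_ge0.
elim=> [|n IH]; first by rewrite !expr0 mulr0 addr0 mulr1 nr_le1.
(* Each further power adds at most [nr z ^+ 2 * (t + 1) ^+ n] to [t] times the previous bound:
   linear growth relative to [(t + 1) ^+ n]. *)
have -> : (cst t - h) ^+ n.+1 =
    t%:C *: (cst t - h) ^+ n - star z * ((cst t - g) ^+ n * z).
  by rewrite exprS mulrBl cstMl -zpow mulrA.
apply: (le_trans (nrB _ _)).
rewrite nrZr ger0_norm//.
have : nr (star z * ((cst t - g) ^+ n * z)) <= nr z ^+ 2 * (t + 1) ^+ n.
  rewrite (le_trans (nr_mul _ _))// nr_star expr2 -mulrA ler_wpM2l ?nr_ge0//.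
  by rewrite (le_trans (nr_mul _ _))// mulrC ler_wpM2l ?nr_ge0.
have := ler_wpM2l t0 IH; rewrite (exprS (t + 1)) -(natr1 n).
have := exprn_ge0 n (ltW t10); have := ler0n R n.
have := exprn_ge0 2 (nr_ge0 z).
set Z := nr z ^+ 2; set P := (t + 1) ^+ n; set N := n%:R => Z0 N0 P0 *.
have := mulr_ge0 (mulr_ge0 Z0 N0) P0; have := mulr_ge0 (mulr_ge0 Z0 P0) t0.
by lra.
Qed.

Lemma pos_starD z : pos (star z * z + z * star z).
Proof.
pose a := z + star z; pose b := 'i%C *: (z - star z).
have sa : star a = a by rewrite starD starK addrC.
have sb : star b = b.
  rewrite starZ starB starK -[star z - z]opprB scalerN -scaleNr; congr (_ *: _).
  by apply/eqP; rewrite eq_complex/= oppr0 opprK !eqxx.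
apply: (@posZ_inv 2) => //.
have -> : (2 : R)%:C *: (star z * z + z * star z) = a * a + b * b.
  rewrite /a /b mscaleAl mscaleAr scalerA mulii scaleN1r.
  rewrite !(mulrDl, mulrDr, mulNr, mulrN).
  rewrite [_%:C]rmorph_nat scaler_nat mulr2n.
  by linear_identity.
by apply: posD; exact: pos_sq.
Qed.

End MultiplierOrder.

(** * Positivity of [y^* y] *)

Section StarPositive.
Context {R : realType} {A : cstarAlgType R}.
Local Notation U := (multiplier A).
Implicit Types (x y z g h k l v : U) (r e : R).

Lemma exp_sq l n : (l * l) ^+ n = l ^+ n * l ^+ n.
Proof. exact: exprMn_comm. Qed.

Lemma comm_exp d l n : d * l = l * d -> d * l ^+ n = l ^+ n * d.
Proof. by move=> dl; apply: (@commrX _ d l n). Qed.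

(* Let [h = y^*y], [1 - h = l^2] and [z = y l^j], so that [z^*z = h (1 - h)^j].
   Both [1 - z^*z] and [z^*z + zz^*] are sums of squares, so [1 + zz^*] and
   hence [1 + z^*z] are positive, and [h (1 - h)^j] is bounded independently of
   [j].  Summing over [j], the powers of [1 - h] grow at most linearly, which
   forces [1 - h] to have norm at most [1]. *)
Lemma pos_starM_lt1 y : nr y < 1 -> pos (star y * y).
Proof.
move=> y1; have [h hE] : exists h, h = star y * y by eexists.
have sh : star h = h by rewrite hE mstarM starK.
have h1 : nr h < 1 by rewrite hE nr_starM expr_lt1// nr_ge0.
have [l [sl ll lC]] := sqrt1B sh h1.
have hl : h * l = l * h by exact: lC.
have hlj j : h * l ^+ j = l ^+ j * h by exact: comm_exp.
have [k kE] : exists k, k = l * l by eexists.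
have zz j : star (y * l ^+ j) * (y * l ^+ j) = h * k ^+ j.
  by rewrite mstarM star_exp// -mulrA (mulrA _ y) -hE mulrA -hlj kE exp_sq mulrA.
have hk j : h * h * k ^+ j = (h * l ^+ j) * (h * l ^+ j).
  by rewrite kE exp_sq -!mulrA; congr (_ * _); rewrite !mulrA hlj.
have cert j : pos (1 - h * k ^+ j).
  elim: j => [|j IH]; first by rewrite expr0 mulr1 -ll; exact: pos_sq.
  have -> : 1 - h * k ^+ j.+1 = (1 - h * k ^+ j) + h * h * k ^+ j.
    by rewrite exprS {1}kE ll mulrBl mul1r mulrBr !mulrA; linear_identity.
  by apply: (posD IH); rewrite hk; apply: pos_sq; rewrite mstarM star_exp// sh hlj.
(* From [0 <= 1 + z^* z <= 2] the norm of [1 + z^* z] is at most 2; removing the unit costs 1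
   more. *)
have bound j : nr (h * k ^+ j) <= 3.
  set z := y * l ^+ j; rewrite -zz -/z.
  have p1 : pos (1 - star z * z) by rewrite zz; exact: cert.
  have p2 : pos (1 + star z * z).
    apply: pos_swap.
    have -> : 1 + z * star z = (1 - star z * z) + (star z * z + z * star z).
      by linear_identity.
    by apply: (posD p1); exact: pos_starD.
  have n2 : nr (1 + star z * z) <= 2.
    apply: nr_pos_le => //; first by case: p2.
    have -> : cst 2 - (1 + star z * z) = 1 - star z * z :> U.
      by rewrite [2]mulr2n cstD cst1; linear_identity.
    exact: p1.
  have -> : star z * z = (1 + star z * z) - 1 by linear_identity.
  by rewrite (le_trans (nrB _ _))//; have := @nr_le1 R A; lra.
(* Consecutive powers of [k] differ by [h * k ^+ n], hence the growth constant 3. *)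
have k1 : nr k <= 1.
  apply: (@nr_le_growth _ _ k 1 3) => //; first by rewrite kE mstarM sl.
  elim=> [|n IH]; first by rewrite !expr0 mulr0 addr0 mulr1 nr_le1.
  have -> : k ^+ n.+1 = k ^+ n - h * k ^+ n.
    by rewrite exprS {1}kE ll mulrBl mul1r.
  move: IH (bound n); rewrite !expr1n !mulr1 -(natr1 n) => IH b.
  by apply: (le_trans (nrB _ _)); lra.
by rewrite -hE; split=> //; exists 1 => //; rewrite cst1 -ll -kE.
Qed.

Lemma pos_starM y : pos (star y * y).
Proof.
have y1 : 0 < nr y + 1 by rewrite ltr_wpDl// nr_ge0.
pose y' := ((nr y + 1)^-1)%:C *: y.
have yy' : y = (nr y + 1)%:C *: y'.
  by rewrite scalerA -rmorphM mulfV ?gt_eqF// scale1r.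
rewrite yy' starZr mscaleAl mscaleAr.
do 2! (apply: posZ; first exact: ltW); apply: pos_starM_lt1.
by rewrite nrZr ger0_norm ?invr_ge0 1?ltW// mulrC ltr_pdivrMr// mul1r ltrDl.
Qed.

(** With [l^2 = v + d], [y^* v y + e] is [(l y)^* (l y)] plus [e - d y^* y]; the choice of [d] makes
    [d |y|^2 <= e]. *)
Lemma pos_conj y v : pos v -> pos (star y * v * y).
Proof.
move=> pv; apply: pos_closed; first by rewrite !mstarM starK pv.1 mulrA.
move=> e e0; pose d := e / (nr y ^+ 2 + 1).
have y1 : 0 < nr y ^+ 2 + 1 by rewrite ltr_wpDl// exprn_ge0// nr_ge0.
have d0 : 0 < d by exact: divr_gt0.
have [l [sl ll _]] := pos_sqrt pv d0.
have -> : star y * v * y + cst e =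
    star (l * y) * (l * y) + (cst e - d%:C *: (star y * y)).
  rewrite mstarM sl -!mulrA (mulrA l) ll mulrDl mulrDr cstMl mscaleAr.
  by linear_identity.
apply: posD; first exact: pos_starM.
apply: pos_nr; first by rewrite starZr mstarM starK.
rewrite nrZr ger0_norm ?(ltW d0)// nr_starM /d.
rewrite mulrAC ler_pdivrMr// ler_wpM2l ?(ltW e0)//.
by rewrite lerDl.
Qed.

End StarPositive.

(** * Approximate units and the order modulo a closed ideal *)

Section IdealApproximation.
Context {R : realType} {A : cstarAlgType R} (I : closed_ideal A).
Local Notation U := (multiplier A).
Local Notation J := (ideal_set I).
Implicit Types (a b i e : A) (d : R).

Lemma ideal_comb (c : R[i]) a b : J a -> J b -> J (c *: a + b).
Proof. by case: (ideal_closed_subspace I) => _ _; apply. Qed.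

Lemma ideal0 : J 0. Proof. by case: (ideal_closed_subspace I). Qed.

Lemma idealD a b : J a -> J b -> J (a + b).
Proof. by move=> Ia Ib; have := ideal_comb 1 Ia Ib; rewrite scale1r. Qed.

Lemma idealZ (c : R[i]) a : J a -> J (c *: a).
Proof. by move=> Ia; have := ideal_comb c Ia ideal0; rewrite addr0. Qed.

Lemma idealB a b : J a -> J b -> J (a - b).
Proof. by move=> Ia Ib; apply: idealD => //; rewrite -scaleN1r; exact: idealZ. Qed.

Lemma lmultD a b : lmult (a + b) = lmult a + lmult b :> U.
Proof. by have := lmultP 1 a b; rewrite !scale1r. Qed.

Lemma lmult0 : lmult 0 = 0 :> U.
Proof. by apply: mult_eq => x /=; rewrite cmul0l. Qed.

Lemma lmultZ (c : R[i]) a : lmult (c *: a) = c *: lmult a :> U.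
Proof. by have := lmultP c a 0; rewrite lmult0 !addr0. Qed.

Lemma lmultN a : lmult (- a) = - lmult a :> U.
Proof. by rewrite -scaleN1r lmultZ scaleN1r. Qed.

Lemma lmultB a b : lmult (a - b) = lmult a - lmult b :> U.
Proof. by rewrite lmultD lmultN. Qed.

(* With [j = i^2], the elements [1 - (1 - j)^m - m j (1 - j)^m] are sums of
   squares, so [(1 - j)^m = 1 - e] nearly annihilates [i] for large [m]. *)
Lemma ideal_approx_lt1 i d : J i -> star i = i -> nr i < 1 -> 0 < d ->
  exists e, [/\ J e, star (1 - lmult e) = 1 - lmult e :> U,
    nr (1 - lmult e : U) <= 1 & nr (lmult i * (1 - lmult e) : U) <= d].
Proof.
move=> Ii si i1 d0; have [x xE] : exists x : U, x = lmult i by eexists.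
have sx : star x = x by rewrite xE -lmult_star si.
have [j jE] : exists j, j = x * x by eexists.
have sj : star j = j by rewrite jE mstarM sx.
have j1 : nr j < 1 by rewrite jE nr_cmul_sa// xE nr_lmult expr_lt1// nr_ge0.
have [l [sl ll lC]] := sqrt1B sj j1.
have xl : x * l = l * x by apply: lC; rewrite jE mulrA.
have xlm m : x * l ^+ m = l ^+ m * x by exact: comm_exp.
have jlm m : j * l ^+ m = l ^+ m * j by rewrite jE -mulrA xlm mulrA xlm mulrA.
have [k kE] : exists k, k = l * l by eexists.
have jk m : j * k ^+ m = (x * l ^+ m) * (x * l ^+ m).
  by rewrite kE exp_sq jE -!mulrA; congr (_ * _); rewrite !mulrA xlm.
have jjk m : j * j * k ^+ m = (j * l ^+ m) * (j * l ^+ m).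
  by rewrite kE exp_sq -!mulrA; congr (_ * _); rewrite !mulrA jlm.
have cert m : pos (1 - k ^+ m - (m%:R : R)%:C *: (j * k ^+ m)).
  elim: m => [|m IH].
    by rewrite expr0 subrr scale0r subrr; exact: pos0.
  have -> : 1 - k ^+ m.+1 - (m.+1%:R : R)%:C *: (j * k ^+ m.+1) =
      1 - k ^+ m - (m%:R : R)%:C *: (j * k ^+ m) +
      (m.+1%:R : R)%:C *: (j * j * k ^+ m).
    rewrite exprS {1 3}kE ll mulrBl mul1r mulrBr !mulrA -natr1.
    rewrite [(_ + _)%:C]rmorphD/= [1%:C]rmorph1; linear_identity.
  apply: posD => //; apply: posZ => //; rewrite jjk; apply: pos_sq.
  by rewrite mstarM star_exp// sj jlm.
have jk_le m : nr ((m%:R : R)%:C *: (j * k ^+ m)) <= 1.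
  have pjk : pos ((m%:R : R)%:C *: (j * k ^+ m)).
    apply: posZ => //; rewrite jk; apply: pos_sq.
    by rewrite mstarM star_exp// sx xlm.
  apply: nr_pos_le => //; first by case: pjk.
  have -> : cst 1 - (m%:R : R)%:C *: (j * k ^+ m) =
     1 - k ^+ m - (m%:R : R)%:C *: (j * k ^+ m) + l ^+ m * l ^+ m.
    by rewrite cst1 kE exp_sq; linear_identity.
  by apply: posD => //; apply: pos_sq; exact: star_exp.
have [m md] : exists m, (d ^+ 2)^-1 < m%:R.
  exists (Num.bound (d ^+ 2)^-1); apply: archi_boundP.
  by rewrite invr_ge0 exprn_ge0 ?ltW.
have {}md : 1 < d ^+ 2 * m%:R by rewrite -ltr_pdivrMl ?exprn_gt0// mulr1.
have [e Ie ke] : exists2 e, J e & k ^+ m = 1 - lmult e.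
  elim: m {md} => [|m [e Ie ke]].
    by exists 0; [exact: ideal0|rewrite expr0 lmult0 subr0].
  (* Obtained by expanding [(1 - i^2) (1 - e)]. *)
  exists (e + cmul i i - cmul (cmul i i) e).
    apply: idealB; first by apply: idealD => //; exact: ideal_mull.
    exact: ideal_mull.
  rewrite exprS ke kE ll mulrBl mul1r mulrBr mulr1 jE xE -!lmultM.
  by rewrite lmultB lmultD; linear_identity.
have sk : star (k ^+ m) = k ^+ m by apply: star_exp; rewrite kE mstarM sl.
exists e; rewrite -ke; split=> //.
- elim: (m) => [|n IH]; first by rewrite expr0 nr_le1.
  rewrite exprS (le_trans (nr_mul _ _))// mulr_ile1 ?nr_ge0//.
  by rewrite kE ll -cst1 jE; apply: nr_subsq => //; rewrite -jE.
(* The square of this norm is [|j k^(2m)|], at most [1 / (2m)] by [jk_le], while [1 < d^2 m]. *)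
- rewrite -(@ler_pXn2r _ 2)// ?nnegrE ?nr_ge0 ?(ltW d0)//.
  rewrite -nr_starM mstarM sk -xE sx -mulrA (mulrA x) -jE.
  have -> : k ^+ m * (j * k ^+ m) = j * k ^+ (m + m).
    rewrite exprD !mulrA; congr (_ * _); apply/esym/comm_exp.
    by have := jlm 1%N; rewrite expr1 kE => jl; rewrite mulrA jl -mulrA jl mulrA.
  have := jk_le (m + m)%N; rewrite nrZr ger0_norm//.
  rewrite natrD; have := nr_ge0 (j * k ^+ (m + m)).
  by have := exprn_ge0 2 (ltW d0); nra.
Qed.

Lemma ideal_approx i d : J i -> star i = i -> 0 < d ->
  exists e, [/\ J e, star (1 - lmult e) = 1 - lmult e :> U,
    nr (1 - lmult e : U) <= 1 & nr (lmult i * (1 - lmult e) : U) <= d].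
Proof.
move=> Ii si d0; have i1 : 0 < nr i + 1 by rewrite ltr_wpDl// nr_ge0.
pose i' := ((nr i + 1)^-1)%:C *: i.
have ii' : i = (nr i + 1)%:C *: i'.
  by rewrite scalerA -rmorphM mulfV ?gt_eqF// scale1r.
have [||||e [Ie se e1 ed]] := @ideal_approx_lt1 i' (d / (nr i + 1)).
- exact: idealZ.
- by rewrite starZr si.
- by rewrite nrZr ger0_norm ?invr_ge0 1?ltW// mulrC ltr_pdivrMr// mul1r ltrDl.
- exact: divr_gt0.
exists e; split=> //; rewrite ii' lmultZ mscaleAl nrZr ger0_norm ?(ltW i1)//.
by rewrite mulrC -ler_pdivlMr.
Qed.

(** If [a^* a <= d + i], multiply both sides by [1 - e] on the left and right, where [e] in [I] is
    chosen so that [i (1 - e)] is small: then [|a - a e|^2 <= 2 d]. So [a] is a limit of elements of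
    [I]. *)
Lemma ideal_pos a :
  (forall d, 0 < d -> exists i, [/\ J i, star i = i
     & pos (cst d + lmult i - lmult (cmul (star a) a))]) -> J a.
Proof.
move=> ha; apply: (proj1 (closed_nr J)); first by case: (ideal_closed_subspace I).
move=> r r0; pose d := r ^+ 2 / 2.
have d0 : 0 < d by rewrite divr_gt0// exprn_gt0.
have [i [Ii si pv]] := ha d d0.
have [e [Ie]] := ideal_approx Ii si d0.
have [w wE] : exists w : U, w = 1 - lmult e by eexists.
rewrite -wE => sw w1 iw.
exists (cmul a e); first exact: ideal_mull.
pose b := lmult a * w.
have <- : nr b = nr (a - cmul a e).
  by rewrite -nr_lmult lmultB lmultM /b wE mulrBr mulr1.
pose g := w * (cst d + lmult i) * w.
have sg : star g = g.
  by rewrite !mstarM sw starD star_cst -lmult_star si mulrA.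
have gd : nr g <= 2 * d.
  rewrite /g -mulrA mulrDl (le_trans (nr_mul _ _))//.
  have : nr (cst d * w + lmult i * w) <= 2 * d.
    rewrite (le_trans (nrD _ _))// cstMl nrZr ger0_norm ?(ltW d0)//.
    by have := ler_wpM2l (ltW d0) w1; lra.
  have := nr_ge0 (cst d * w + lmult i * w).
  by have := nr_ge0 w; nra.
have : nr (star b * b) <= 2 * d.
  apply: nr_pos_le; first by rewrite mulr_ge0// ltW.
  - by rewrite mstarM starK.
  - exact: pos_starM.
  have -> : cst (2 * d) - star b * b = (cst (2 * d) - g) +
      star w * (cst d + lmult i - lmult (cmul (star a) a)) * w.
    rewrite /b mstarM sw lmultM lmult_star mulrBr mulrBl -/g !mulrA.
    by linear_identity.
  by apply: posD; [exact: pos_nr|exact: pos_conj].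
rewrite nr_starM /d => b2.
by rewrite -(@ler_pXn2r _ 2)// ?nnegrE ?nr_ge0 ?(ltW r0)//; lra.
Qed.

Lemma ideal_sqrt a : J (cmul (star a) a) -> J a.
Proof.
move=> Iaa; apply: ideal_pos => d d0; exists (cmul (star a) a); split=> //.
  by rewrite starM starK.
by rewrite addrK; apply: pos_cst; exact: ltW.
Qed.

(** Closed ideals of [A] are stable under multipliers: [(T a)^* (T a) = a^* (T^* T a)] lies in [I],
    and [ideal_sqrt] removes the square. *)
Lemma ideal_mfun (T : U) a : J a -> J (T a).
Proof.
by move=> Ia; apply: ideal_sqrt; rewrite madjP; apply/ideal_mulr/ideal_star.
Qed.

End IdealApproximation.

(** * Extreme dominated functionals *)

Section ExtremeHahnBanach.
Context {R : realType} {V : lmodType R[i]}.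
Implicit Types (p q f g : V -> R) (u v w : V) (r c t : R).

Definition sublinear p := (forall u v, p (u + v) <= p u + p v) /\
  (forall r v, 0 < r -> p (r%:C *: v) <= r * p v).

Definition real_linear f := (forall u v, f (u + v) = f u + f v) /\
  (forall r v, f (r%:C *: v) = r * f v).

Lemma real_linear0 f : real_linear f -> f 0 = 0.
Proof. by move=> [fD _]; apply: (addrI (f 0)); rewrite -fD !addr0. Qed.

Lemma real_linearN f v : real_linear f -> f (- v) = - f v.
Proof.
by move=> fl; apply: (addrI (f v)); rewrite -fl.1 !subrr real_linear0.
Qed.

Lemma sublinear0 q : sublinear q -> q 0 = 0.
Proof.
move=> [qD qZ]; have := qD 0 0; rewrite addr0 => q0.
by have := qZ 2^-1 0; rewrite scaler0 invr_gt0 => /(_ (ltr0Sn _ 1)); lra.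
Qed.

Lemma sublinearZ q r v : sublinear q -> 0 < r -> q (r%:C *: v) = r * q v.
Proof.
move=> [_ qZ] r0; apply/eqP; rewrite eq_le qZ//=.
have := qZ r^-1 (r%:C *: v); rewrite scalerA -rmorphM mulVf ?gt_eqF//.
by rewrite rmorph1 scale1r invr_gt0 => /(_ r0); rewrite mulrC ler_pdivlMr// mulrC.
Qed.

Lemma sublinearN q v : sublinear q -> - q (- v) <= q v.
Proof.
by move=> ql; have := ql.1 v (- v); rewrite subrr sublinear0//; lra.
Qed.

(* The sublinear functional whose dominated linear functionals are those
   dominated by [q] that attain [q] at [v]. *)
Definition lower q v u : R :=
  inf [set q (u + t%:C *: v) - t * q v | t in [set t : R | 0 <= t]].

Lemma lower_lbound q v u : sublinear q ->
  lbound [set q (u + t%:C *: v) - t * q v | t in [set t : R | 0 <= t]] (- q (- u)).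
Proof.
move=> ql _ [t /= t0 <-]; have [->|tn0] := eqVneq t 0.
  by rewrite scale0r mul0r addr0 subr0 sublinearN.
have {}t0 : 0 < t by rewrite lt_neqAle eq_sym tn0.
have := ql.1 (u + t%:C *: v) (- u); rewrite [_ + - u]addrC addKr sublinearZ//.
by rewrite lerBrDr -lerBrDl opprK addrC.
Qed.

Lemma lower_le q v u t : sublinear q -> 0 <= t ->
  lower q v u <= q (u + t%:C *: v) - t * q v.
Proof.
move=> ql t0; apply: ge_inf; last by exists t.
by exists (- q (- u)); exact: lower_lbound.
Qed.

Lemma le_lower q v u c :
  (forall t, 0 <= t -> c <= q (u + t%:C *: v) - t * q v) -> c <= lower q v u.
Proof.
move=> h; apply: lb_le_inf; last by move=> _ [t t0 <-]; exact: h.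
by exists (q (u + 0%:C *: v) - 0 * q v), 0 => /=.
Qed.

Lemma lower_le_id q v u : sublinear q -> lower q v u <= q u.
Proof.
move=> ql; have := lower_le v u ql (lexx 0).
by rewrite scale0r mul0r addr0 subr0.
Qed.

Lemma lower_opp q v : sublinear q -> lower q v (- v) <= - q v.
Proof.
move=> ql; have := lower_le v (- v) ql ler01.
by rewrite scale1r addNr mul1r sublinear0// sub0r.
Qed.

Lemma sublinear_lower q v : sublinear q -> sublinear (lower q v).
Proof.
move=> ql; split=> [u w|r u r0].
  rewrite -lerBlDr; apply: le_lower => t t0; rewrite lerBlDr -lerBlDl.
  apply: le_lower => s s0.
  have := lower_le v (u + w) ql (addr_ge0 t0 s0).
  have := ql.1 (u + t%:C *: v) (w + s%:C *: v).
  by rewrite addrACA -scalerDl -rmorphD; lra.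
rewrite -ler_pdivrMl//; apply: le_lower => t t0; rewrite ler_pdivrMl//.
have := lower_le v (r%:C *: u) ql (mulr_ge0 (ltW r0) t0).
rewrite rmorphM -scalerA -scalerDr (sublinearZ _ ql r0); lra.
Qed.

Variable p : V -> R.
Hypothesis p_sublinear : sublinear p.

(* The linear functionals dominated by [q] form a face of those dominated by
   [p]; a minimal such [q] is itself linear, hence an extreme point. *)
Definition face q := [/\ sublinear q, forall v, q v <= p v
  & forall f g c, real_linear f -> real_linear g ->
    (forall v, f v <= p v) -> (forall v, g v <= p v) -> 0 < c < 1 ->
    (forall v, c * f v + (1 - c) * g v <= q v) ->
    (forall v, f v <= q v) /\ (forall v, g v <= q v)].

Lemma face_lower q v : face q -> face (lower q v).
Proof.
move=> [ql qp qf]; split; first exact: sublinear_lower.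
  by move=> u; apply: le_trans (qp u); exact: lower_le_id.
move=> f g c fl gl fp gp /andP[c0 c1] fgq.
have c01 : 0 < c < 1 by rewrite c0.
have [|fq gq] := qf f g c fl gl fp gp c01.
  by move=> u; apply: le_trans (fgq u) _; exact: lower_le_id.
(* At [- v] the domination says that the convex combination of [f v] and [g v] is at least [q v]; as
   neither exceeds [q v], both equal it. *)
have := le_trans (fgq (- v)) (lower_opp v ql).
rewrite !real_linearN// => fgv.
have [fv gv] : f v = q v /\ g v = q v.
  have := fq v; have := gq v => gv fv.
  have h1 := ler_wpM2l (ltW c0) fv.
  have h2 : (1 - c) * g v <= (1 - c) * q v by apply: ler_wpM2l => //; lra.
  have h3 : c * f v = c * q v by lra.
  have h4 : (1 - c) * g v = (1 - c) * q v by lra.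
  split; first by apply: (mulfI _ h3); rewrite gt_eqF.
  by apply: (mulfI _ h4); rewrite gt_eqF// subr_gt0.
split=> u; apply: le_lower => t t0; rewrite lerBrDr.
  by rewrite -fv -fl.2 -fl.1.
by rewrite -gv -gl.2 -gl.1.
Qed.

(** Staying below [lower p v0] forces the value [p v0] at [v0]. A minimal [q] satisfies
    [lower q v = q] for every [v], hence [q (- v) <= - q v], and an odd sublinear functional is
    linear. *)
Theorem extreme_hahn_banach v0 : exists q, [/\ real_linear q,
  forall v, q v <= p v, q v0 = p v0
  & forall f g c, real_linear f -> real_linear g ->
    (forall v, f v <= p v) -> (forall v, g v <= p v) -> 0 < c < 1 ->
    (forall v, c * f v + (1 - c) * g v = q v) -> f = q].
Proof.
pose q0 := lower p v0.
pose T := {q | face q /\ forall v, q v <= q0 v}.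
have t0 : T by exists q0; split=> //; exact: face_lower.
(* The order is reversed, so that a maximal element is a minimal functional. *)
pose rel (s t : T) := `[< forall v, sval t v <= sval s v >].
have [||||[q [qf qq0]] qmin] := @Zorn T rel.
- by move=> t; apply/asboolP.
- move=> r s t /asboolP rs /asboolP st; apply/asboolP => v.
  exact: le_trans (st v) (rs v).
- move=> [s sP] [t tP] /asboolP/= st /asboolP/= ts.
  apply: eq_exist; apply/funext => v; apply/eqP.
  by rewrite eq_le st ts.
- move=> F Ftot; have [[s0 Fs0]|F0] := pselect (exists s, F s); last first.
    by exists t0 => s Fs; exfalso; apply: F0; exists s.
  pose m v := inf [set sval s v | s in F].
  have mlb v : has_lbound [set sval s v | s in F].
    exists (- p (- v)) => _ [[s [[sl sp _] _]] /= _ <-].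
    by apply: le_trans (sublinearN v sl); rewrite lerN2.
  have mle s v : F s -> m v <= sval s v.
    by move=> Fs; apply: ge_inf => //; exists s.
  have lem c v : (forall s, F s -> c <= sval s v) -> c <= m v.
    move=> h; apply: lb_le_inf; first by exists (sval s0 v), s0.
    by move=> _ [s Fs <-]; exact: h.
  have msub : sublinear m.
    split=> [u v|r v r0].
      rewrite -lerBlDr; apply: (lem) => s Fs; rewrite lerBlDr -lerBlDl.
      apply: (lem) => t Ft; rewrite lerBlDl.
      (* At [u + v] the smaller of [s] and [t] is used, so that both values on the right dominate
         its own. *)
      have [/asboolP st|/asboolP ts] := Ftot _ _ Fs Ft.
        apply: (le_trans (mle t (u + v) Ft)).
        have [[tl _ _] _] := svalP t; apply: (le_trans (tl.1 u v)).
        by rewrite lerD2r.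
      apply: (le_trans (mle s (u + v) Fs)).
      have [[sl _ _] _] := svalP s; apply: (le_trans (sl.1 u v)).
      by rewrite lerD2l.
    rewrite -ler_pdivrMl//; apply: (lem) => s Fs; rewrite ler_pdivrMl//.
    apply: (le_trans (mle s _ Fs)).
    by have [[sl _ _] _] := svalP s; exact: sl.2.
  have mface : face m.
    split=> // [v|f g c fl gl fp gp c01 fgm].
      by apply: (le_trans (mle s0 v Fs0)); have [[_ ]] := svalP s0.
    have h s : F s -> (forall v, f v <= sval s v) /\ (forall v, g v <= sval s v).
      move=> Fs; have [[_ _ sf] _] := svalP s.
      by apply: (sf f g c) => // v; apply: le_trans (fgm v) (mle s v Fs).
    by split=> v; apply: (lem) => s /h[].
  have mq0 v : m v <= q0 v.
    by apply: (le_trans (mle s0 v Fs0)); have [_ ] := svalP s0.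
  exists (exist _ m (conj mface mq0)) => s Fs; apply/asboolP => v /=.
  exact: mle.
have [ql qp qext] := qf.
have qN v : q (- v) = - q v.
  apply/eqP; rewrite eq_le; apply/andP; split; last first.
    by have := sublinearN (- v) ql; rewrite opprK.
  have lq0 u : lower q v u <= q0 u.
    exact: le_trans (lower_le_id v u ql) (qq0 u).
  have := qmin (exist _ (lower q v) (conj (face_lower v qf) lq0)).
  have -> : rel (exist _ q (conj qf qq0))
      (exist _ (lower q v) (conj (face_lower v qf) lq0)).
    by apply/asboolP => u /=; exact: lower_le_id.
  by move=> /(_ erefl)/(congr1 sval)/= lq; have := lower_opp v ql; rewrite lq.
have qlin : real_linear q.
  split=> [u v|r v].
    apply/eqP; rewrite eq_le ql.1/=.
    have := ql.1 (u + v) (- v); rewrite addrK qN; lra.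
  have [r0|r0|->] := ltgtP r 0; last by rewrite scale0r mul0r sublinear0.
  - have := sublinearZ v ql (_ : 0 < - r); rewrite oppr_gt0 => /(_ r0).
    by rewrite rmorphN scaleNr qN; lra.
  - exact: sublinearZ.
exists q; split=> //.
- apply/eqP; rewrite eq_le qp/=.
  have := qq0 (- v0); rewrite qN.
  by have := lower_opp v0 p_sublinear; rewrite -/q0; lra.
- move=> f g c fl gl fp gp c01 fgq.
  have [|fq _] := qext f g c fl gl fp gp c01; first by move=> v; rewrite fgq.
  apply/funext => v; apply/eqP; rewrite eq_le fq/=.
  by have := fq (- v); rewrite !real_linearN//; lra.
Qed.

End ExtremeHahnBanach.

(** * Hilbert spaces *)

Section ComplexModulus.
Context {R : realType}.
Implicit Types (z w : R[i]) (r : R).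

Definition cn z : R := nr (z : R[i]^o).

Lemma cnE z : cn z = complex.Re `|z|. Proof. by []. Qed.

Lemma cn_ge0 z : 0 <= cn z. Proof. exact: nr_ge0. Qed.

Lemma cnD z w : cn (z + w) <= cn z + cn w. Proof. exact: nrD. Qed.

Lemma cnN z : cn (- z) = cn z. Proof. exact: nrN. Qed.

Lemma cn0 : cn 0 = 0. Proof. exact: nr0. Qed.

Lemma cn_distC z w : cn (z - w) = cn (w - z). Proof. exact: nr_distC. Qed.

Lemma cn_le_eq0 z : (forall e : R, 0 < e -> cn z <= e) -> z = 0.
Proof. exact: (@nr_le_eq0 _ R[i]^o). Qed.

Lemma cnM z w : cn (z * w) = cn z * cn w. Proof. exact: (nrZ z (w : R[i]^o)). Qed.

Lemma cnr r : cn r%:C = `|r|.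
Proof. by rewrite cnE normc_def/= expr0n addr0 sqrtr_sqr. Qed.

Lemma cn_conj z : cn (Num.conj z) = cn z.
Proof. by rewrite !cnE norm_conjC. Qed.

Lemma cn_sqr z : (cn z ^+ 2)%:C = z * Num.conj z.
Proof. by rewrite -normCK rmorphXn/= cnE RRe_real// ger0_real. Qed.

Lemma cn_sqrE z : cn z ^+ 2 = complex.Re z ^+ 2 + complex.Im z ^+ 2.
Proof. by rewrite cnE normc_def/= sqr_sqrtr// addr_ge0 ?sqr_ge0. Qed.

Lemma Re_le_cn z : `|complex.Re z| <= cn z.
Proof.
rewrite -(@ler_pXn2r _ 2)// ?nnegrE ?cn_ge0//.
by rewrite cn_sqrE real_normK ?num_real// lerDl sqr_ge0.
Qed.

Lemma Im_le_cn z : `|complex.Im z| <= cn z.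
Proof.
rewrite -(@ler_pXn2r _ 2)// ?nnegrE ?cn_ge0//.
by rewrite cn_sqrE real_normK ?num_real// lerDr sqr_ge0.
Qed.

Lemma cn_le z : cn z <= `|complex.Re z| + `|complex.Im z|.
Proof.
rewrite -(@ler_pXn2r _ 2)// ?nnegrE ?cn_ge0 ?addr_ge0// cn_sqrE.
rewrite -(real_normK (num_real (complex.Re z))).
rewrite -(real_normK (num_real (complex.Im z))).
have := normr_ge0 (complex.Re z); have := normr_ge0 (complex.Im z); nra.
Qed.

Lemma real_cauchy (u : nat -> R) :
  (forall e, 0 < e -> exists N : nat, forall m n, (N <= m)%N -> (N <= n)%N ->
    `|u m - u n| <= e) ->
  exists l, forall e, 0 < e -> exists N : nat, forall n, (N <= n)%N ->
    `|u n - l| <= e.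
Proof.
move=> cu.
have : cvg (u @ \oo).
  apply/cauchy_cvgP/cauchy_ballP => e e0.
  have [N uN] := cu (e / 2) (divr_gt0 e0 (ltr0Sn _ 1)).
  exists ([set u n | n in [set n | (N <= n)%N]],
          [set u n | n in [set n | (N <= n)%N]]).
    by split; exists N => // n /= Nn; exists n.
  move=> [a b] /= [[m Nm <-] [n Nn <-]].
  by rewrite /ball/=; apply: (le_lt_trans (uN _ _ Nm Nn)); lra.
move=> /cvg_ex[l ul]; exists l => e e0.
have /cvgrPdist_le/(_ e e0)[N _ uN] := ul.
by exists N => n /uN /=; rewrite distrC.
Qed.

Lemma complex_cauchy (u : nat -> R[i]) :
  (forall e, 0 < e -> exists N : nat, forall m n, (N <= m)%N -> (N <= n)%N ->
    cn (u m - u n) <= e) ->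
  exists l, forall e, 0 < e -> exists N : nat, forall n, (N <= n)%N ->
    cn (u n - l) <= e.
Proof.
move=> cu.
have [a ua] : exists a, forall e, 0 < e -> exists N : nat, forall n, (N <= n)%N ->
    `|complex.Re (u n) - a| <= e.
  apply: real_cauchy => e /cu[N uN]; exists N => m n Nm Nn.
  by rewrite -raddfB (le_trans (Re_le_cn _))// uN.
have [b ub] : exists b, forall e, 0 < e -> exists N : nat, forall n, (N <= n)%N ->
    `|complex.Im (u n) - b| <= e.
  apply: real_cauchy => e /cu[N uN]; exists N => m n Nm Nn.
  by rewrite -raddfB (le_trans (Im_le_cn _))// uN.
exists (Complex a b) => e e0; have e20 : 0 < e / 2 by exact: divr_gt0.
have [[M uM] [N uN]] := (ua _ e20, ub _ e20).
exists (maxn M N) => n; rewrite geq_max => /andP[/uM aM /uN bN].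
apply: (le_trans (cn_le _)); move: aM bN.
by case: (u n) => x y /=; lra.
Qed.

End ComplexModulus.

(** Degenerate forms are allowed, since a state may vanish at [u^* u] for nonzero [u]. *)
Record preinner (R : realType) (V : lmodType R[i]) := Preinner {
  pin :> V -> V -> R[i] ;
  pinP : forall (c : R[i]) u v w, pin (c *: u + v) w = c * pin u w + pin v w ;
  pin_conj : forall u v, pin u v = Num.conj (pin v u) ;
  pin_ge0 : forall u, 0 <= complex.Re (pin u u)
}.

Section PreinnerTheory.
Context {R : realType} {V : lmodType R[i]} (B : preinner V).
Implicit Types (u v w : V).

Lemma pin0l w : B 0 w = 0.
Proof.
have := pinP B 1 0 0 w; rewrite scale1r addr0 mul1r => h.
by apply: (addrI (B 0 w)); rewrite -h addr0.
Qed.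

Lemma pinDl u v w : B (u + v) w = B u w + B v w.
Proof. by have := pinP B 1 u v w; rewrite scale1r mul1r. Qed.

Lemma pinZl (c : R[i]) u w : B (c *: u) w = c * B u w.
Proof. by have := pinP B c u 0 w; rewrite !addr0 pin0l addr0. Qed.

Lemma pinDr u v w : B w (u + v) = B w u + B w v.
Proof. by rewrite !(pin_conj B w) pinDl rmorphD. Qed.

Lemma pinZr (c : R[i]) u w : B w (c *: u) = Num.conj c * B w u.
Proof. by rewrite !(pin_conj B w) pinZl rmorphM. Qed.

Lemma pinNl u w : B (- u) w = - B u w.
Proof. by rewrite -scaleN1r pinZl mulN1r. Qed.

Lemma pinNr u w : B w (- u) = - B w u.
Proof. by rewrite !(pin_conj B w) pinNl rmorphN. Qed.

Definition sn u : R := Num.sqrt (complex.Re (B u u)).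

Lemma sn_ge0 u : 0 <= sn u. Proof. exact: sqrtr_ge0. Qed.

Lemma sn_sqr u : sn u ^+ 2 = complex.Re (B u u).
Proof. by rewrite sqr_sqrtr ?pin_ge0. Qed.

Lemma pin_real u : B u u = (complex.Re (B u u))%:C.
Proof.
have := pin_conj B u u; case: (B u u) => a b /=.
by case=> bb; congr Complex; lra.
Qed.

Lemma cauchy_schwarz u v : cn (B u v) <= sn u * sn v.
Proof.
rewrite -(@ler_pXn2r _ 2)// ?nnegrE ?cn_ge0 ?mulr_ge0 ?sn_ge0//.
rewrite exprMn !sn_sqr; set a := complex.Re (B u u); set b := complex.Re (B v v).
have [m mE] : exists m, m = cn (B u v) ^+ 2 by eexists.
rewrite -mE.
have a0 : 0 <= a := pin_ge0 B u; have b0 : 0 <= b := pin_ge0 B v.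
have m0 : 0 <= m by rewrite mE exprn_ge0// cn_ge0.
have quad (r : R) : 0 <= a - 2 * r * m + r ^+ 2 * m * b.
  have := pin_ge0 B (u + (- (r%:C * B u v)) *: v).
  rewrite pinDl !pinDr !pinZl !pinZr (pin_conj B v u) (pin_real u) (pin_real v).
  rewrite -/a -/b !rmorphN !rmorphM/= conjr.
  have -> : a%:C + - (r%:C * Num.conj (B u v)) * B u v +
     (- (r%:C * B u v) * Num.conj (B u v) +
      - (r%:C * B u v) * (- (r%:C * Num.conj (B u v)) * b%:C)) =
     (a - 2 * r * m + r ^+ 2 * m * b)%:C.
    have {}mE : m%:C = B u v * Num.conj (B u v) by rewrite mE cn_sqr.
    by ring: mE.
  by [].
have [->|mn0] := eqVneq m 0; first by rewrite mulr_ge0.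
have {}m0 : 0 < m by rewrite lt_neqAle eq_sym mn0.
(* If [b = 0] and [m] is nonzero, [r = (a + 1) / (2 m)] would make the quadratic expression equal to
   [-1]. *)
have [bz|bn0] := eqVneq b 0.
  have := quad ((a + 1) / (2 * m)); rewrite bz mulr0 addr0.
  have -> : 2 * ((a + 1) / (2 * m)) * m = a + 1 by field; rewrite gt_eqF.
  by lra.
have {}b0 : 0 < b by rewrite lt_neqAle eq_sym bn0.
have := quad b^-1.
have -> : a - 2 * b^-1 * m + b^-1 ^+ 2 * m * b = a - m / b by field; rewrite gt_eqF.
by rewrite subr_ge0 ler_pdivrMr.
Qed.

End PreinnerTheory.

(* The completion of a pre-Hilbert space, realised as the closure of the
   functionals [B v] among the antilinear functionals bounded by the seminorm. *)
Record hilb (R : realType) (V : lmodType R[i]) (B : preinner V) := Hilb {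
  hfun :> V -> R[i] ;
  happrox : forall e : R, 0 < e ->
    exists v, forall w, cn (hfun w - B v w) <= e * sn B w
}.

Section HilbertCompletion.
Context {R : realType} {V : lmodType R[i]} {B : preinner V}.
Local Notation H := (hilb B).
Implicit Types (x y z : H) (u v w : V) (c e r : R).

Lemma hilb_eq x y : (forall w, x w = y w) -> x = y.
Proof.
case: x y => [f fP] [g gP] /= /funext fg; case: _ / fg gP => gP.
by congr Hilb; exact: Prop_irrelevance.
Qed.

Lemma hilb_bounded x : exists2 c, 0 <= c & forall w, cn (x w) <= c * sn B w.
Proof.
have [v xv] := happrox x ltr01; exists (1 + sn B v) => [|w].
  by rewrite addr_ge0// sn_ge0.
rewrite -(subrK (B v w) (x w)) (le_trans (cnD _ _))// mulrDl lerD//.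
exact: cauchy_schwarz.
Qed.

Lemma hilbP x (k : R[i]) u v : x (k *: u + v) = Num.conj k * x u + x v.
Proof.
apply/eqP; rewrite -subr_eq0; apply/eqP/cn_le_eq0 => e e0.
pose s := sn B (k *: u + v) + cn k * sn B u + sn B v.
have s0 : 0 <= s by rewrite !addr_ge0 ?mulr_ge0 ?sn_ge0 ?cn_ge0.
have s1 : 0 < s + 1 by rewrite ltr_wpDl.
have [z xz] := happrox x (divr_gt0 e0 s1).
have -> : x (k *: u + v) - (Num.conj k * x u + x v) =
    (x (k *: u + v) - B z (k *: u + v)) - Num.conj k * (x u - B z u) - (x v - B z v).
  by rewrite pinDr pinZr; ring.
apply: (@le_trans _ _ (e / (s + 1) * s)); last first.
  by rewrite mulrAC ler_pdivrMr// ler_wpM2l ?(ltW e0)// lerDl.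
apply: (le_trans (cnD _ _)); rewrite cnN.
have := cnD (x (k *: u + v) - B z (k *: u + v)) (- (Num.conj k * (x u - B z u))).
rewrite cnN cnM cn_conj /s; move: (e / _) xz => d xz.
have := xz (k *: u + v); have := xz v; have := ler_wpM2l (cn_ge0 k) (xz u); lra.
Qed.

Program Definition hzero := @Hilb R V B (fun=> 0) _.
Next Obligation.
by move=> e e0; exists 0 => w; rewrite pin0l subrr cn0 mulr_ge0 ?sn_ge0 ?ltW.
Qed.

Program Definition hopp x := @Hilb R V B (fun w => - x w) _.
Next Obligation.
move=> x e e0; have [v xv] := happrox x e0; exists (- v) => w.
by rewrite pinNl -opprD cnN xv.
Qed.

Program Definition hadd x y := @Hilb R V B (fun w => x w + y w) _.
Next Obligation.
move=> x y e e0; have e20 : 0 < e / 2 by exact: divr_gt0.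
have [[u xu] [v yv]] := (happrox x e20, happrox y e20).
exists (u + v) => w; rewrite pinDl opprD addrACA (le_trans (cnD _ _))//.
by have := xu w; have := yv w; lra.
Qed.

Program Definition hscale (k : R[i]) x := @Hilb R V B (fun w => k * x w) _.
Next Obligation.
move=> k x e e0; have k1 : 0 < cn k + 1 by rewrite ltr_wpDl// cn_ge0.
have [v xv] := happrox x (divr_gt0 e0 k1); exists (k *: v) => w.
rewrite pinZl -mulrBr cnM; have := xv w.
rewrite mulrAC ler_pdivlMr//.
by have := cn_ge0 (x w - B v w); lra.
Qed.

Program Definition hin v := @Hilb R V B (B v) _.
Next Obligation.
by move=> v e e0; exists v => w; rewrite subrr cn0 mulr_ge0 ?sn_ge0 ?ltW.
Qed.

HB.instance Definition _ := gen_eqMixin H.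
HB.instance Definition _ := gen_choiceMixin H.

Let haddA : associative hadd.
Proof. by move=> x y z; apply: hilb_eq => a /=; rewrite addrA. Qed.
Let haddC : commutative hadd.
Proof. by move=> x y; apply: hilb_eq => a /=; rewrite addrC. Qed.
Let hadd0 : left_id hzero hadd.
Proof. by move=> x; apply: hilb_eq => a /=; rewrite add0r. Qed.
Let haddN : left_inverse hzero hopp hadd.
Proof. by move=> x; apply: hilb_eq => a /=; rewrite addNr. Qed.
HB.instance Definition _ := GRing.isZmodule.Build H haddA haddC hadd0 haddN.

Let hscaleA k l x : hscale k (hscale l x) = hscale (k * l) x.
Proof. by apply: hilb_eq => a /=; rewrite mulrA. Qed.
Let hscale1 : left_id 1 hscale.
Proof. by move=> x; apply: hilb_eq => a /=; rewrite mul1r. Qed.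
Let hscaleDr : right_distributive hscale +%R.
Proof. by move=> k x y; apply: hilb_eq => a /=; rewrite mulrDr. Qed.
Let hscaleDl x : {morph hscale^~ x : k l / k + l}.
Proof. by move=> k l; apply: hilb_eq => a /=; rewrite mulrDl. Qed.
HB.instance Definition _ := GRing.Zmodule_isLmodule.Build R[i] H
  hscaleA hscale1 hscaleDr hscaleDl.

Definition hn x : R := inf [set c : R | 0 <= c /\ forall w, cn (x w) <= c * sn B w].

Lemma hn_le x c : 0 <= c -> (forall w, cn (x w) <= c * sn B w) -> hn x <= c.
Proof. by move=> c0 xc; apply: ge_inf => //; exists 0 => d []. Qed.

Let hn_has_inf x :
  [set c : R | 0 <= c /\ forall w, cn (x w) <= c * sn B w] !=set0.
Proof. by have [c c0 xc] := hilb_bounded x; exists c; split. Qed.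

Lemma hn_ge0 x : 0 <= hn x.
Proof. by apply: (lb_le_inf (hn_has_inf x)) => c []. Qed.

Lemma hnP x w : cn (x w) <= hn x * sn B w.
Proof.
have [w0|w0] := eqVneq (sn B w) 0.
  have [c c0 xc] := hilb_bounded x.
  by rewrite (le_trans (xc w))// w0 !mulr0.
have w_gt0 : 0 < sn B w by rewrite lt_neqAle eq_sym w0 sn_ge0.
rewrite -ler_pdivrMr//; apply: (lb_le_inf (hn_has_inf x)) => c [c0 xc].
by rewrite ler_pdivrMr.
Qed.

Let hnorm x : R[i] := (hn x)%:C.

Let hnormD x y : hnorm (x + y) <= hnorm x + hnorm y.
Proof.
rewrite -rmorphD lecR; apply: hn_le => [|a]; first by rewrite addr_ge0// hn_ge0.
by rewrite mulrDl (le_trans (cnD _ _))// lerD// hnP.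
Qed.

Let hnormZ k x : hnorm (k *: x) = `|k| * hnorm x.
Proof.
have le l y : hn (l *: y) <= cn l * hn y.
  apply: hn_le => [|a]; first by rewrite mulr_ge0 ?hn_ge0 ?cn_ge0.
  by rewrite cnM -mulrA ler_wpM2l ?cn_ge0 ?hnP.
have -> : `|k| = (cn k)%:C by rewrite cnE RRe_real// ger0_real.
rewrite -rmorphM; congr (_ %:C); apply/eqP; rewrite eq_le le andTb.
have [->|k0] := eqVneq k 0; first by rewrite cn0 mul0r hn_ge0.
have := le k^-1 (k *: x); rewrite scalerA mulVf// scale1r => lex.
apply: (le_trans (ler_wpM2l (cn_ge0 k) lex)); rewrite mulrA -cnM mulfV//.
by rewrite -(rmorph1 (real_complex R)) cnr normr1 mul1r.
Qed.

Let hnorm0 x : hnorm x = 0 -> x = 0.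
Proof.
move=> /complexI x0; apply: hilb_eq => a; apply: cn_le_eq0 => e e0.
by rewrite (le_trans (hnP _ _))// x0 mul0r ltW.
Qed.

HB.instance Definition _ := Lmodule_isNormed.Build R[i] H hnormD hnormZ hnorm0.

Lemma nr_hilbP x w : cn (x w) <= nr x * sn B w. Proof. exact: hnP. Qed.

Lemma nr_hin v : nr (hin v) = sn B v.
Proof.
apply/eqP; rewrite eq_le; apply/andP; split.
  by apply: hn_le => [|w]; [exact: sn_ge0|exact: cauchy_schwarz].
have [->|v0] := eqVneq (sn B v) 0; first exact: nr_ge0.
have v_gt0 : 0 < sn B v by rewrite lt_neqAle eq_sym v0 sn_ge0.
rewrite -(ler_pM2r v_gt0); apply: le_trans (nr_hilbP (hin v) v).
by rewrite -expr2 sn_sqr /= pin_real cnr ler_norm.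
Qed.

Lemma hinP (k : R[i]) u v : hin (k *: u + v) = k *: hin u + hin v.
Proof. by apply: hilb_eq => w; rewrite /= pinP. Qed.

Lemma hin_dense x e : 0 < e -> exists v, nr (x - hin v) <= e.
Proof.
move=> e0; have [v xv] := happrox x e0; exists v.
by apply: hn_le => [|w]; [exact: ltW|exact: xv].
Qed.

Lemma hilb_complete (F : set_system H) : ProperFilter F -> cauchy F -> cvg F.
Proof.
apply: complete_nr => u cu.
have cf w : exists l, forall e, 0 < e -> exists N : nat, forall n, (N <= n)%N ->
    cn (u n w - l) <= e.
  apply: complex_cauchy => e e0.
  have w1 : 0 < sn B w + 1 by rewrite ltr_wpDl// sn_ge0.
  have [N uN] := cu (e / (sn B w + 1)) (divr_gt0 e0 w1).
  exists N => m n Nm Nn; apply: (le_trans (nr_hilbP (u m - u n) w)).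
  have := uN _ _ Nm Nn; rewrite ler_pdivlMr//.
  by have := nr_ge0 (u m - u n); lra.
have [f fP] := choice cf.
have uf e : 0 < e -> exists N, forall n, (N <= n)%N ->
    forall w, cn (u n w - f w) <= e * sn B w.
  move=> e0; have [N uN] := cu e e0; exists N => n Nn w.
  apply/ler_addgt0Pl => d d0; have [M uM] := fP w d d0.
  pose m := maxn M N.
  rewrite -(subrK (u m w) (u n w)) -addrA (le_trans (cnD _ _))//.
  have := uM m (leq_maxl _ _); have := nr_hilbP (u n - u m) w.
  have := ler_wpM2r (sn_ge0 B w) (uN n m Nn (leq_maxr _ _)).
  by rewrite /=; lra.
have fa e : 0 < e -> exists v, forall w, cn (f w - B v w) <= e * sn B w.
  move=> e0; have e20 : 0 < e / 2 by exact: divr_gt0.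
  have [N uN] := uf _ e20; have [v uv] := happrox (u N) e20; exists v => w.
  rewrite -(subrK (u N w) (f w)) -addrA (le_trans (cnD _ _))// cn_distC.
  by have := uN N (leqnn N) w; have := uv w; lra.
exists (Hilb fa) => e e0; have [N uN] := uf e e0; exists N => n Nn.
by apply: hn_le => [|w]; [exact: ltW|exact: uN].
Qed.

HB.instance Definition _ := Uniform_isComplete.Build H hilb_complete.

Lemma hilbB x u v : x (u - v) = x u - x v.
Proof.
have := hilbP x (-1) v u; rewrite scaleN1r addrC => ->.
by rewrite rmorphN rmorph1 mulN1r addrC.
Qed.

Lemma hinB u v : hin (u - v) = hin u - hin v.
Proof. by rewrite addrC -scaleN1r hinP scaleN1r addrC. Qed.

(** [x v] plays the role of the inner product of [x] with [hin v]; [d] is its continuous extension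
    to [y], the limit of [x] along vectors [hin v] approaching [y]. *)
Lemma hinner_exists x y :
  exists d : R[i], forall v, cn (d - x v) <= nr x * nr (y - hin v).
Proof.
have apx n : exists v, nr (y - hin v) <= (2^-1) ^+ n.
  by apply: hin_dense; rewrite exprn_gt0 ?invr_gt0.
have [f fP] := choice apx.
have xdist u v : cn (x u - x v) <= nr x * nr (hin u - hin v).
  by rewrite -hilbB -hinB nr_hin nr_hilbP.
have f0 e : 0 < e -> exists N : nat, forall n, (N <= n)%N -> nr (y - hin (f n)) <= e.
  move=> e0.
  have [N fN] := half_expr_small e0.
  by exists N => n Nn; exact: le_trans (fP n) (fN n Nn).
have [e e0|d dP] := @complex_cauchy R (fun n => x (f n)).
  have x1 : 0 < nr x + 1 by rewrite ltr_wpDl// nr_ge0.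
  have [N fN] := f0 (e / 2 / (nr x + 1)) (divr_gt0 (divr_gt0 e0 (ltr0Sn _ 1)) x1).
  exists N => m n Nm Nn; apply: (le_trans (xdist _ _)).
  rewrite -(subrK y (hin (f m))) -addrA.
  have := fN m Nm; have := fN n Nn; rewrite !ler_pdivlMr// => h1 h2.
  have := nrD (hin (f m) - y) (y - hin (f n)); rewrite (nr_distC (hin (f m))).
  move=> /(ler_wpM2l (nr_ge0 x)).
  have := nr_ge0 (y - hin (f m)); have := nr_ge0 (y - hin (f n)); lra.
exists d => v; apply/ler_addgt0Pl => e e0.
have x1 : 0 < nr x + 1 by rewrite ltr_wpDl// nr_ge0.
have [N1 fN] := f0 (e / 2 / (nr x + 1)) (divr_gt0 (divr_gt0 e0 (ltr0Sn _ 1)) x1).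
have [N2 dN] := dP (e / 2) (divr_gt0 e0 (ltr0Sn _ 1)).
pose n := maxn N1 N2.
have := fN n (leq_maxl _ _); rewrite ler_pdivlMr// => h1.
have h2 := dN n (leq_maxr _ _).
rewrite -(subrK (x (f n)) d) -addrA (le_trans (cnD _ _))// cn_distC.
have := xdist (f n) v; rewrite -(subrK y (hin (f n))) -addrA.
have := nrD (hin (f n) - y) (y - hin v); rewrite (nr_distC (hin (f n))).
move=> /(ler_wpM2l (nr_ge0 x)).
have := nr_ge0 (y - hin (f n)); lra.
Qed.

Definition hinner x y : R[i] := projT1 (cid (hinner_exists x y)).

Lemma hinnerP x y v : cn (hinner x y - x v) <= nr x * nr (y - hin v).
Proof. exact: (projT2 (cid (hinner_exists x y))). Qed.

(** Any Lipschitz constant will do, so identities for [hinner] reduce to an estimate against vectors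
    of the dense image. *)
Lemma hinner_unique x y (d : R[i]) c : 0 <= c ->
  (forall v, cn (d - x v) <= c * nr (y - hin v)) -> hinner x y = d.
Proof.
move=> c0 dP; apply/eqP; rewrite -subr_eq0; apply/eqP/cn_le_eq0 => e e0.
have x1 : 0 < nr x + c + 1 by rewrite ltr_wpDl// addr_ge0// nr_ge0.
have [v] := hin_dense y (divr_gt0 e0 x1); rewrite ler_pdivlMr// => yv.
rewrite -(subrK (x v) (hinner x y)) -addrA (le_trans (cnD _ _))//.
have := dP v; rewrite cn_distC; have := hinnerP x y v.
by have := nr_ge0 (y - hin v); lra.
Qed.

Lemma hinner_in x v : hinner x (hin v) = x v.
Proof.
apply/eqP; rewrite -subr_eq0; apply/eqP/cn_le_eq0 => e e0.
by rewrite (le_trans (hinnerP _ _ _))// subrr nr0 mulr0 ltW.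
Qed.

Lemma hinner_linear (k : R[i]) x y z :
  hinner (k *: x + y) z = k * hinner x z + hinner y z.
Proof.
apply: (@hinner_unique _ _ _ (cn k * nr x + nr y)).
  by rewrite addr_ge0 ?mulr_ge0 ?nr_ge0 ?cn_ge0.
move=> v /=.
have -> : k * hinner x z + hinner y z - (k * x v + y v) =
  k * (hinner x z - x v) + (hinner y z - y v) by ring.
rewrite (le_trans (cnD _ _))// mulrDl lerD ?hinnerP// cnM -mulrA.
by rewrite ler_wpM2l ?cn_ge0 ?hinnerP.
Qed.

Lemma hinner_bound x y : cn (hinner x y) <= nr x * nr y.
Proof.
have := hinnerP x y 0.
have -> : x 0 = 0 by rewrite -(subrr (0 : V)) hilbB subrr.
have -> : hin 0 = 0 by apply: hilb_eq => w; rewrite /= pin0l.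
by rewrite !subr0.
Qed.

Lemma hinner_conj x y : hinner x y = Num.conj (hinner y x).
Proof.
(* Symmetry is extended in one variable at a time: the case [x = hin u] comes from symmetry of [B],
   and density then handles general [x]. *)
suff in_case u z : hinner (hin u) z = Num.conj (z u).
  apply: (@hinner_unique _ _ _ (nr x)); first exact: nr_ge0.
  move=> v; rewrite -(conjCK (x v)) -rmorphB cn_conj -in_case.
  have -> : hinner y x - hinner (hin v) x = hinner (y - hin v) x.
    have -> : y - hin v = -1 *: hin v + y by rewrite scaleN1r addrC.
    by rewrite hinner_linear mulN1r addrC.
  by rewrite mulrC hinner_bound.
apply: (@hinner_unique _ _ _ (sn B u)); first exact: sn_ge0.
move=> v /=; rewrite pin_conj -rmorphB cn_conj mulrC.
exact: (nr_hilbP (z - hin v)).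
Qed.

Lemma hinner_norm x : hinner x x = (nr x ^+ 2)%:C.
Proof.
apply/eqP; rewrite -subr_eq0; apply/eqP/cn_le_eq0 => e e0.
(* If [hin v] is at distance [d <= 1] from [x], the three errors below add up to at most
   [d (2 |x| + 2 |hin v|) <= d (4 |x| + 2)]. *)
pose s := 4 * nr x + 2; have s0 : 0 < s by rewrite ltr_wpDl// mulr_ge0// nr_ge0.
have es : 0 < Num.min 1 (e / s) by rewrite lt_min ltr01 divr_gt0.
have [v] := hin_dense x es; rewrite le_min => /andP[xv1 xve].
rewrite ler_pdivlMr// in xve.
have h1 := hinnerP x x v.
have h2 := nr_hilbP (x - hin v) v; rewrite -nr_hin in h2.
have h3 := nr_dist_le x (hin v); have h4 := nr_dist_le (hin v) x.
rewrite nr_distC in h4.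
have -> : hinner x x - (nr x ^+ 2)%:C = (hinner x x - x v) + (x v - B v v) +
    (nr (hin v) ^+ 2 - nr x ^+ 2)%:C.
  by rewrite rmorphB/= {1}nr_hin sn_sqr -pin_real; ring.
rewrite (le_trans (cnD _ _))// cnr.
have := cnD (hinner x x - x v) (x v - B v v).
have n0 := nr_ge0 x; have d0 := nr_ge0 (x - hin v); have v0 := nr_ge0 (hin v).
have : `|nr (hin v) ^+ 2 - nr x ^+ 2| <= nr (x - hin v) * (nr (hin v) + nr x).
  by rewrite ler_norml; apply/andP; split; nra.
rewrite /= in h2; rewrite /s in xve; nra.
Qed.

Let hinner_bilinear : bilinear_for ( *%R) (Num.conj \; *%R) hinner.
Proof.
split=> [y k x z|x k y z]; first exact: hinner_linear.
rewrite [LHS]hinner_conj (hinner_conj x y) (hinner_conj x z) hinner_linear.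
by rewrite rmorphD rmorphM.
Qed.

Let hinner_herm x y : hinner x y = (-1) ^+ false * Num.conj (hinner y x).
Proof. by rewrite expr0 mul1r hinner_conj. Qed.

Let hinner_gt0 x : x != 0 -> 0 < hinner x x.
Proof.
move=> x0; rewrite hinner_norm ltcR exprn_gt0// lt_neqAle nr_ge0 andbT eq_sym.
by apply: contra x0 => /eqP/nr0_eq0 ->.
Qed.

HB.instance Definition _ := @bilinear_isBilinear.Build R[i] H H R[i]
  ( *%R) (Num.conj \; *%R) hinner hinner_bilinear.
HB.instance Definition _ :=
  @isHermitianSesquilinear.Build R[i] H false Num.conj hinner hinner_herm.
HB.instance Definition _ := @isDotProduct.Build R[i] H hinner hinner_gt0.

Let hinner_normE x : (hinner : {dot H for Num.conj}) x x = `|x| ^+ 2.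
Proof. by rewrite [LHS]hinner_norm nrE rmorphXn. Qed.

HB.instance Definition _ := isHilbert.Build R H hinner_normE.

Lemma hdotE x y : hdot x y = hinner x y. Proof. by []. Qed.

End HilbertCompletion.

(** * Orthogonal projections in Hilbert spaces *)

Section HilbertFacts.
Context {R : realType} {H : hilbertType R}.
Implicit Types (x y z : H) (c : R[i]) (S : set H).

Let hdot_lin c x y z : hdot (c *: x + y) z = c * hdot x z + hdot y z.
Proof. by rewrite linearDl linearZl_LR. Qed.

Let hdot_herm x y : hdot x y = Num.conj (hdot y x).
Proof. by rewrite hermitian_subproof expr0 mul1r. Qed.

Let hdot_ge0 x : 0 <= complex.Re (hdot x x).
Proof. by rewrite hdot_norm nrE -rmorphXn/= exprn_ge0// nr_ge0. Qed.

Definition hdot_pin : preinner H := Preinner hdot_lin hdot_herm hdot_ge0.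

Lemma hdotDl x y z : hdot (x + y) z = hdot x z + hdot y z.
Proof. exact: (pinDl hdot_pin). Qed.
Lemma hdotDr x y z : hdot z (x + y) = hdot z x + hdot z y.
Proof. exact: (pinDr hdot_pin). Qed.
Lemma hdotZl c x z : hdot (c *: x) z = c * hdot x z.
Proof. exact: (pinZl hdot_pin). Qed.
Lemma hdotZr c x z : hdot z (c *: x) = Num.conj c * hdot z x.
Proof. exact: (pinZr hdot_pin). Qed.
Lemma hdotNl x z : hdot (- x) z = - hdot x z.
Proof. exact: (pinNl hdot_pin). Qed.
Lemma hdotNr x z : hdot z (- x) = - hdot z x.
Proof. exact: (pinNr hdot_pin). Qed.
Lemma hdotBl x y z : hdot (x - y) z = hdot x z - hdot y z.
Proof. by rewrite hdotDl hdotNl. Qed.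
Lemma hdotBr x y z : hdot z (x - y) = hdot z x - hdot z y.
Proof. by rewrite hdotDr hdotNr. Qed.
Lemma hdot0l x : hdot 0 x = 0. Proof. exact: (pin0l hdot_pin). Qed.
Lemma hdot_conj x y : hdot x y = Num.conj (hdot y x). Proof. exact: hdot_herm. Qed.

Lemma hdot0r x : hdot x 0 = 0. Proof. by rewrite hdot_conj hdot0l rmorph0. Qed.

Lemma hdot_nr x : hdot x x = (nr x ^+ 2)%:C.
Proof. by rewrite hdot_norm nrE -rmorphXn. Qed.

Lemma Re_hdot_nr x : complex.Re (hdot x x) = nr x ^+ 2.
Proof. by rewrite hdot_nr. Qed.

Lemma hdot_bound x y : cn (hdot x y) <= nr x * nr y.
Proof.
have := cauchy_schwarz hdot_pin x y.
by rewrite /sn/= !Re_hdot_nr !sqrtr_sqr !ger0_norm ?nr_ge0.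
Qed.

Lemma hdot_eq0 x : (forall y, hdot x y = 0) -> x = 0.
Proof.
move=> /(_ x); rewrite hdot_nr => /complexI/eqP; rewrite sqrf_eq0 => /eqP.
exact: nr0_eq0.
Qed.

Lemma complex_Re_conj c : complex.Re (Num.conj c) = complex.Re c.
Proof. by case: c. Qed.

Lemma nr_sqrB x y :
  nr (x - y) ^+ 2 = nr x ^+ 2 - 2 * complex.Re (hdot x y) + nr y ^+ 2.
Proof.
rewrite -!Re_hdot_nr hdotBl !hdotBr (hdot_conj y x) !raddfB/=.
by rewrite complex_Re_conj; lra.
Qed.

Lemma parallelogram x y :
  nr (x + y) ^+ 2 + nr (x - y) ^+ 2 = 2 * nr x ^+ 2 + 2 * nr y ^+ 2.
Proof.
have := nr_sqrB x (- y); rewrite opprK nrN hdotNr raddfN/= nr_sqrB; lra.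
Qed.

Lemma subspaceZ S c x : closed_subspace S -> S x -> S (c *: x).
Proof. by move=> [_ S0 Slin] Sx; rewrite -(addr0 (c *: x)); exact: Slin. Qed.

(** Moving [y] by [(r z) s] changes the squared distance by [r |z|^2 (r |s|^2 - 2)], which is
    negative unless [z = 0] because [r |s|^2 < 1]. *)
Lemma closest_orthogonal S x y : closed_subspace S -> S y ->
  (forall s, S s -> nr (x - y) <= nr (x - s)) -> forall s, S s -> hdot (x - y) s = 0.
Proof.
move=> Ssub Sy ymin s Ss; pose w := x - y; pose z := hdot w s.
pose r := (nr s ^+ 2 + 1)^-1.
have s1 : 0 < nr s ^+ 2 + 1 by rewrite ltr_wpDl// exprn_ge0// nr_ge0.
have r0 : 0 < r by rewrite invr_gt0.
have Sr : S (y + (r%:C * z) *: s) by rewrite addrC; case: Ssub => _ _; apply.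
have := ymin _ Sr; rewrite opprD addrA -(@ler_pXn2r _ 2)// ?nnegrE ?nr_ge0//.
rewrite [leRHS]nr_sqrB -/w hdotZr -/z nrZ -cnE cnM cnr ger0_norm ?(ltW r0)//.
rewrite rmorphM/= conjr -mulrA (mulrC _ z) -cn_sqr -rmorphM/=.
rewrite !exprMn => h.
have rs : r * (nr s ^+ 2 + 1) = 1 by rewrite /r mulVf// gt_eqF.
have z0 : cn z ^+ 2 <= 0.
  have n0 := exprn_ge0 2 (cn_ge0 z).
  have : 0 <= r * (cn z ^+ 2 * (r * nr s ^+ 2 - 2)) by lra.
  rewrite pmulr_rge0// => h'; have rs' : r * nr s ^+ 2 = 1 - r by lra.
  by move: h'; rewrite rs'; nra.
apply: cn_le_eq0 => e e0.
rewrite (_ : cn _ = 0) ?ltW//; apply/eqP.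
by rewrite -sqrf_eq0 eq_le z0 exprn_ge0// cn_ge0.
Qed.

Lemma projection S x : closed_subspace S ->
  exists2 y, S y & forall s, S s -> hdot (x - y) s = 0.
Proof.
move=> Ssub; have [Scl S0 Slin] := Ssub.
pose d := inf [set nr (x - s) ^+ 2 | s in S].
have dlb s : S s -> d <= nr (x - s) ^+ 2.
  move=> Ss; apply: ge_inf; last by exists s.
  by exists 0 => _ [t _ <-]; rewrite exprn_ge0// nr_ge0.
have dinf e : 0 < e -> exists2 s, S s & nr (x - s) ^+ 2 <= d + e.
  move=> e0; have hi : has_inf [set nr (x - s) ^+ 2 | s in S].
    split; first by exists (nr (x - 0) ^+ 2), 0.
    by exists 0 => _ [t _ <-]; rewrite exprn_ge0// nr_ge0.
  by have [_ [s Ss <-] sd] := inf_adherent e0 hi; exists s => //; exact: ltW.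
have [u uP] : exists u : nat -> H, forall n,
    S (u n) /\ nr (x - u n) ^+ 2 <= d + (2^-1) ^+ n.
  have /choice[u uP] n : exists s, S s /\ nr (x - s) ^+ 2 <= d + (2^-1) ^+ n.
    by have [|s Ss sd] := dinf ((2^-1) ^+ n); [rewrite exprn_gt0 ?invr_gt0|exists s].
  by exists u.
have half a b : S a -> S b -> nr (a - b) ^+ 2 <=
    2 * nr (x - a) ^+ 2 + 2 * nr (x - b) ^+ 2 - 4 * d.
  move=> Sa Sb; have := parallelogram (x - a) (x - b).
  have -> : x - a - (x - b) = - (a - b) by linear_identity.
  rewrite nrN; pose m := (2^-1 : R)%:C *: (a + b).
  have Sm : S m.
    by apply: subspaceZ => //; rewrite -(scale1r a); exact: Slin.
  have -> : x - a + (x - b) = (2 : R)%:C *: (x - m).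
    rewrite scalerBr /m scalerA -rmorphM mulfV ?pnatr_eq0// scale1r.
    by rewrite [_%:C]rmorph_nat scaler_nat mulr2n; linear_identity.
  by rewrite nrZr ger0_norm// exprMn; have := dlb m Sm; lra.
have [e e0|y uy] := @cauchy_cvg_nr _ H u.
  have [N hN] := half_expr_small (divr_gt0 (exprn_gt0 2 e0) (ltr0Sn _ 3)).
  exists N => m n Nm Nn.
  rewrite -(@ler_pXn2r _ 2)// ?nnegrE ?nr_ge0 ?(ltW e0)//.
  have [[Sm um] [Sn un]] := (uP m, uP n).
  by have := half _ _ Sm Sn; have := hN m Nm; have := hN n Nn; lra.
have Sy : S y.
  apply: (proj1 (closed_nr S)) => // e e0; have [N uN] := uy e e0.
  by exists (u N); [exact: (uP N).1|rewrite nr_distC uN].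
exists y => //; apply: closest_orthogonal => // s Ss.
apply/ler_addgt0Pr => e e0.
have [N1 uN] := uy (e / 2) (divr_gt0 e0 (ltr0Sn _ 1)).
have e40 : 0 < e ^+ 2 / 4 by rewrite divr_gt0 ?exprn_gt0.
have [N2 hN] := half_expr_small e40.
pose n := maxn N1 N2.
have h1 := uN n (leq_maxl _ _); have h2 := hN n (leq_maxr _ _).
have : nr (x - u n) <= nr (x - s) + e / 2.
  rewrite -(@ler_pXn2r _ 2)// ?nnegrE ?nr_ge0 ?addr_ge0 ?nr_ge0//; last lra.
  have := (uP n).2; have := dlb s Ss; have := nr_ge0 (x - s); nra.
move=> h3; have := nrD (x - u n) (u n - y); rewrite addrA subrK; lra.
Qed.

End HilbertFacts.

(** * Representations are contractive *)

Section RepresentationBound.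
Context {R : realType} {A : cstarAlgType R} {H : hilbertType R}.
Variable pi : A -> {linear H -> H}.
Hypothesis pi_rep : is_representation pi.

Lemma reprD a b x : pi (a + b) x = pi a x + pi b x.
Proof. by have := repr_linear pi_rep 1 a b x; rewrite !scale1r. Qed.

Lemma repr0 x : pi 0 x = 0.
Proof. by apply: (addrI (pi 0 x)); rewrite -reprD !addr0. Qed.

Lemma reprZ (c : R[i]) a x : pi (c *: a) x = c *: pi a x.
Proof. by have := repr_linear pi_rep c a 0 x; rewrite !addr0 repr0 addr0. Qed.

Lemma reprB a b x : pi (a - b) x = pi a x - pi b x.
Proof. by rewrite reprD -scaleN1r reprZ scaleN1r. Qed.

(* If [k = 1 - sqrt (1 - a^*a)] then
   [|x|^2 - |pi a x|^2 = |x - pi k x|^2]. *)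
Lemma repr_contract a x : nr a < 1 -> nr (pi a x) <= nr x.
Proof.
move=> a1; pose h := cmul (star a) a.
have sh : star h = h by rewrite starM starK.
have h1 : nr h < 1 by rewrite nr_cstar expr_lt1// nr_ge0.
have [k [sk kh _ _]] := csqrt1B sh h1.
rewrite -(@ler_pXn2r _ 2)// ?nnegrE ?nr_ge0//.
have : nr (pi a x) ^+ 2 = 2 * complex.Re (hdot x (pi k x)) - nr (pi k x) ^+ 2.
  rewrite -!Re_hdot_nr -(repr_star pi_rep) -(repr_mul pi_rep) -/h -kh.
  rewrite reprB reprD (repr_mul pi_rep) hdotBl hdotDl raddfB raddfD/=.
  rewrite -[X in hdot (pi X (pi _ _)) _]sk (repr_star pi_rep).
  by rewrite (hdot_conj (pi k x) x) complex_Re_conj; lra.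
by have := nr_sqrB x (pi k x); have := exprn_ge0 2 (nr_ge0 (x - pi k x)); lra.
Qed.

(** [is_representation] asks only for continuity of each operator; continuity in [a], which makes
    kernels closed, has to be derived. *)
Lemma repr_bound a x : nr (pi a x) <= nr a * nr x.
Proof.
apply/ler_addgt0Pr => e e0.
have x1 : 0 < nr x + 1 by rewrite ltr_wpDl// nr_ge0.
pose t := nr a + e / (nr x + 1).
have t0 : 0 < t by rewrite ltr_wpDl ?nr_ge0// divr_gt0.
have := @repr_contract ((t^-1)%:C *: a) x.
rewrite reprZ !nrZr ger0_norm ?invr_ge0 ?(ltW t0)//.
rewrite !(mulrC t^-1) ltr_pdivrMr// mul1r ltrDl divr_gt0// => /(_ isT).
rewrite ler_pdivrMr// => h; apply: (le_trans h).
rewrite /t mulrDr mulrC lerD2l mulrCA ler_piMr ?(ltW e0)//.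
by rewrite ler_pdivrMr// mul1r lerDl.
Qed.

End RepresentationBound.

(** * Pure states and the GNS representation *)

Section QuotientStates.
Context {R : realType} {A : cstarAlgType R} (I : closed_ideal A) (a0 : A).
Hypothesis a0I : ~ ideal_set I a0.
Local Notation U := (multiplier A).
Local Notation J := (ideal_set I).
Implicit Types (u v w : U) (t r : R) (a i : A).

Definition re v : U := (2^-1 : R)%:C *: (v + star v).

Lemma re_sa v : star (re v) = re v.
Proof. by rewrite starZr starD starK addrC. Qed.

Lemma re_id v : star v = v -> re v = v.
Proof. by move=> sv; rewrite /re sv half_double. Qed.

Lemma reD u v : re (u + v) = re u + re v.
Proof. by rewrite /re starD; linear_identity. Qed.

Lemma reZ r v : re (r%:C *: v) = r%:C *: re v.
Proof. by rewrite /re starZr; linear_identity. Qed.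

Lemma reN v : re (- v) = - re v.
Proof. by rewrite /re starN; linear_identity. Qed.

(* The upper bounds of [v] in the quotient by [I]; their infimum is the supremum
   of [Re (f v)] over the states [f] vanishing on [I]. *)
Definition qbounds v : set R :=
  [set t | exists i, [/\ J i, star i = i & pos (cst t - re v + lmult i)]].

Definition qsup v : R := inf (qbounds v).

(** The quotient by [I] is nonzero: from [i >= r] one gets [a0^* a0 <= r^-1 a0^* i a0], whose right
    side is in [I], and [ideal_pos] would put [a0] in [I]. *)
Lemma pos_modI r i : 0 < r -> J i -> ~ pos (lmult i - cst r : U).
Proof.
move=> r0 Ji pir; apply: a0I; apply: ideal_pos => d d0.
pose j := cmul (star a0) (cmul i a0).
have sj : star i = i -> star j = j by move=> si; rewrite /j !starM starK si cmulA.
have si : star i = i.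
  have := pir.1; rewrite starB star_cst -lmult_star => /addIr h.
  apply/eqP; rewrite -subr_eq0; apply/eqP/nr0_eq0.
  by rewrite -nr_lmult lmultB h subrr nr0.
exists (r^-1%:C *: j); split.
- by apply: idealZ; apply: ideal_mull; exact: ideal_mulr.
- by rewrite starZr sj.
have -> : cst d + lmult (r^-1%:C *: j) - lmult (cmul (star a0) a0) =
   cst d + r^-1%:C *: (star (lmult a0) * (lmult i - cst r) * lmult a0).
  rewrite mulrBr mulrBl -mulrA -lmult_star -!lmultM cstMr mscaleAl -lmultM.
  rewrite lmultZ scalerBr scalerA -rmorphM mulVf ?gt_eqF// scale1r addrA.
  by rewrite /j.
apply: posD; first exact/pos_cst/ltW.
by apply: posZ; [rewrite invr_ge0 ltW|exact: pos_conj].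
Qed.

Lemma qbounds_nr v : qbounds v (nr (re v)).
Proof.
exists 0; split; [exact: ideal0|exact: star0|].
by rewrite lmult0 addr0; apply: pos_nr => //; exact: re_sa.
Qed.

(** This makes [qsup] a genuine infimum: a smaller [t] would yield an element of [I] above a
    positive scalar, contradicting [pos_modI]. *)
Lemma qbounds_lb v : lbound (qbounds v) (- nr (re v)).
Proof.
move=> t [i [Ji si pt]]; rewrite leNgt; apply/negP => tv.
apply: (@pos_modI (- (t + nr (re v))) i) => //; first by lra.
have -> : lmult i - cst (- (t + nr (re v))) =
  (cst t - re v + lmult i) + (cst (nr (re v)) - (- re v)).
  by rewrite cstN cstD; linear_identity.
by apply: posD => //; apply: pos_nr; rewrite ?starN ?re_sa ?nrN.
Qed.

Lemma qsup_le v t : qbounds v t -> qsup v <= t.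
Proof.
by move=> vt; apply: ge_inf => //; exists (- nr (re v)); exact: qbounds_lb.
Qed.

Lemma le_qsup v t : (forall s, qbounds v s -> t <= s) -> t <= qsup v.
Proof.
by move=> h; apply: lb_le_inf => //; exists (nr (re v)); exact: qbounds_nr.
Qed.

Lemma sublinear_qsup : sublinear qsup.
Proof.
split=> [u v|r v r0].
  rewrite -lerBlDr; apply: le_qsup => s [i [Ji si ps]]; rewrite lerBlDr -lerBlDl.
  apply: le_qsup => t [j [Jj sj pt]]; rewrite lerBlDl; apply: qsup_le.
  exists (i + j); split; [exact: idealD|by rewrite starD si sj|].
  have -> : cst (s + t) - re (u + v) + lmult (i + j) =
    (cst s - re u + lmult i) + (cst t - re v + lmult j).
    by rewrite cstD reD lmultD; linear_identity.
  exact: posD.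
rewrite -ler_pdivrMl//; apply: le_qsup => s [i [Ji si ps]].
rewrite ler_pdivrMl//; apply: qsup_le; exists (r%:C *: i); split.
- exact: idealZ.
- by rewrite starZr si.
- rewrite reZ lmultZ -cstZ -scalerBr -scalerDr; apply: posZ => //; exact: ltW.
Qed.

(** Otherwise every [d > 0] would bound [a0^* a0] modulo [I], and [ideal_pos] would put [a0] in
    [I]. *)
Lemma qsup_gt0 : 0 < qsup (lmult (cmul (star a0) a0)).
Proof.
set v := lmult _; have sv : star v = v by rewrite -lmult_star starM starK.
rewrite ltNge; apply/negP => v0; apply: a0I; apply: ideal_pos => d d0.
have hi : has_inf (qbounds v).
  split; first by exists (nr (re v)); exact: qbounds_nr.
  by exists (- nr (re v)); exact: qbounds_lb.
have [t [i [Ji si pt]] td] := inf_adherent d0 hi.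
exists i; split=> //; rewrite -/v.
have -> : cst d + lmult i - v = (cst t - re v + lmult i) + cst (d - t).
  by rewrite re_id// cstB; linear_identity.
by apply: posD => //; apply: pos_cst; move: td; rewrite -/(qsup v); lra.
Qed.

(** The real part of a state vanishing on [I]: the Hahn-Banach argument works with real functionals,
    and [cstate] restores the complex one. *)
Definition quotient_state (f : U -> R) := [/\ real_linear f,
  forall v, f (star v) = f v, forall v, pos v -> 0 <= f v,
  forall i, J i -> f (lmult i) = 0 & f 1 = 1].

Lemma quotient_state_re f v : quotient_state f -> f (re v) = f v.
Proof. by move=> [[fD fZ] fs _ _ _]; rewrite fZ fD fs; lra. Qed.

Lemma quotient_state_le f v : quotient_state f -> f v <= qsup v.
Proof.
move=> fst; have [fl fs fp fI f1] := fst.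
apply: le_qsup => t [i [Ji si pt]]; have := fp _ pt.
rewrite !fl.1 real_linearN// (quotient_state_re _ fst) fI// fl.2 f1; lra.
Qed.

(** [qbounds] sees only the selfadjoint part, so [f] kills skew elements; the other properties come
    from explicit bounds at [- v], at plus or minus the selfadjoint part of [lmult i], and at [1]
    and [- 1]. *)
Lemma le_quotient_state f : real_linear f -> (forall v, f v <= qsup v) ->
  quotient_state f.
Proof.
move=> fl fq; have fle0 v : qbounds v 0 -> f v <= 0.
  by move=> v0; apply: le_trans (fq v) _; exact: qsup_le.
have eq0 v : qbounds v 0 -> qbounds (- v) 0 -> f v = 0.
  move=> /fle0 v0 /fle0; rewrite real_linearN// => v0'.
  by apply/eqP; rewrite eq_le v0/=; lra.
have skew v : re v = 0 -> f v = 0.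
  move=> rv; apply: eq0; exists 0; rewrite star0 ?reN rv cst0 ?oppr0 addr0 lmult0 addr0.
    by split; [exact: ideal0| |exact: pos0].
  by split; [exact: ideal0| |exact: pos0].
split=> // [v|v pv|i Ji|].
- have : f (star v - v) = 0.
    by apply: skew; rewrite /re starB starK; linear_identity.
  by rewrite fl.1 real_linearN//; lra.
- have : f (- v) <= 0.
    apply: fle0; exists 0; split; [exact: ideal0|exact: star0|].
    by rewrite lmult0 addr0 cst0 sub0r reN opprK re_id//; exact: pv.1.
  by rewrite real_linearN//; lra.
- pose j := (2^-1 : R)%:C *: (i + star i).
  have Jj : J j by apply/idealZ/idealD => //; exact: ideal_star.
  have sj : star j = j by rewrite starZr starD starK addrC.
  have rj : re (lmult i) = lmult j by rewrite /re -lmult_star -lmultD -lmultZ.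
  apply: eq0.
    by exists j; split=> //; rewrite rj cst0 sub0r addNr; exact: pos0.
  exists (- j); split; [by rewrite -scaleN1r; exact: idealZ|by rewrite starN sj|].
  by rewrite reN rj cst0 lmultN sub0r addNr; exact: pos0.
- have h1 : f 1 <= 1.
    apply: le_trans (fq 1) _; apply: qsup_le; exists 0.
    split; [exact: ideal0|exact: star0|].
    by rewrite lmult0 addr0 re_id ?mstar1// cst1 subrr; exact: pos0.
  have h2 : f (- 1) <= - 1.
    apply: le_trans (fq (- 1)) _; apply: qsup_le; exists 0.
    split; [exact: ideal0|exact: star0|].
    by rewrite lmult0 addr0 reN re_id ?mstar1// cstN cst1 subrr; exact: pos0.
  by move: h2; rewrite real_linearN// => h2; apply/eqP; rewrite eq_le h1/=; lra.
Qed.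

Theorem pure_state_exists : exists q : U -> R, [/\ quotient_state q,
  0 < q (lmult (cmul (star a0) a0))
  & forall f g c, quotient_state f -> quotient_state g -> 0 < c < 1 ->
    (forall v, c * f v + (1 - c) * g v = q v) -> f = q].
Proof.
have [q [ql qle q0 qext]] :=
  extreme_hahn_banach sublinear_qsup (lmult (cmul (star a0) a0)).
exists q; split; first exact: le_quotient_state.
  by rewrite q0; exact: qsup_gt0.
move=> f g c fst gst; have [fl _ _ _ _] := fst; have [gl _ _ _ _] := gst.
by apply: (qext f g c) => // v; exact: quotient_state_le.
Qed.

End QuotientStates.

Section GNS.
Context {R : realType} {A : cstarAlgType R} (I : closed_ideal A).
Local Notation U := (multiplier A).
Local Notation J := (ideal_set I).
Variable q : U -> R.
Hypothesis q_state : quotient_state I q.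
Implicit Types (u v w m : U) (t r : R) (a i : A).

Let q_lin : real_linear q. Proof. by case: q_state. Qed.
Let q_star v : q (star v) = q v. Proof. by case: q_state. Qed.
Let q_pos v : pos v -> 0 <= q v. Proof. by case: q_state => _ _ h _ _; exact: h. Qed.
Let q_ideal i : J i -> q (lmult i) = 0.
Proof. by case: q_state => _ _ _ h _; exact: h. Qed.
Let q_1 : q 1 = 1. Proof. by case: q_state. Qed.

(** The unique complex-linear functional with real part [q]. *)
Definition cstate v : R[i] := Complex (q v) (- q ('i%C *: v)).

Lemma cstate_linear (k : R[i]) u v : cstate (k *: u + v) = k * cstate u + cstate v.
Proof.
have cdec (l : R[i]) w : q (l *: w) =
    complex.Re l * q w + complex.Im l * q ('i%C *: w).
  have -> : l *: w = (complex.Re l)%:C *: w + (complex.Im l)%:C *: ('i%C *: w).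
    by rewrite scalerA -scalerDl; congr (_ *: _); rewrite [LHS]complexE mulrC.
  by rewrite q_lin.1 !q_lin.2.
rewrite /cstate; case: k => x y; apply/eqP; rewrite eq_complex/=.
apply/andP; split; apply/eqP.
  by rewrite q_lin.1 cdec/=; lra.
by rewrite scalerDr scalerA q_lin.1 cdec/=; lra.
Qed.

Lemma cstate_star v : cstate (star v) = Num.conj (cstate v).
Proof.
congr Complex; first exact: q_star.
have -> : 'i%C *: star v = - star ('i%C *: v).
  rewrite starZ -scaleNr; congr (_ *: _).
  by apply/eqP; rewrite eq_complex/= oppr0 opprK !eqxx.
by rewrite real_linearN// q_star.
Qed.

Let B_lin (k : R[i]) u v w :
  cstate (star w * (k *: u + v)) = k * cstate (star w * u) + cstate (star w * v).
Proof. by rewrite mulrDr mscaleAr cstate_linear. Qed.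

Let B_conj u v : cstate (star v * u) = Num.conj (cstate (star u * v)).
Proof. by rewrite -cstate_star mstarM starK. Qed.

Let B_ge0 u : 0 <= complex.Re (cstate (star u * u)).
Proof. exact/q_pos/pos_starM. Qed.

Definition gns_form : preinner U :=
  @Preinner R U (fun u v => cstate (star v * u)) B_lin B_conj B_ge0.

Local Notation H := (hilb gns_form).

(** The state is nonnegative at [w^* (|m|^2 - m^* m) w]. *)
Lemma gns_sn_mul m w : sn gns_form (m * w) <= nr m * sn gns_form w.
Proof.
rewrite -(@ler_pXn2r _ 2)// ?nnegrE ?mulr_ge0 ?sn_ge0 ?nr_ge0//.
rewrite exprMn !sn_sqr /=.
have : pos (star w * (cst (nr m ^+ 2) - star m * m) * w).
  by apply: pos_conj; apply: pos_nr; rewrite ?nr_starM// mstarM starK.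
move=> /q_pos; rewrite mulrBr mulrBl cstMr mscaleAl.
by rewrite q_lin.1 real_linearN// q_lin.2 mstarM !mulrA; lra.
Qed.

(** Elements of [H] are functionals on [U], so left multiplication by [m] acts through [star m] on
    the argument; on the dense image it is [m * v], see [gns_op_hin]. *)
Program Definition gns_op m (x : H) : H :=
  @Hilb R U gns_form (fun w => x (star m * w)) _.
Next Obligation.
move=> m x e e0; have m1 : 0 < nr m + 1 by rewrite ltr_wpDl// nr_ge0.
have [v xv] := happrox x (divr_gt0 e0 m1); exists (m * v) => w.
have -> : gns_form (m * v) w = gns_form v (star m * w).
  by rewrite /= mstarM starK mulrA.
apply: (le_trans (xv _)); have := gns_sn_mul (star m) w; rewrite nr_star => h.
rewrite mulrAC ler_pdivrMr// -mulrA ler_wpM2l ?(ltW e0)//.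
by have := sn_ge0 gns_form w; lra.
Qed.

Lemma gns_op_linear m : linear (gns_op m).
Proof. by move=> k x y; apply: hilb_eq. Qed.

HB.instance Definition _ m :=
  GRing.isLinear.Build R[i] H H *:%R (gns_op m) (gns_op_linear m).

Lemma nr_gns_op m (x : H) : nr (gns_op m x) <= nr m * nr x.
Proof.
apply: hn_le => [|w]; first by rewrite mulr_ge0 ?nr_ge0.
apply: (le_trans (nr_hilbP x _)); rewrite (mulrC (nr m)) -mulrA ler_wpM2l ?nr_ge0//.
by have := gns_sn_mul (star m) w; rewrite nr_star.
Qed.

Lemma gns_opM m n (x : H) : gns_op (m * n) x = gns_op m (gns_op n x).
Proof. by apply: hilb_eq => w; rewrite /= mstarM mulrA. Qed.

Lemma gns_op_hin m v : gns_op m (hin v) = hin (m * v) :> H.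
Proof. by apply: hilb_eq => w; rewrite /= mstarM starK mulrA. Qed.

Lemma gns_op_star m (x y : H) : hdot (gns_op (star m) x) y = hdot x (gns_op m y).
Proof.
apply/eqP; rewrite -subr_eq0; apply/eqP/cn_le_eq0 => e e0.
pose s := 2 * nr x * nr m + 1.
have s0 : 0 < s by rewrite ltr_wpDl// !mulr_ge0 ?nr_ge0.
have [v] := hin_dense y (divr_gt0 e0 s0); rewrite ler_pdivlMr// => yv.
have E : hdot (gns_op (star m) x) (hin v) = hdot x (gns_op m (hin v)).
  by rewrite gns_op_hin !hdotE !hinner_in /= starK.
have -> : hdot (gns_op (star m) x) y - hdot x (gns_op m y) =
    hdot (gns_op (star m) x) (y - hin v) - hdot x (gns_op m (y - hin v)).
  by rewrite (linearB (gns_op m)) !hdotBr E; ring.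
apply: (le_trans (cnD _ _)); rewrite cnN.
have h1 := hdot_bound (gns_op (star m) x) (y - hin v).
have h2 := hdot_bound x (gns_op m (y - hin v)).
have h3 := nr_gns_op (star m) x; rewrite nr_star in h3.
have h4 := nr_gns_op m (y - hin v).
have h5 := ler_wpM2r (nr_ge0 (y - hin v)) h3.
have h6 := ler_wpM2l (nr_ge0 x) h4.
by have := nr_ge0 (y - hin v); move: yv; rewrite /s; lra.
Qed.

Definition gns_rep a : {linear H -> H} := gns_op (lmult a).

Lemma gns_is_representation : is_representation gns_rep.
Proof.
split.
- move=> a; apply: (continuous_nr (nr_ge0 (lmult a))) => x y.
  by rewrite -(linearB (gns_op (lmult a))) nr_gns_op.
- move=> c a b x; apply: hilb_eq => w /=.
  by rewrite lmultP starD starZ mulrDl mscaleAl hilbP conjCK.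
- by move=> a b x; rewrite /= lmultM gns_opM.
- by move=> a x y; rewrite /= lmult_star gns_op_star.
Qed.

(** The value at [w] is bounded by the seminorm of [i^* w], whose square is the state at
    [w^* i i^* w]; this lies in [I] by [ideal_mfun]. *)
Lemma gns_rep_ideal i x : J i -> gns_rep i x = 0.
Proof.
move=> Ji; apply: hilb_eq => w /=.
suff s0 : sn gns_form (star (lmult i) * w) = 0.
  apply: cn_le_eq0 => e e0.
  by rewrite (le_trans (nr_hilbP x _))// s0 mulr0 ltW.
apply/eqP; rewrite -sqrf_eq0 sn_sqr /= mstarM starK; apply/eqP.
pose j := cmul i (star i).
have sj : star j = j by rewrite starM starK.
have -> : star w * lmult i * (star (lmult i) * w) =
    lmult (mfun (star w) (star (mfun (star w) j))).
  rewrite -mulrA (mulrA (lmult i)) -lmult_star -lmultM -/j.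
  rewrite -[lmult j * w](starK (_ : U)) mstarM -lmult_star sj lmult_mul.
  by rewrite -lmult_star lmult_mul.
by apply/q_ideal/ideal_mfun/ideal_star/ideal_mfun; exact: ideal_mulr.
Qed.

Definition gns_vec : H := @hin _ _ gns_form (1 : U).

Lemma hdot_gns_vec (x : H) v : hdot x (gns_op v gns_vec) = x v.
Proof. by rewrite gns_op_hin mulr1 hdotE hinner_in. Qed.

Lemma hdot_gns_vec_vec v : hdot (gns_op v gns_vec) gns_vec = cstate v.
Proof. by rewrite gns_op_hin mulr1 hdotE hinner_in /= mstar1 mul1r. Qed.

Lemma gns_op_lin (k : R[i]) u v (x : H) :
  gns_op (k *: u + v) x = k *: gns_op u x + gns_op v x.
Proof.
by apply: hilb_eq => w /=; rewrite starD starZ mulrDl mscaleAl hilbP conjCK.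
Qed.

Definition vec_functional (x : H) v : R := complex.Re (hdot (gns_op v x) x).

Lemma vec_functional_lin x : real_linear (vec_functional x).
Proof.
split=> [u v|r v]; rewrite /vec_functional.
  by have := gns_op_lin 1 u v x; rewrite !scale1r => ->; rewrite hdotDl raddfD.
have := gns_op_lin r%:C v 0 x; rewrite !addr0 => ->.
have -> : gns_op 0 x = 0.
  apply: hilb_eq => w /=; rewrite star0 mul0r.
  by rewrite -(subrr (0 : U)) hilbB subrr.
by rewrite addr0 hdotZl; case: (hdot _ _) => a b /=; rewrite mul0r subr0.
Qed.

Lemma vec_functional_state x (c : R) : 0 < c -> nr x ^+ 2 = c ->
  quotient_state I (fun v => c^-1 * vec_functional x v).
Proof.
move=> c0 xc; have fl := vec_functional_lin x.
have c1 : 0 <= c^-1 by rewrite invr_ge0 ltW.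
have f1 : vec_functional x 1 = c.
  rewrite -xc -Re_hdot_nr /vec_functional; congr (complex.Re (hdot _ _)).
  by apply: hilb_eq => w /=; rewrite mstar1 mul1r.
split=> [|v|v pv|i Ji|].
- by split=> [u v|r v]; rewrite ?fl.1 ?fl.2 ?mulrDr// mulrCA.
- by rewrite /vec_functional gns_op_star hdot_conj complex_Re_conj.
(* Only [v] plus a positive scalar has a root; since the functional takes the value [c] at 1, adding
   [e / c] shifts it by exactly [e]. *)
- rewrite mulr_ge0//; apply/ler_addgt0Pr => e e0.
  have ec : 0 < e / c by exact: divr_gt0.
  have [l [sl ll _]] := pos_sqrt pv ec.
  have : vec_functional x (l * l) = nr (gns_op l x) ^+ 2.
    by rewrite /vec_functional gns_opM -{1}sl gns_op_star Re_hdot_nr.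
  rewrite ll fl.1 fl.2 f1 divfK ?gt_eqF// => ->.
  by rewrite exprn_ge0// nr_ge0.
- have -> : vec_functional x (lmult i) = 0; last by rewrite mulr0.
  by rewrite /vec_functional -[gns_op _ x]/(gns_rep i x) gns_rep_ideal// hdot0l.
- by rewrite f1 mulVf// gt_eqF.
Qed.

Hypothesis q_extreme : forall f g (c : R), quotient_state I f ->
  quotient_state I g -> 0 < c < 1 ->
  (forall v, c * f v + (1 - c) * g v = q v) -> f = q.

(* The projection of the cyclic vector on an invariant subspace decomposes the
   state into two vector states; by extremality the projection is a multiple of
   the cyclic vector. *)
Lemma gns_irreducible (S : set H) : closed_subspace S ->
  (forall m x, S x -> S (gns_op m x)) -> S = [set 0] \/ S = setT.
Proof.
move=> Ssub Sinv; have [Scl S0 Slin] := Ssub.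
have [y Sy yort] := projection gns_vec Ssub.
have [z zE] : exists z, z = gns_vec - y by eexists.
rewrite -zE in yort.
have vecE : gns_vec = y + z by rewrite zE addrC subrK.
have full : S gns_vec -> S = setT.
  move=> Sv; apply/seteqP; split=> // x _; apply: (proj1 (closed_nr S)) => // e e0.
  have [v xv] := hin_dense x e0; exists (hin v) => //.
  by rewrite -[v]mulr1 -gns_op_hin; exact: Sinv.
have ortR m s : S s -> hdot (gns_op m z) s = 0.
  by move=> Ss; rewrite -(starK m) gns_op_star; apply: yort; exact: Sinv.
have ortL m s : S s -> hdot (gns_op m s) z = 0.
  by move=> Ss; rewrite hdot_conj yort ?rmorph0//; exact: Sinv.
have split v : q v = vec_functional y v + vec_functional z v.
  have -> : q v = complex.Re (hdot (gns_op v gns_vec) gns_vec).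
    by rewrite hdot_gns_vec_vec.
  rewrite {1 2}vecE (linearD (gns_op v)) hdotDl !hdotDr (ortR v y)// (ortL v y)//.
  by rewrite addr0 add0r raddfD.
have f1 x : vec_functional x 1 = nr x ^+ 2.
  rewrite -Re_hdot_nr /vec_functional; congr (complex.Re (hdot _ _)).
  by apply: hilb_eq => w /=; rewrite mstar1 mul1r.
have yz1 : nr y ^+ 2 + nr z ^+ 2 = 1 by rewrite -!f1 -split q_1.
have y0 := exprn_ge0 2 (nr_ge0 y); have z0 := exprn_ge0 2 (nr_ge0 z).
have [yz|yn0] := eqVneq (nr y ^+ 2) 0.
  (* Here the cyclic vector is [z], and its whole orbit is orthogonal to [S]. *)
  left; apply/seteqP; split=> [s Ss /=|_ -> //].
  have {}yz : y = 0 by apply/nr0_eq0/eqP; rewrite -sqrf_eq0 yz.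
  apply: hilb_eq => w; rewrite -hdot_gns_vec vecE yz add0r.
  by rewrite hdot_conj ortR// rmorph0.
right; apply: full.
have [zz|zn0] := eqVneq (nr z ^+ 2) 0.
  have {}zz : z = 0 by apply/nr0_eq0/eqP; rewrite -sqrf_eq0 zz.
  by rewrite vecE zz addr0.
have {}y0 : 0 < nr y ^+ 2 by rewrite lt_neqAle eq_sym yn0.
have {}z0 : 0 < nr z ^+ 2 by rewrite lt_neqAle eq_sym zn0.
set c := nr y ^+ 2 in y0 yn0 yz1.
have cz : nr z ^+ 2 = 1 - c by lra.
have c1 : 0 < 1 - c by lra.
have fq := q_extreme (vec_functional_state y0 erefl)
  (vec_functional_state c1 cz) (_ : 0 < c < 1) _.
have {fq}yq v : vec_functional y v = c * q v.
  rewrite -fq; first by rewrite mulrA mulfV// mul1r.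
    by rewrite y0; lra.
  by move=> u; rewrite !mulrA !mulfV ?gt_eqF// !mul1r split.
have yc v : hdot (gns_op v y) gns_vec = c%:C * hdot (gns_op v gns_vec) gns_vec.
  rewrite hdot_gns_vec_vec {1}vecE hdotDr ortL// addr0.
  (* Extremality compares real parts only; imaginary parts follow by using the identity at
     ['i%C *: v]. *)
  have im (x : R[i]) : complex.Im x = - complex.Re ('i%C * x).
    by case: x => a b /=; rewrite mul0r mul1r sub0r opprK.
  have yi := yq ('i%C *: v).
  rewrite /vec_functional in yq yi.
  have E : gns_op ('i%C *: v) y = 'i%C *: gns_op v y.
    apply: hilb_eq => w /=; rewrite starZ mscaleAl.
    by have := hilbP y (Num.conj 'i%C) (star v * w) 0;
      rewrite addr0 conjCK -(subrr (0 : U)) hilbB !subrr addr0.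
  rewrite E hdotZl in yi.
  apply/eqP; rewrite eq_complex im yi yq /=; apply/andP; split; apply/eqP; lra.
have yE : y = c%:C *: gns_vec.
  apply: hilb_eq => w; rewrite -!hdot_gns_vec -{1 2}(starK w) -!gns_op_star.
  by rewrite linearZ hdotZl yc.
have -> : gns_vec = (c^-1)%:C *: y.
  by rewrite yE scalerA -rmorphM mulVf// scale1r.
exact: subspaceZ.
Qed.

(** [gns_irreducible] concerns invariance under all multipliers. If [S] is invariant under [A] only,
    the orthogonal complement of [A S] is invariant under multipliers, as [A] is an ideal there. If
    it is 0, then [S] is everything, because the complement of [S] lies in it; if it is everything,
    then [A S = 0], and [S = 0] by nondegeneracy. *)
Lemma gns_nonzero_irreducible a0 : 0 < q (lmult (cmul (star a0) a0)) ->
  nonzero_irreducible gns_rep /\ exists x, gns_rep a0 x <> 0.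
Proof.
move=> q0; have nz : gns_rep a0 gns_vec <> 0.
  move=> z0; pose y := gns_op (lmult a0) gns_vec.
  have : hdot y y = 0 by rewrite [y]z0 hdot0l.
  rewrite -gns_op_star -gns_opM -lmult_star -lmultM.
  rewrite hdot_gns_vec_vec => /(congr1 (@complex.Re R))/= qz.
  by rewrite qz ltxx in q0.
split; last by exists gns_vec.
split; [exact: gns_is_representation|by exists a0, gns_vec|].
have mulA m a : exists b, m * lmult a = lmult b by exists (m a); exact: lmult_mul.
pose orth (T : set H) := [set x : H | forall y : H, T y -> hdot x y = 0].
have closed_orth T : closed_subspace (orth T).
  split.
  - apply/closed_nr => x xT t Tt; apply: cn_le_eq0 => e e0.
    have t1 : 0 < nr t + 1 by rewrite ltr_wpDl// nr_ge0.
    have [s sT] := xT (e / (nr t + 1)) (divr_gt0 e0 t1); rewrite ler_pdivlMr// => xs.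
    have -> : hdot x t = hdot (x - s) t by rewrite hdotBl (sT t Tt) subr0.
    by apply: (le_trans (hdot_bound _ _)); have := nr_ge0 (x - s); lra.
  - by move=> t _; rewrite hdot0l.
  - by move=> c x y xT yT t Tt; rewrite hdotDl hdotZl xT// yT// mulr0 addr0.
(* A vector killed by [A] lies in the orthogonal complement of [A H], which is not everything
   because [a0] acts nontrivially. *)
have nondeg x : (forall a, gns_rep a x = 0) -> x = 0.
  move=> xz; pose T := [set t : H | exists a y, t = gns_rep a y].
  have [||T0|TT] := @gns_irreducible (orth T).
  - exact: closed_orth.
  - move=> m y yT t [a [w ->]]; rewrite -(starK m) gns_op_star.
    have [b mb] := mulA (star m) a.
    by apply: yT; exists b, w; rewrite /gns_rep -gns_opM mb.
  - have : (orth T) x.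
      move=> _ [a [y ->]]; rewrite /gns_rep /= -[lmult a]starK -lmult_star.
      by rewrite -gns_op_star starK -/(gns_rep (star a)) xz hdot0l.
    by rewrite T0.
  - exfalso; apply: nz.
    have : (orth T) (gns_rep a0 gns_vec) by rewrite TT.
    move=> /(_ (gns_rep a0 gns_vec)) h; apply/nr0_eq0/eqP; rewrite -sqrf_eq0.
    by rewrite -Re_hdot_nr h//; exists a0, gns_vec.
move=> S Ssub Sinv.
pose T := [set t : H | exists2 s, S s & exists a, t = gns_rep a s].
have [||T0|TT] := @gns_irreducible (orth T).
- exact: closed_orth.
- move=> m x xT t [s Ss [a ->]]; rewrite -(starK m) gns_op_star.
  have [b mb] := mulA (star m) a.
  by apply: xT; exists s => //; exists b; rewrite /gns_rep -gns_opM mb.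
- right; apply/seteqP; split=> // x _; have [y Sy yort] := projection x Ssub.
  have : (orth T) (x - y).
    by move=> t [s Ss [a ->]]; apply: yort; exact: Sinv.
  by rewrite T0 => /eqP; rewrite subr_eq0 => /eqP ->.
- left; apply/seteqP; split=> [s Ss|_ ->]; last by case: Ssub.
  apply: nondeg => a.
  have : (orth T) (gns_rep a s) by rewrite TT.
  move=> /(_ (gns_rep a s)) h; apply/nr0_eq0/eqP; rewrite -sqrf_eq0.
  by rewrite -Re_hdot_nr h//; exists s => //; exists a.
Qed.

End GNS.

(** * Separating a point from a closed ideal by a primitive ideal *)

Section IdealsArePrimitiveIntersections.
Context {R : realType} {A : cstarAlgType R}.

Section KernelIdeal.
Context {H : hilbertType R}.
Variable pi : A -> {linear H -> H}.
Hypothesis pi_rep : is_representation pi.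

Local Notation K := [set a : A | forall x, pi a x = 0].

Lemma repr_kernel_closed : closed_subspace K.
Proof.
split.
- apply/closed_nr => a aK x; apply: nr_le_eq0 => e e0.
  have x1 : 0 < nr x + 1 by rewrite ltr_wpDl// nr_ge0.
  have [b bK] := aK (e / (nr x + 1)) (divr_gt0 e0 x1); rewrite ler_pdivlMr// => ab.
  have -> : pi a x = pi (a - b) x by rewrite (reprB pi_rep) bK subr0.
  by apply: (le_trans (repr_bound pi_rep _ _)); have := nr_ge0 (a - b); lra.
- by move=> x; exact: (repr0 pi_rep).
- by move=> c a b Ka Kb x; rewrite (repr_linear pi_rep) Ka Kb scaler0 addr0.
Qed.

Lemma repr_kernel_mull a b : K b -> K (cmul a b).
Proof. by move=> Kb x; rewrite (repr_mul pi_rep) Kb linear0. Qed.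

Lemma repr_kernel_mulr a b : K a -> K (cmul a b).
Proof. by move=> Ka x; rewrite (repr_mul pi_rep) Ka. Qed.

Lemma repr_kernel_star a : K a -> K (star a).
Proof.
by move=> Ka x; apply: hdot_eq0 => y; rewrite (repr_star pi_rep) Ka hdot0r.
Qed.

Definition repr_kernel : closed_ideal A :=
  ClosedIdeal repr_kernel_closed repr_kernel_mull repr_kernel_mulr
    repr_kernel_star.

End KernelIdeal.

Theorem primitive_separation (I : closed_ideal A) (a : A) : ~ ideal_set I a ->
  exists p : Prim A, ideal_set I `<=` ideal_set p /\ ~ ideal_set p a.
Proof.
move=> Ia; have [q [qs q0 qext]] := pure_state_exists Ia.
have [irr [x ax]] := gns_nonzero_irreducible qs qext q0.
have rep := gns_is_representation qs.
have prim : primitive (repr_kernel rep) by exists (hilb (gns_form qs)), (gns_rep qs).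
exists (MkPrim prim); split; last by move=> /(_ x).
by move=> i Ii y; exact: gns_rep_ideal.
Qed.

End IdealsArePrimitiveIntersections.

(** * Open sets, ideals and the two functors *)

Section OpensAndIdeals.
Context {R : realType} {A : cstarAlgType R}.
Implicit Types (I J : closed_ideal A) (W : set (Prim A)).

Lemma closed_ideal_eq I J : (I : set A) = J -> I = J.
Proof.
case: I J => [I I1 I2 I3 I4] [J J1 J2 J3 J4] /= IJ.
by case: _ / IJ J1 J2 J3 J4 => *; congr ClosedIdeal; exact: Prop_irrelevance.
Qed.

Lemma kernelP (T : set (Prim A)) (a : A) :
  ideal_set (kernel T) a <-> forall p : Prim A, T p -> ideal_set p a.
Proof. by []. Qed.

Definition open_of_ideal I : set (Prim A) := [set p : Prim A | ~ (I `<=` p)].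

Lemma open_open_of_ideal I : open (open_of_ideal I).
Proof.
rewrite -closedC; apply/closed_hull_kernel => p kp.
have kerI : (I : set A) `<=` kernel (~` open_of_ideal I).
  by move=> a Ia; apply/kernelP => s /contrapT Is; exact: Is.
by move=> /(_ (subset_trans kerI kp)).
Qed.

(** A closed ideal is the intersection of the primitive ideals containing it; the nontrivial
    inclusion is [primitive_separation]. *)
Lemma open_of_idealK I : ideal_of_open (open_of_ideal I) = I.
Proof.
apply: closed_ideal_eq; apply/seteqP; split=> a; last first.
  by move=> Ia; apply/kernelP => p /contrapT Ip; exact: Ip.
move=> /kernelP ka.
apply: contrapT => /primitive_separation[p [Ip pa]]; apply: pa.
by apply: (ka p) => /(_ Ip).
Qed.

Lemma ideal_of_openK W : open W -> open_of_ideal (ideal_of_open W) = W.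
Proof.
move=> oW; apply/seteqP; split=> [p|p Wp kp]; last first.
  have /closed_hull_kernel cW : closed (~` W) by rewrite closedC.
  exact: cW kp Wp.
by apply: contra_notP => Wp a; exact.
Qed.

End OpensAndIdeals.

Section SubbasicSets.
Variable X : topologicalType.

HB.instance Definition _ := gen_eqMixin (opens X).
HB.instance Definition _ := gen_choiceMixin (opens X).

Lemma open_Ysup (F : set (opens X)) : finite_set F -> open (Ysup F).
Proof.
move=> fF; apply/open_power_opens; exists [set F]; first by move=> _ ->.
by rewrite bigcup_set1.
Qed.

(** These sets form a subbasis; an algebra over the power set gets its ideal at [U] from
    [Ysup1 U]. *)
Definition Ysup1 (U : opens X) : opens (power_opens X) :=
  exist _ (Ysup [set U]) (open_Ysup (finite_set1 U)).

Lemma Ysup1P (U : opens X) (y : power_opens X) : sval (Ysup1 U) y <-> y U.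
Proof. by split=> [|yU _ ->//]; exact. Qed.

End SubbasicSets.

(** By proof irrelevance the induced equality of indices is [erefl], so no transport remains. *)
Lemma existT_inj (T : Type) (P : T -> Type) (t : T) (a b : P t) :
  existT P t a = existT P t b -> a = b.
Proof.
by move=> e; have := projT2_eq e; rewrite (Prop_irrelevance (projT1_eq e) erefl).
Qed.

(** Images of an arrow under [F] and [G] have different types until the objects are identified;
    pairing each with its endpoints lets them be compared without casts. *)
Lemma functor_eq (C D : category) (F G : functor C D) :
  (forall x, fob F x = fob G x) ->
  (forall x y (f : Defs.Hom x y),
    existT (fun p : Ob D * Ob D => Defs.Hom p.1 p.2)
      (fob F x, fob F y) (Defs.fmap F f) =
    existT (fun p : Ob D * Ob D => Defs.Hom p.1 p.2)
      (fob G x, fob G y) (Defs.fmap G f)) ->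
  F = G.
Proof.
case: F G => [Fo Fm F1 F2] [Go Gm G1 G2] /= /funext FG.
case: _ / FG Gm G1 G2 => Gm G1 G2 FGm.
have : Fm = Gm.
  apply: functional_extensionality_dep => x.
  apply: functional_extensionality_dep => y.
  by apply: functional_extensionality_dep => f; exact: existT_inj (FGm x y f).
move=> FGm'; case: _ / FGm' G1 G2 {FGm} => G1 G2.
by congr Functor; exact: Prop_irrelevance.
Qed.

(** * The two functors and their composites *)

Section Functors.
Variables (R : realType) (X : topologicalType).

Definition ideal_map_prim (A : cstarAlgType R) (f : opens X -> closed_ideal A)
  (p : Prim A) : power_opens X := [set U | open_of_ideal (f U) p].

(** The preimage of a basic set is an intersection of open sets indexed by [F], which is open
    because [F] is finite. *)
Lemma ideal_map_prim_continuous A f : continuous (@ideal_map_prim A f).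
Proof.
apply/continuousP => _ /open_power_opens[D Dfin <-].
rewrite preimage_bigcup; apply: bigcup_open => F /Dfin fF.
have -> : ideal_map_prim f @^-1` Ysup F =
    \bigcap_(U in F) open_of_ideal (f U) by apply/seteqP; split.
by rewrite -closedC setC_bigcap; apply: closed_bigcup => // U _;
  rewrite closedC; exact: open_open_of_ideal.
Qed.

Definition over_of_map (x : ideal_map_algebra R X) :
    algebra_over R (power_opens X) :=
  AlgebraOver (@ideal_map_prim_continuous _ (@ima_map R X x)).

Definition map_of_over (y : algebra_over R (power_opens X)) :
    ideal_map_algebra R X :=
  IdealMapAlgebra (fun U => over_ideal y (Ysup1 U)).

Lemma over_ideal_primP (y : algebra_over R (power_opens X))
    (V : opens (power_opens X)) (p : Prim (over_alg y)) :
  ~ (over_ideal y V `<=` p) <-> sval V (over_map p).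
Proof.
have oV : open (@over_map _ _ y @^-1` sval V).
  by apply: open_comp (svalP V) => x _; exact: over_continuous.
by have /seteqP[h1 h2] := ideal_of_openK oV; split; [exact: h1|exact: h2].
Qed.

Lemma over_map_ima (x : ideal_map_algebra R X) (U : opens X) :
  over_ideal (over_of_map x) (Ysup1 U) = ima_map x U.
Proof.
rewrite /over_ideal -[RHS]open_of_idealK; congr ideal_of_open.
apply/seteqP; split=> p.
  exact: (proj1 (Ysup1P _ _)).
exact: (proj2 (Ysup1P _ _)).
Qed.

(* The preimage of a primitive ideal under a *-homomorphism is the kernel of a
   representation, hence closed, hence an intersection of primitive ideals;
   this is what handles unions of basic open sets. *)
Lemma ideal_map_hom_over (x y : ideal_map_algebra R X)
    (h : star_hom (ima_alg x) (ima_alg y)) :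
  (forall U, h @` ima_map x U `<=` ima_map y U) ->
  forall V, h @` over_ideal (over_of_map x) V `<=` over_ideal (over_of_map y) V.
Proof.
move=> hU V _ [a xa <-]; apply/kernelP => p pV.
have [H [pi [[pi_rep _ _] pE]]] := prim_primitive p.
have pih_rep : is_representation (fun b => pi (h b)).
  split=> [b|c b d z|b d z|b u v]; first exact: repr_continuous.
  - by rewrite star_hom_linear (repr_linear pi_rep).
  - by rewrite star_hom_mul (repr_mul pi_rep).
  - by rewrite star_hom_star (repr_star pi_rep).
suff : ideal_set (repr_kernel pih_rep) a by rewrite pE.
(* A primitive [r] containing the preimage of [p] contains [a] unless it lies over [V]; but if [r]
   lies over a basic set in [V], so does [p]. *)
apply: contrapT => /primitive_separation[r [Ir ra]]; apply: ra.
apply: (proj1 (kernelP _ _) xa) => Vr; apply: pV; move: Vr.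
have /open_power_opens[D Dfin DV] := svalP V.
rewrite /= -DV => -[F DF Fr]; exists F => //.
move=> U FU pU; apply: (Fr U FU) => b Ub; apply: Ir.
have : ideal_set p (h b) by apply: pU; apply: hU; exists b.
by rewrite pE.
Qed.

Definition to_over_hom (x y : ideal_map_algebra R X)
    (h : @Defs.Hom (ideal_map_category R X) x y) :
    @Defs.Hom (algebra_over_category R (power_opens X))
      (over_of_map x) (over_of_map y) :=
  @IdealHom R _ _ _ (@over_ideal R (power_opens X))
    (over_of_map x) (over_of_map y)
    (ideal_hom_fun h) (ideal_map_hom_over (@ideal_hom_sub _ _ _ _ _ _ _ h)).

Lemma over_hom_ima (x y : algebra_over R (power_opens X))
    (h : @Defs.Hom (algebra_over_category R (power_opens X)) x y) (U : opens X) :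
  ideal_hom_fun h @` @ima_map R X (map_of_over x) U `<=`
    @ima_map R X (map_of_over y) U.
Proof. by case: h => h hs; exact: (hs (Ysup1 U)). Qed.

Definition to_map_hom (x y : algebra_over R (power_opens X))
    (h : @Defs.Hom (algebra_over_category R (power_opens X)) x y) :
    @Defs.Hom (ideal_map_category R X) (map_of_over x) (map_of_over y) :=
  @IdealHom R _ _ _ (@ima_map R X) (map_of_over x) (map_of_over y)
    (ideal_hom_fun h) (@over_hom_ima x y h).

Program Definition to_over_functor :
    functor (ideal_map_category R X) (algebra_over_category R (power_opens X)) :=
  @Functor (ideal_map_category R X) (algebra_over_category R (power_opens X))
    over_of_map to_over_hom _ _.
Next Obligation. by move=> x; exact: ideal_hom_eq. Qed.
Next Obligation. by move=> x y z g f; exact: ideal_hom_eq. Qed.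

Program Definition to_map_functor :
    functor (algebra_over_category R (power_opens X)) (ideal_map_category R X) :=
  @Functor (algebra_over_category R (power_opens X)) (ideal_map_category R X)
    map_of_over to_map_hom _ _.
Next Obligation. by move=> x; exact: ideal_hom_eq. Qed.
Next Obligation. by move=> x y z g f; exact: ideal_hom_eq. Qed.

(** The objects are spelled with constructors so that equations between their fields can be
    eliminated before the two arrows are compared. *)
Lemma existT_ima_hom (A B : cstarAlgType R) (f f' : opens X -> closed_ideal A)
    (g g' : opens X -> closed_ideal B)
    (h : @Defs.Hom (ideal_map_category R X) (IdealMapAlgebra f) (IdealMapAlgebra g))
    (h' : @Defs.Hom (ideal_map_category R X)
      (IdealMapAlgebra f') (IdealMapAlgebra g')) :
  f = f' -> g = g' -> (ideal_hom_fun h : A -> B) = ideal_hom_fun h' ->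
  existT (fun p : Ob (ideal_map_category R X) * Ob (ideal_map_category R X) =>
      Defs.Hom p.1 p.2) (IdealMapAlgebra f, IdealMapAlgebra g) h =
  existT _ (IdealMapAlgebra f', IdealMapAlgebra g') h'.
Proof.
move=> ff' gg'; case: _ / ff' h'; case: _ / gg' => h' hh'.
by congr existT; exact: ideal_hom_eq.
Qed.

Lemma existT_over_hom (A B : cstarAlgType R)
    (f f' : Prim A -> power_opens X) (g g' : Prim B -> power_opens X)
    (cf : continuous f) (cf' : continuous f') (cg : continuous g)
    (cg' : continuous g')
    (h : @Defs.Hom (algebra_over_category R (power_opens X))
      (AlgebraOver cf) (AlgebraOver cg))
    (h' : @Defs.Hom (algebra_over_category R (power_opens X))
      (AlgebraOver cf') (AlgebraOver cg')) :
  f = f' -> g = g' -> (ideal_hom_fun h : A -> B) = ideal_hom_fun h' ->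
  existT (fun p : Ob (algebra_over_category R (power_opens X)) *
        Ob (algebra_over_category R (power_opens X)) =>
      Defs.Hom p.1 p.2) (AlgebraOver cf, AlgebraOver cg) h =
  existT _ (AlgebraOver cf', AlgebraOver cg') h'.
Proof.
move=> ff' gg'; case: _ / ff' cf' h'; case: _ / gg' cg' => cg' cf'.
rewrite (Prop_irrelevance cf' cf) (Prop_irrelevance cg' cg) => h' hh'.
by congr existT; exact: ideal_hom_eq.
Qed.

Lemma algebra_over_eq (A : cstarAlgType R) (f g : Prim A -> power_opens X)
    (cf : continuous f) (cg : continuous g) :
  f = g -> AlgebraOver cf = AlgebraOver cg.
Proof.
by move=> fg; case: _ / fg cg => cg; congr AlgebraOver; exact: Prop_irrelevance.
Qed.

Lemma map_of_overK (x : ideal_map_algebra R X) :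
  ima_map (map_of_over (over_of_map x)) = ima_map x.
Proof. by apply/funext => U; exact: over_map_ima. Qed.

Lemma over_of_mapK (y : algebra_over R (power_opens X)) :
  @over_map _ _ (over_of_map (map_of_over y)) = @over_map _ _ y.
Proof.
apply/funext => p; apply/seteqP; split=> U.
  by move=> /over_ideal_primP/Ysup1P.
by move=> pU; apply/over_ideal_primP/Ysup1P.
Qed.

Lemma to_map_to_over : functor_comp to_map_functor to_over_functor =
  functor_id (ideal_map_category R X).
Proof.
apply: functor_eq => [[A f]|[A f] [B g] h].
  congr IdealMapAlgebra; exact: (map_of_overK (IdealMapAlgebra f)).
apply: existT_ima_hom => //.
  exact: (map_of_overK (IdealMapAlgebra f)).
exact: (map_of_overK (IdealMapAlgebra g)).
Qed.

Lemma to_over_to_map : functor_comp to_over_functor to_map_functor =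
  functor_id (algebra_over_category R (power_opens X)).
Proof.
apply: functor_eq => [y|x y h].
  case: y => A f cf; apply: algebra_over_eq.
  exact: (over_of_mapK (AlgebraOver cf)).
case: x y h => [A f cf] [B g cg] h; apply: existT_over_hom => //.
  exact: (over_of_mapK (AlgebraOver cf)).
exact: (over_of_mapK (AlgebraOver cg)).
Qed.

End Functors.

Theorem theorem2p42 (R : realType) (X : topologicalType) :
  isomorphic_categories (ideal_map_category R X)
    (algebra_over_category R (power_opens X)).
Proof.
exists (to_over_functor R X), (to_map_functor R X).
by split; [exact: to_map_to_over|exact: to_over_to_map].
Qed.
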